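(* For $i\in\{0,1,2\}$ let $0<p_i,q_i,r_i\le\infty$ and $\beta_i\in\mathbb{R}$, and assume $$\tfrac1{p_0}=\tfrac1{p_1}+\tfrac1{p_2},\quad \tfrac1{q_0}=\tfrac1{q_1}+\tfrac1{q_2},\quad \tfrac1{r_0}=\tfrac1{r_1}+\tfrac1{r_2},\quad \beta_0=\beta_1+\beta_2$$ (with $1/\infty=0$). Then both the multiplication $T^{p_0,r_0}_{q_0,\beta_0}\leftarrow T^{p_1,r_1}_{q_1,\beta_1}\cdot T^{p_2,r_2}_{q_2,\beta_2}$ and the factorization $T^{p_0,r_0}_{q_0,\beta_0}\rightarrow T^{p_1,r_1}_{q_1,\beta_1}\cdot T^{p_2,r_2}_{q_2,\beta_2}$ hold.
   Context: Let $\mathbb{R}^{n+1}_+=\mathbb{R}^n\times(0,\infty)$; functions are complex-valued measurable, identified a.e. $B(y,t)=\{z:|z-y|<t\}$, $\Gamma(x)=\{(y,t):|y-x|<t\}$, $\widehat{B}=\{(y,t):B(y,t)\subset B\}$ for an open ball $B\subset\mathbb{R}^n$. Fix Whitney parameters $0<\alpha_1<\alpha_2^{-1}<1$, $W(y,t)=\{(z,s):|z-y|<\alpha_1t,\ \alpha_2^{-1}t<s<\alpha_2t\}$, $\mathcal{W}_r(f)(y,t)=|W(y,t)|^{-1/r}\|f\|_{L^r(W(y,t))}$ ($r<\infty$), $\mathcal{W}_\infty(f)(y,t)=\operatorname{ess\,sup}_{W(y,t)}|f|$. Tent spaces $T^p_q$: (A) $p,q<\infty$: $\|g\|=\|(\iint_{\Gamma(x)}|g|^q\,dy\,dt/t^{n+1})^{1/q}\|_{L^p(dx)}$;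 (B) $q<p=\infty$: $\|g\|=\sup_x\sup_{B\ni x}|B|^{-1/q}(\iint_{\widehat B}|g|^q\,dy\,dt/t)^{1/q}$; (C) $p<q=\infty$: $\|g\|=\|\sup_{(y,t)\in\Gamma(x)}|g(y,t)|\|_{L^p(dx)}$; (D) $T^\infty_\infty=L^\infty$. $\|f\|_{T^{p,r}_q}=\|\mathcal{W}_r(f)\|_{T^p_q}$ and $\|f\|_{T^{p,r}_{q,\beta}}=\|f(z,s)s^{-\beta}\|_{T^{p,r}_q}$. Multiplication $X_0\leftarrow X_1\cdot X_2$: for all $f_i\in X_i$, $f_1f_2\in X_0$ and $\|f_1f_2\|_{X_0}\le C\|f_1\|_{X_1}\|f_2\|_{X_2}$. Factorization $X_0\rightarrow X_1\cdot X_2$: every $f_0\in X_0$ admits $f_i\in X_i$ with $|f_0|=|f_1||f_2|$ a.e. and $\|f_1\|_{X_1}\|f_2\|_{X_2}\le C\|f_0\|_{X_0}$; constants independent of the functions. *)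

(* Defs.v *)
From HB Require Import structures.
From mathcomp Require Import all_boot all_order all_algebra.
From mathcomp Require Import all_classical all_reals all_analysis.
From mathcomp.real_closed Require Import complex.
Set Implicit Arguments.
Unset Strict Implicit.
Unset Printing Implicit Defensive.
Import Order.TTheory GRing.Theory Num.Theory.
Local Open Scope classical_set_scope.
Local Open Scope ring_scope.

Section TentSpaces.
Variable R : realType.

(** Points of R^n are n-tuples of reals; R^n carries the product (Borel)
    sigma-algebra given by mathcomp-analysis's tuple instance. *)

(** Lebesgue integral of a nonnegative function over R^n, written as the
    iterated one-dimensional Lebesgue integral (Tonelli). *)
Fixpoint int_Rn (n : nat) : (n.-tuple R -> \bar R) -> \bar R :=
  match n with
  | 0 => fun F => F [tuple]
  | m.+1 => fun F =>
      (\int[@lebesgue_measure R]_x int_Rn (fun y => F (cons_tuple x y)))%E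
  end.

Definition leb_n (n : nat) (A : set (n.-tuple R)) : \bar R :=
  int_Rn (fun y => (\1_A y)%:E).

Definition intH (n : nat) (F : n.-tuple R * R -> \bar R) : \bar R :=
  (\int[@lebesgue_measure R]_(t in `]0%R, +oo[%classic)
      int_Rn (fun y => F (y, t)))%E.

Definition measH (n : nat) (A : set (n.-tuple R * R)) : \bar R :=
  intH (fun p => (\1_A p)%:E).

Definition upper (n : nat) : set (n.-tuple R * R) := [set p | 0 < p.2].

Definition esssupH (n : nat) (A : set (n.-tuple R * R))
    (g : n.-tuple R * R -> \bar R) : \bar R :=
  ereal_inf [set M : \bar R | measH [set p | A p /\ (M < g p)%E] = 0%E].

Definition edist (n : nat) (y z : n.-tuple R) : R :=
  Num.sqrt (\sum_(i < n) (tnth y i - tnth z i) ^+ 2).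

Definition eball (n : nat) (y : n.-tuple R) (t : R) : set (n.-tuple R) :=
  [set z | edist z y < t].

Definition cone (n : nat) (x : n.-tuple R) : set (n.-tuple R * R) :=
  [set p | 0 < p.2 /\ edist p.1 x < p.2].

Definition tent (n : nat) (B : set (n.-tuple R)) : set (n.-tuple R * R) :=
  [set p | 0 < p.2 /\ eball p.1 p.2 `<=` B].

Definition whitney (a1 a2 : R) (n : nat) (p : n.-tuple R * R)
    : set (n.-tuple R * R) :=
  [set q | edist q.1 p.1 < a1 * p.2 /\ a2^-1 * p.2 < q.2 < a2 * p.2].

(** Exponents in (0, oo] are represented in \bar R; 1/oo = 0. *)
Definition einv (p : \bar R) : R := if p == +oo%E then 0 else (fine p)^-1.

Definition whitney_avg (a1 a2 : R) (n : nat) (r : \bar R)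
    (h : n.-tuple R * R -> \bar R) (p : n.-tuple R * R) : \bar R :=
  let W := whitney a1 a2 p in
  if r == +oo%E then esssupH W h
  else poweR (((fine (measH W))^-1)%:E
          * intH (fun q => ((\1_W q)%:E * poweR (h q) (fine r))%E))%E
         (fine r)^-1.

Definition tent_norm (n : nat) (p q : \bar R)
    (g : n.-tuple R * R -> \bar R) : \bar R :=
  if (p != +oo%E) && (q != +oo%E) then
    poweR (int_Rn (fun x =>
       poweR (intH (fun z => (\1_(cone x) z)%:E
                     * (poweR (g z) (fine q) * ((z.2 ^+ n.+1)^-1)%:E))%E)
         (fine p / fine q)))
      (fine p)^-1
  else if (p == +oo%E) && (q != +oo%E) then
    ereal_sup [set v : \bar R | exists x c (rho : R), 0 < rho /\
       eball c rho x /\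
       v = poweR (((fine (leb_n (eball c rho)))^-1)%:E
              * intH (fun z => (\1_(tent (eball c rho)) z)%:E
                     * (poweR (g z) (fine q) * (z.2^-1)%:E))%E)%E (fine q)^-1]
  else if (p != +oo%E) && (q == +oo%E) then
    poweR (int_Rn (fun x => poweR (ereal_sup (g @` cone x)) (fine p)))
      (fine p)^-1
  else
    esssupH (@upper n) g.

Definition wtent_norm (a1 a2 : R) (n : nat) (p q r : \bar R) (beta : R)
    (f : n.-tuple R * R -> R[i]) : \bar R :=
  tent_norm p q
    (whitney_avg a1 a2 r (fun z => (Normc.normc (f z) * powR z.2 (- beta))%:E)).

Definition cmeasurable (n : nat) (f : n.-tuple R * R -> R[i]) : Prop :=
  measurable_fun (@upper n) (fun z => complex.Re (f z)) /\
  measurable_fun (@upper n) (fun z => complex.Im (f z)).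

Definition in_wtent (a1 a2 : R) (n : nat) (p q r : \bar R) (beta : R)
    (f : n.-tuple R * R -> R[i]) : Prop :=
  cmeasurable f /\ (wtent_norm a1 a2 p q r beta f < +oo)%E.

End TentSpaces.

(* Main.v *)
(** The half-space is cut into Whitney boxes [wbox m j]: level [m] is the layer
    [scale m <= t < a2 * scale m], divided into triadic cells of side comparable
    to [scale m].  A function is replaced by the numbers [a m j], the infima of its
    Whitney averages over the boxes; these dominate its local L^r means.

    In all four cases, a bound [K] for the tent norm is equivalent, up to constants,
    to a certificate: sets [E m] filling a fixed fraction of every cell of level
    [m], and [g] in the unit ball of L^p, such that at every point the l^q norm of
    [(a m * 1_(E m))_m] is at most [K * g].  A bound yields a certificate by taking
    for [g] the area function or the maximal function, or, when p = oo, by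
    Chebyshev's inequality in the Carleson condition.  Conversely the sets [E m] may
    be removed, since on a tree of cells a fixed fraction of a cell is as good as
    the whole cell, and neighbouring boxes are reached by finitely many shifted
    grids.

    Certificates multiply by Hoelder's inequality at each point.  For the
    factorization write 1/p_i = s_i/p_0, 1/q_i = t_i/q_0, 1/r_i = k_i/r_0, let [M] be
    the median of [g] on each cell, and take
    [f_i = (f / a)^k_i * a^t_i * (K M)^(s_i - t_i)] on each box.  As [g] is at least,
    resp. at most, [M] on half of the cell, [g^s_i] certifies the i-th factor. *)

Require Import Defs.
From HB Require Import structures.
From mathcomp Require Import all_boot all_order all_algebra.
From mathcomp Require Import all_classical all_reals all_analysis.
From mathcomp Require Import measurable_realfun.
From mathcomp.real_closed Require Import complex.
From mathcomp Require Import lra ring zify.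
Import Order.TTheory GRing.Theory Num.Theory.
Set Implicit Arguments.
Unset Strict Implicit.
Unset Printing Implicit Defensive.
Local Open Scope classical_set_scope.
Local Open Scope ring_scope.

(** * Integration over the half-space *)

(** Two obstacles shape the proof. The first is measurability: [tent_norm] is applied to Whitney
    averages, which are never shown to be measurable. Upper bounds therefore use only the
    monotonicity of the integral, valid for all nonnegative functions, and lower bounds pass to
    infima over boxes, which are constant on cells and so measurable. The second is the range of
    exponents: below 1 there is no duality and no maximal inequality. The sets [E m] are removed
    instead by telescoping powers of partial sums along nested partitions, by concavity if p/q <= 1
    and by convexity with absorption if p/q >= 1. Infinite exponents enter Hölder's inequality
    through gauges with values 0 and [+oo], so that one pointwise inequality serves the spatial, the
    level and the local exponents.

    The fraction 3/4 in the certificates is large enough to be intersected once more: two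
    certificates share at least 1/2 of each cell, and one certificate shares at least 1/4 with
    either side of a median. Powers of 3 are needed because half-shifted grids are nested under
    tripling, not under doubling. *)

Section MonotoneFunctional.
Context d (T : measurableType d) (R : realType) (I : (T -> \bar R) -> \bar R).
Hypothesis I_ge0 : forall f, (forall x, 0 <= f x)%E -> (0 <= I f)%E.
Hypothesis I_le : forall f g, (forall x, 0 <= f x)%E ->
  (forall x, f x <= g x)%E -> (I f <= I g)%E.
Hypothesis I_scale : forall (k : R) (f : T -> \bar R), 0 <= k -> measurable_fun [set: T] f ->
  (forall x, 0 <= f x)%E -> I (fun x => k%:E * f x)%E = (k%:E * I f)%E.
Hypothesis I_add : forall f g : T -> \bar R, measurable_fun [set: T] f -> measurable_fun [set: T] g ->
  (forall x, 0 <= f x)%E -> (forall x, 0 <= g x)%E ->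
  I (fun x => f x + g x)%E = (I f + I g)%E.
Hypothesis I_mct : forall g : (T -> \bar R)^nat,
  (forall k, measurable_fun [set: T] (g k : T -> \bar R)) -> (forall k x, 0 <= g k x)%E ->
  (forall x, {homo g^~ x : k l / (k <= l)%N >-> (k <= l)%E}) ->
  I (fun x => limn (g^~ x)) = limn (fun k => I (g k)).

Lemma functional0 : I (fun=> 0%E) = 0%E.
Proof.
have /= := @I_scale 0 (fun=> 0%E) (lexx _) (measurable_cst _) (fun=> lexx _).
by under eq_fun do rewrite mul0e; rewrite mul0e.
Qed.

Lemma functional_sum J (s : seq J) (f : J -> T -> \bar R) :
  (forall j, measurable_fun [set: T] (f j)) -> (forall j x, 0 <= f j x)%E ->
  I (fun x => \sum_(j <- s) f j x)%E = (\sum_(j <- s) I (f j))%E.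
Proof.
move=> mf f0; elim: s => [|j s IH].
  by under eq_fun do rewrite big_nil; rewrite big_nil functional0.
under eq_fun do rewrite big_cons; rewrite big_cons I_add ?IH//.
- exact: emeasurable_sum.
- by move=> x; exact: sume_ge0.
Qed.

(** Indicators of finite disjoint unions are finite sums, which increase to the indicator of the
    whole union; additivity and [I_mct] conclude. This is how the iterated integrals [leb_n] and
    [measH] become measures. *)
Lemma functional_semi_sigma_additive :
  semi_sigma_additive (fun A : set T => I (fun x => (\1_A x)%:E)).
Proof.
move=> F mF tF mUF; pose m := fun A : set T => I (fun x => (\1_A x)%:E).
have mI k : measurable_fun [set: T] (fun x : T => (\1_(F k) x : R)%:E).
  by apply/measurable_EFinP; exact: measurable_indic.
have I0 k x : (0 <= (\1_(F k) x : R)%:E)%E by rewrite lee_fin.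
rewrite (_ : (fun k => _) =
    (fun k => I (fun x => (\sum_(0 <= i < k) (\1_(F i) x)%:E)%E))); last first.
  by apply/funext => k; rewrite functional_sum.
rewrite (_ : I _ = limn (fun k => I (fun x => (\sum_(0 <= i < k) (\1_(F i) x)%:E)%E))).
  apply: ereal_nondecreasing_is_cvgn => k l kl; apply: I_le => x.
    by apply: sume_ge0.
  by apply: lee_sum_nneg_natr.
rewrite -I_mct//.
- by congr I; apply/funext => x; rewrite indic_bigcup.
- by move=> k; apply: emeasurable_sum.
- by move=> k x; apply: sume_ge0.
- by move=> x k l kl; apply: lee_sum_nneg_natr.
Qed.

Import HBNNSimple.

(** Agreement on indicators extends to simple functions by linearity and to nonnegative measurable
    functions by monotone approximation. Integration theory for measures thereby applies to [int_Rn]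
    and [intH]. *)
Lemma functional_integral (mu : {measure set T -> \bar R}) :
  (forall A, mu A = I (fun x => (\1_A x)%:E)) ->
  forall f : T -> \bar R, measurable_fun [set: T] f -> (forall x, 0 <= f x)%E ->
  (\int[mu]_x f x)%E = I f.
Proof.
move=> muI f mf f0.
pose g := nnsfun_approx measurableT mf.
have gI k : sintegral mu (g k) = I (fun x => (g k x)%:E).
  rewrite sintegralE.
  rewrite [in RHS](_ : (fun x => (g k x)%:E) = fun x =>
     (\sum_(r <- finmap.enum_fset (fset_set (range (g k)))) (r * \1_(g k @^-1` [set r]) x)%:E)%E).
    rewrite functional_sum.
    - rewrite fsbig_finite//=; apply: eq_big_seq => r.
      rewrite in_fset_set// inE => -[x _ <-].
      under eq_fun do rewrite EFinM.
      rewrite I_scale ?muI//.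
      by apply/measurable_EFinP; apply: measurable_indic.
    - move=> r; apply/measurable_EFinP; apply: measurable_funM => //.
    - move=> r x; rewrite lee_fin indicE.
      case: (boolP (x \in g k @^-1` [set r])) => [/set_mem <-|_]; last by rewrite mulr0.
      by rewrite mulr1.
  apply/funext => x; rewrite sumEFin; congr EFin.
  by rewrite {1}(fimfunE (g k)) fsbig_finite.
rewrite (@nd_ge0_integral_lim _ _ _ mu f g f0); last 2 first.
- by move=> x k l kl; exact: (lefP _ _ (nd_nnsfun_approx measurableT mf kl)).
- by move=> x; exact: cvg_nnsfun_approx.
rewrite (_ : f = fun x => limn (fun k => (g k x)%:E)); last first.
  by apply/funext => x; apply/esym/cvg_lim => //; exact: cvg_nnsfun_approx.
rewrite I_mct.
- by congr (limn _); apply/funext => k /=; rewrite gI.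
- by move=> k; apply/measurable_EFinP.
- by move=> k x; rewrite lee_fin.
- by move=> x k l kl; rewrite lee_fin; exact: (lefP _ _ (nd_nnsfun_approx measurableT mf kl)).
Qed.

End MonotoneFunctional.

(** The integral of a nonnegative function is a supremum over simple functions below it, hence
    monotone without measurability. The upper bounds on tent norms rely on this. *)
Lemma ge0_le_integral_nomeas d (T : measurableType d) (R : realType)
    (mu : {measure set T -> \bar R}) (D : set T) (f g : T -> \bar R) :
  (forall x, D x -> 0 <= f x)%E -> (forall x, D x -> f x <= g x)%E ->
  (\int[mu]_(x in D) f x <= \int[mu]_(x in D) g x)%E.
Proof.
move=> f0 fg; rewrite !ge0_integralE//; last first.
  by move=> x Dx; exact: le_trans (f0 _ Dx) (fg _ Dx).
apply: le_ereal_sup => _ [h hf <-]; exists h => // x.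
apply: le_trans (hf x) _; rewrite !patchE.
by case: ifPn => // /set_mem; exact: fg.
Qed.

Section IntRn.
Context (R : realType).
Implicit Types n : nat.

Lemma int_Rn_ge0 n (F : n.-tuple R -> \bar R) :
  (forall x, 0 <= F x)%E -> (0 <= int_Rn F)%E.
Proof.
elim: n F => [|n IH] F F0 /=; first exact: F0.
by apply: integral_ge0 => x _; apply: IH => y; exact: F0.
Qed.

Lemma int_Rn_le n (F G : n.-tuple R -> \bar R) : (forall x, 0 <= F x)%E ->
  (forall x, F x <= G x)%E -> (int_Rn F <= int_Rn G)%E.
Proof.
elim: n F G => [|n IH] F G F0 FG /=; first exact: FG.
apply: ge0_le_integral_nomeas => x _; first by apply: int_Rn_ge0 => y; exact: F0.
by apply: IH => y; [exact: F0|exact: FG].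
Qed.

(** The parameter space [T] is arbitrary so that the induction can move a coordinate into it,
    passing from [T] to [T * R]. *)
Lemma measurable_int_Rn n d (T : measurableType d) (F : T * n.-tuple R -> \bar R) :
  measurable_fun [set: T * n.-tuple R] F -> (forall x, 0 <= F x)%E ->
  measurable_fun [set: T] (fun x => int_Rn (fun y => F (x, y))).
Proof.
elim: n d T F => [|n IH] d T F mF F0 /=.
  by apply: (measurableT_comp mF); exact: measurable_fun_pair.
pose G := fun p : (T * R) * n.-tuple R => F (p.1.1, cons_tuple p.1.2 p.2).
have mG : measurable_fun [set: (T * R) * n.-tuple R] G.
  apply: (measurableT_comp mF); apply: measurable_fun_pair => /=.
    exact: (measurableT_comp measurable_fst measurable_fst).
  apply: (@measurable_cons _ _ _ _ (fun p => p.1.2) n (fun p => p.2)).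
    exact: (measurableT_comp measurable_snd measurable_fst).
  exact: measurable_snd.
have G0 x : (0 <= G x)%E by exact: F0.
have := IH _ _ G mG G0.
move=> /(@measurable_fun_fubini_tonelli_F _ _ T _ R (@lebesgue_measure R)
   (fun p : T * R => int_Rn (fun y => G (p, y)))).
by apply => x; exact: int_Rn_ge0.
Qed.

Lemma measurable_cons_section n (F : n.+1.-tuple R -> \bar R) x :
  measurable_fun [set: n.+1.-tuple R] F ->
  measurable_fun [set: n.-tuple R] (fun y => F (cons_tuple x y)).
Proof.
move=> mF; apply: (measurableT_comp mF).
exact: (@measurable_cons _ _ _ _ (cst x) n id).
Qed.

Lemma measurable_int_Rn_cons n (F : n.+1.-tuple R -> \bar R) :
  measurable_fun [set: n.+1.-tuple R] F -> (forall x, 0 <= F x)%E ->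
  measurable_fun [set: R] (fun x => int_Rn (fun y => F (cons_tuple x y))).
Proof.
move=> mF F0.
apply: (@measurable_int_Rn n _ _ (fun p : R * n.-tuple R => F (cons_tuple p.1 p.2))) => //.
apply: (measurableT_comp mF).
apply: (@measurable_cons _ _ _ _ (fun p => p.1) n (fun p => p.2)).
  exact: measurable_fst.
exact: measurable_snd.
Qed.

Lemma int_RnZ n (k : R) (F : n.-tuple R -> \bar R) : 0 <= k ->
  measurable_fun [set: n.-tuple R] F -> (forall x, 0 <= F x)%E ->
  int_Rn (fun x => k%:E * F x)%E = (k%:E * int_Rn F)%E.
Proof.
move=> k0; elim: n F => [//|n IH] F mF F0 /=.
under eq_integral => x _.
  rewrite IH//; last exact: measurable_cons_section.
  over.
rewrite ge0_integralZl_EFin//.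
- by move=> x _; exact: int_Rn_ge0.
- exact: measurable_int_Rn_cons.
Qed.

Lemma int_RnD n (F G : n.-tuple R -> \bar R) :
  measurable_fun [set: n.-tuple R] F -> measurable_fun [set: n.-tuple R] G ->
  (forall x, 0 <= F x)%E -> (forall x, 0 <= G x)%E ->
  int_Rn (fun x => F x + G x)%E = (int_Rn F + int_Rn G)%E.
Proof.
elim: n F G => [//|n IH] F G mF mG F0 G0 /=.
under eq_integral => x _.
  rewrite IH//; [|exact: measurable_cons_section..].
  over.
rewrite ge0_integralD//.
- by move=> x _; exact: int_Rn_ge0.
- exact: measurable_int_Rn_cons.
- by move=> x _; exact: int_Rn_ge0.
- exact: measurable_int_Rn_cons.
Qed.

Lemma int_Rn_mct n (G : (n.-tuple R -> \bar R)^nat) :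
  (forall k, measurable_fun [set: n.-tuple R] (G k)) ->
  (forall k x, 0 <= G k x)%E ->
  (forall x, {homo G^~ x : k l / (k <= l)%N >-> (k <= l)%E}) ->
  int_Rn (fun x => limn (G^~ x)) = limn (fun k => int_Rn (G k)).
Proof.
elim: n G => [//|n IH] G mG G0 ndG /=.
under eq_integral => x _.
  rewrite (IH (fun k y => G k (cons_tuple x y)))//.
    by over.
  by move=> k; exact: measurable_cons_section.
rewrite monotone_convergence//.
- by move=> k; exact: measurable_int_Rn_cons.
- by move=> k x _; exact: int_Rn_ge0.
- by move=> x _ k l kl; apply: int_Rn_le => // y; exact: ndG.
Qed.

Section leb_n_measure.
Variable n : nat.

Let leb_n_set0 : leb_n (set0 : set (n.-tuple R)) = 0%E.
Proof.
rewrite /leb_n (_ : (fun _ => _) = fun=> 0%E).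
  exact: functional0 (@int_RnZ n).
by apply/funext => y; rewrite indicE in_set0.
Qed.

Let leb_n_ge0 (A : set (n.-tuple R)) : (0 <= leb_n A)%E.
Proof. by apply: int_Rn_ge0 => y; rewrite lee_fin. Qed.

HB.instance Definition _ := isMeasure.Build _ (n.-tuple R) R (@leb_n R n)
  leb_n_set0 leb_n_ge0
  (functional_semi_sigma_additive (@int_Rn_le n) (@int_RnZ n) (@int_RnD n) (@int_Rn_mct n)).

End leb_n_measure.

Lemma int_RnE n (F : n.-tuple R -> \bar R) :
  measurable_fun [set: n.-tuple R] F -> (forall x, 0 <= F x)%E ->
  int_Rn F = (\int[@leb_n R n]_x F x)%E.
Proof.
move=> mF F0; apply/esym.
exact: (functional_integral (@int_RnZ n) (@int_RnD n) (@int_Rn_mct n)).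
Qed.

Lemma intH_ge0 n (F : n.-tuple R * R -> \bar R) :
  (forall x, 0 <= F x)%E -> (0 <= intH F)%E.
Proof. by move=> F0; apply: integral_ge0 => x _; exact: int_Rn_ge0. Qed.

Lemma intH_le n (F G : n.-tuple R * R -> \bar R) : (forall x, 0 <= F x)%E ->
  (forall x, F x <= G x)%E -> (intH F <= intH G)%E.
Proof.
move=> F0 FG; apply: ge0_le_integral_nomeas => t _; first exact: int_Rn_ge0.
by apply: int_Rn_le.
Qed.

Lemma measurable_int_Rn_swap n (F : n.-tuple R * R -> \bar R) :
  measurable_fun [set: n.-tuple R * R] F -> (forall x, 0 <= F x)%E ->
  measurable_fun [set: R] (fun t => int_Rn (fun y => F (y, t))).
Proof.
move=> mF F0.
apply: (@measurable_int_Rn n _ _ (fun p : R * n.-tuple R => F (p.2, p.1))) => //.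
by apply: (measurableT_comp mF); exact: measurable_fun_pair.
Qed.

Lemma measurable_section n (F : n.-tuple R * R -> \bar R) t :
  measurable_fun [set: n.-tuple R * R] F ->
  measurable_fun [set: n.-tuple R] (fun y => F (y, t)).
Proof. by move=> mF; apply: (measurableT_comp mF); exact: measurable_fun_pair. Qed.

Lemma intHZ n (k : R) (F : n.-tuple R * R -> \bar R) : 0 <= k ->
  measurable_fun [set: n.-tuple R * R] F -> (forall x, 0 <= F x)%E ->
  intH (fun x => k%:E * F x)%E = (k%:E * intH F)%E.
Proof.
move=> k0 mF F0; rewrite /intH.
under eq_integral => t _.
  rewrite int_RnZ//; last exact: measurable_section.
  over.
rewrite ge0_integralZl_EFin//.
- by move=> x _; exact: int_Rn_ge0.
- by apply: measurable_funTS; exact: measurable_int_Rn_swap.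
Qed.

Lemma intHD n (F G : n.-tuple R * R -> \bar R) :
  measurable_fun [set: n.-tuple R * R] F -> measurable_fun [set: n.-tuple R * R] G ->
  (forall x, 0 <= F x)%E -> (forall x, 0 <= G x)%E ->
  intH (fun x => F x + G x)%E = (intH F + intH G)%E.
Proof.
move=> mF mG F0 G0; rewrite /intH.
under eq_integral => t _.
  rewrite int_RnD//; [|exact: measurable_section..].
  over.
rewrite ge0_integralD//.
- by move=> x _; exact: int_Rn_ge0.
- by apply: measurable_funTS; exact: measurable_int_Rn_swap.
- by move=> x _; exact: int_Rn_ge0.
- by apply: measurable_funTS; exact: measurable_int_Rn_swap.
Qed.

Lemma intH_mct n (G : (n.-tuple R * R -> \bar R)^nat) :
  (forall k, measurable_fun [set: n.-tuple R * R] (G k)) ->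
  (forall k x, 0 <= G k x)%E ->
  (forall x, {homo G^~ x : k l / (k <= l)%N >-> (k <= l)%E}) ->
  intH (fun x => limn (G^~ x)) = limn (fun k => intH (G k)).
Proof.
move=> mG G0 ndG; rewrite /intH.
under eq_integral => t _.
  rewrite (int_Rn_mct (G := fun k y => G k (y, t)))//.
    by over.
  by move=> k; exact: measurable_section.
rewrite monotone_convergence//.
- by move=> k; apply: measurable_funTS; exact: measurable_int_Rn_swap.
- by move=> k x _; exact: int_Rn_ge0.
- by move=> x _ k l kl; apply: int_Rn_le => // y; exact: ndG.
Qed.

Section measH_measure.
Variable n : nat.

Let measH_set0 : measH (set0 : set (n.-tuple R * R)) = 0%E.
Proof.
rewrite /measH (_ : (fun _ => _) = fun=> 0%E).
  exact: functional0 (@intHZ n).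
by apply/funext => y; rewrite indicE in_set0.
Qed.

Let measH_ge0 (A : set (n.-tuple R * R)) : (0 <= measH A)%E.
Proof. by apply: intH_ge0 => y; rewrite lee_fin. Qed.

HB.instance Definition _ := isMeasure.Build _ (n.-tuple R * R)%type R (@measH R n)
  measH_set0 measH_ge0
  (functional_semi_sigma_additive (@intH_le n) (@intHZ n) (@intHD n) (@intH_mct n)).

End measH_measure.

Lemma intHE n (F : n.-tuple R * R -> \bar R) :
  measurable_fun [set: n.-tuple R * R] F -> (forall x, 0 <= F x)%E ->
  intH F = (\int[@measH R n]_x F x)%E.
Proof.
move=> mF F0; apply/esym.
exact: (functional_integral (@intHZ n) (@intHD n) (@intH_mct n)).
Qed.

End IntRn.

(** * Elementary inequalities for real powers *)

Section PowerInequalities.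
Context (R : realType).
Implicit Types s u v w x y z b : R.

Lemma powR_le_bernoulli s z : 0 < s -> s <= 1 -> 0 <= z -> z `^ s <= 1 + s * (z - 1).
Proof.
move=> s0; rewrite le_eqVlt => /predU1P[->|s1] z0.
  by rewrite powRr1// mul1r addrC subrK.
(* Young's inequality for the numbers z^s and 1 with the conjugate exponents 1/s and 1/(1 - s). *)
have := @conjugate_powR R (z `^ s) 1 s^-1 (1 - s)^-1 (powR_ge0 _ _) ler01.
rewrite !invr_gt0 subr_gt0 => /(_ s0 s1); rewrite !invrK.
rewrite (addrC s) subrK => /(_ erefl).
rewrite mulr1 powR1 mul1r -powRrM mulfV ?gt_eqF// powRr1// => h.
by apply: le_trans h _; lra.
Qed.

Lemma powR_le_tangent s x y : 0 < s -> s <= 1 -> 0 < x -> 0 <= y ->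
  y `^ s <= x `^ s + s * x `^ (s - 1) * (y - x).
Proof.
move=> s0 s1 x0 y0.
have yx : y = x * (y / x) by rewrite mulrCA mulfV ?mulr1// gt_eqF.
have yx0 : 0 <= y / x by rewrite divr_ge0// ltW.
rewrite {1}yx (powRM _ (ltW x0) yx0).
have := powR_le_bernoulli s0 s1 yx0.
move=> /(ler_wpM2l (powR_ge0 x s)) /le_trans; apply.
rewrite -(mulr_powRB1 (ltW x0) s0) le_eqVlt; apply/orP; left; apply/eqP.
by field; rewrite gt_eqF.
Qed.

(** This is concavity. For disjoint intervals [u, u + b] and [v, v + b] the tangents at u + b and at
    v bound the two increments, and the slopes decrease. *)
Lemma powR_increment_decreasing s u v b : 0 < s -> s <= 1 -> 0 <= u -> u <= v -> 0 <= b ->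
  (v + b) `^ s - v `^ s <= (u + b) `^ s - u `^ s.
Proof.
move=> s0 s1.
have key u' v' b' : 0 <= u' -> 0 <= b' -> u' + b' <= v' ->
    (v' + b') `^ s - v' `^ s <= (u' + b') `^ s - u' `^ s.
  move=> u0; rewrite le_eqVlt => /predU1P[<-|b0] uv; first by rewrite !addr0 !subrr.
  have v0 : 0 < v' by apply: lt_le_trans uv; rewrite ltr_wpDl.
  have ub0 : 0 < u' + b' by rewrite ltr_wpDl.
  have h1 := powR_le_tangent s0 s1 v0 (addr_ge0 (ltW v0) (ltW b0)).
  have h2 := powR_le_tangent s0 s1 ub0 u0.
  have h3 : v' `^ (s - 1) <= (u' + b') `^ (s - 1).
    rewrite -[s - 1]opprB !powRN lef_pV2 ?posrE ?powR_gt0//.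
    by apply: ge0_ler_powR; rewrite ?nnegrE ?subr_ge0// ltW.
  have : s * v' `^ (s - 1) * b' <= s * (u' + b') `^ (s - 1) * b'.
    by rewrite ler_pM2r// ler_pM2l.
  move: h1 h2; rewrite (addrC v' b') addrK opprD addNKr addrC => h1 h2 h4; lra.
move=> u0 uv b0; have [ubv|vub] := leP (u + b) v; first exact: key.
(* Overlapping case: moving v^s and (u + b)^s across gives the same claim with step v - u and base
   points u and u + b, whose intervals no longer overlap. *)
have := @key u (u + b) (v - u) u0; rewrite subr_ge0 => /(_ uv).
rewrite addrC subrK => /(_ (ltW vub)).
by rewrite (_ : u + b + (v - u) = v + b); [move=> h; lra|ring].
Qed.

(** The tangent inequality for the concave power 1/s, taken at w^s and x^s and multiplied by s w^(s
    - 1). *)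
Lemma powR_increment_le s w x : 1 <= s -> 0 <= x -> x <= w ->
  w `^ s - x `^ s <= s * w `^ (s - 1) * (w - x).
Proof.
move=> s1 x0 xw; have s0 : 0 < s by lra.
have [w0|w0] := leP w 0.
  have -> : x = w by lra.
  by rewrite !subrr mulr0.
have := @powR_le_tangent s^-1 (w `^ s) (x `^ s).
rewrite invr_gt0 invf_le1// powR_gt0// powR_ge0 -!powRrM mulfV ?gt_eqF// !powRr1// ?(ltW w0)//.
move=> /(_ s0 s1 isT isT).
rewrite (_ : s * (s^-1 - 1) = - (s - 1)) ?powRN; last by field; rewrite gt_eqF.
have W0 : 0 < w `^ (s - 1) by rewrite powR_gt0.
move=> h; have := ler_wpM2l (ltW (mulr_gt0 s0 W0)) h.
rewrite mulrDr mulrA.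
rewrite (_ : _ * (s^-1 / _) = 1) ?mul1r; last by field; rewrite !gt_eqF.
by move=> {}h; lra.
Qed.

(** Young's inequality in the form needed for absorption, with an arbitrarily small coefficient of
    v^s. Splitting at u = k v gives explicit constants. *)
Lemma powR_absorb s (k : R) u v : 1 <= s -> 0 < k -> 0 <= u -> 0 <= v ->
  u * v `^ (s - 1) <= k * v `^ s + k `^ (1 - s) * u `^ s.
Proof.
move=> s1 k0 u0 v0; have s0 : 0 < s by lra.
have [h|h] := leP u (k * v).
  rewrite -[leLHS]addr0 lerD ?mulr_ge0 ?powR_ge0//.
  by rewrite -(mulr_powRB1 v0 s0) mulrA ler_wpM2r ?powR_ge0.
rewrite -[leLHS]add0r lerD ?mulr_ge0 ?powR_ge0//; first exact: ltW.
rewrite -(mulr_powRB1 u0 s0) mulrCA ler_wpM2l//.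
have vk : v <= u / k by rewrite ler_pdivlMr// mulrC ltW.
apply: le_trans (_ : (u / k) `^ (s - 1) <= _).
  by apply: ge0_ler_powR; rewrite ?nnegrE ?subr_ge0// divr_ge0// ltW.
rewrite powRM// ?invr_ge0 ?(ltW k0)// mulrC ler_wpM2r ?powR_ge0//.
by rewrite -powR_inv1 ?(ltW k0)// -powRrM mulN1r opprB.
Qed.

Lemma powR_ler s x y : 0 <= s -> 0 <= x -> x <= y -> x `^ s <= y `^ s.
Proof. by move=> s0 x0 xy; rewrite ge0_ler_powR ?nnegrE// (le_trans x0). Qed.

End PowerInequalities.

Lemma integral_setE d (T : measurableType d) (R : realType) (mu : {measure set T -> \bar R})
    (D : set T) (f : T -> R) :
  (\int[mu]_(x in D) (f x)%:E = \int[mu]_x (\1_D x * f x)%:E)%E.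
Proof.
rewrite integral_mkcond; apply: eq_integral => x _; rewrite patchE indicE.
by case: (x \in D); rewrite ?mul1r ?mul0r.
Qed.

(** * Functions that are constant on the cells of a countable partition *)

Definition cellwise (T J U : Type) (c : T -> J) (f : T -> U) :=
  forall x y, c x = c y -> f x = f y.

Section Cellwise.
Context d (T : measurableType d) (R : realType) (mu : {measure set T -> \bar R}).
Context (J : countType) (c : T -> J).
Hypothesis mc : forall j, measurable (c @^-1` [set j]).

Lemma bigcup_cells (B : set J) : \bigcup_k [set x | pickle (c x) = k /\ B (c x)] = c @^-1` B.
Proof.
apply/seteqP; split=> [x [k _ [_ ?]]//|x Bx].
by exists (pickle (c x)).
Qed.

Lemma measurable_preimage_cell (B : set J) : measurable (c @^-1` B).
Proof.
rewrite -bigcup_cells; apply: bigcupT_measurable => k.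
have [[x [xk Bx]]|/forallNP h] := pselect (exists x, pickle (c x) = k /\ B (c x)).
  rewrite (_ : [set _ | _] = c @^-1` [set c x])//.
  apply/seteqP; split=> [y [yk By]|y /= ->//].
  by apply: (pcan_inj pickleK); rewrite yk.
by rewrite (_ : [set _ | _] = set0)//; apply/seteqP; split=> // y /h.
Qed.

Lemma cellwise_comp (U : Type) (f : T -> U) : cellwise c f -> T ->
  exists g : J -> U, f = g \o c.
Proof.
move=> cf x0.
have /choice[g gP] : forall j, exists u, forall x, c x = j -> f x = u.
  move=> j; have [[x xj]|h] := pselect (exists x, c x = j).
    by exists (f x) => y yj; apply: cf; rewrite xj yj.
  by exists (f x0) => y yj; case: h; exists y.
by exists g; apply/funext => x /=; exact: gP.
Qed.

(** The map factors through a countable index type, so its preimages are countable unions of cells.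
    This gives measurability of everything read off from box infima. *)
Lemma measurable_cellwise d' (U : measurableType d') (f : T -> U) :
  cellwise c f -> measurable_fun [set: T] f.
Proof.
move=> cf; have [[x _]|h] := pselect (exists x : T, True).
  have [g ->] := cellwise_comp cf x.
  by move=> _ Y mY; rewrite setTI comp_preimage; exact: measurable_preimage_cell.
move=> _ Y mY; rewrite (_ : _ `&` _ = set0)//.
by apply/seteqP; split => // x; case: h; exists x.
Qed.

Lemma cellwise_integral_le (k : R) (E : set T) (f : T -> R) : 0 <= k ->
  measurable E -> cellwise c f -> (forall x, 0 <= f x) ->
  (forall x, k%:E * mu (c @^-1` [set c x]) <= mu (E `&` c @^-1` [set c x]))%E ->
  (k%:E * \int[mu]_x (f x)%:E <= \int[mu]_(x in E) (f x)%:E)%E.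
Proof.
move=> k0 mE cf f0 kE.
(* The cells are listed along the natural numbers by their codes; a code that no cell has gives the
   empty set. *)
pose F k := [set x | pickle (c x) = k].
have FE i : F i = [set x | pickle (c x) = i /\ [set: J] (c x)].
  by apply/seteqP; split=> x //= [].
have mF i : measurable (F i).
  rewrite (_ : F i = c @^-1` [set j | pickle j = i])//.
  exact: measurable_preimage_cell.
have UF : \bigcup_i F i = [set: T].
  rewrite (eq_bigcupr (fun i _ => FE i)); exact: bigcup_cells.
have tF : trivIset [set: nat] F by move=> i j _ _ [x [/= <- <-]].
have mf : measurable_fun [set: T] (EFin \o f).
  by apply/measurable_EFinP; exact: measurable_cellwise.
rewrite -{1}UF ge0_integral_bigcup//; [|by rewrite UF|by move=> x _; rewrite lee_fin].
rewrite -[in leRHS](setIT E) -UF setI_bigcupr ge0_integral_bigcup//; last 4 first.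
- by move=> i; exact: measurableI.
- exact: measurable_funTS.
- by move=> x _; rewrite lee_fin.
- exact: trivIset_setIl.
rewrite -nneseriesZl; last by move=> i _; apply: integral_ge0 => x _; rewrite lee_fin.
apply: lee_nneseries => [i _|i _].
  by rewrite mule_ge0// integral_ge0// => x _; rewrite lee_fin.
have [[x xi]|h] := pselect (exists x, pickle (c x) = i); last first.
  rewrite (_ : F i = set0) ?setI0 ?integral_set0 ?mule0//.
  by apply/seteqP; split => // x xi; case: h; exists x.
have -> : F i = c @^-1` [set c x].
  apply/seteqP; split=> [y yi|y /= yx]; last by rewrite /F /= yx.
  by apply: (pcan_inj pickleK); rewrite xi; exact: yi.
rewrite (eq_integral (cst (f x)%:E)); last first.
  by move=> y /set_mem yx /=; congr EFin; exact: cf.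
rewrite [leRHS](eq_integral (cst (f x)%:E)); last first.
  by move=> y /set_mem[_ yx] /=; congr EFin; exact: cf.
rewrite !integral_cst//; last exact: measurableI.
by rewrite muleCA lee_wpmul2l// lee_fin.
Qed.

End Cellwise.

Lemma ereal_absorb_half (R : realType) (k C : R) (X Y : \bar R) : 0 < k ->
  (0 <= X)%E -> (X < +oo)%E -> (0 <= Y)%E -> (Y < +oo)%E ->
  (k%:E * X <= (k / 2)%:E * X + C%:E * Y)%E -> (X <= (2 / k * C)%:E * Y)%E.
Proof.
move: X Y => [x| |] [y| |]// k0 _ _ _ _; rewrite -!EFinM -EFinD !lee_fin => h.
have -> : 2 / k * C * y = 2 / k * (C * y) by rewrite !mulrA.
have h1 : k / 2 * x <= C * y by lra.
rewrite -(ler_pM2l (_ : 0 < k / 2)) ?divr_gt0//; apply: le_trans h1 _.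
by rewrite mulrA (_ : k / 2 * (2 / k) = 1) ?mul1r//; field; rewrite gt_eqF.
Qed.

Lemma integral_le_combination d (T : measurableType d) (R : realType)
    (mu : {measure set T -> \bar R}) (a b : R) (f g h : T -> R) :
  measurable_fun [set: T] f -> measurable_fun [set: T] g ->
  (forall x, 0 <= f x) -> (forall x, 0 <= g x) -> 0 <= a -> 0 <= b ->
  (forall x, 0 <= h x) -> (forall x, h x <= a * f x + b * g x) ->
  (\int[mu]_x (h x)%:E <= a%:E * \int[mu]_x (f x)%:E + b%:E * \int[mu]_x (g x)%:E)%E.
Proof.
move=> mf mg f0 g0 a0 b0 h0 hfg.
have mf' : measurable_fun [set: T] (EFin \o f) by apply/measurable_EFinP.
have mg' : measurable_fun [set: T] (EFin \o g) by apply/measurable_EFinP.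
apply: (@le_trans _ _ (\int[mu]_x (a%:E * (f x)%:E + b%:E * (g x)%:E))%E).
  by apply: ge0_le_integral_nomeas => x _; rewrite -?EFinM -?EFinD lee_fin.
rewrite ge0_integralD//.
- by rewrite !ge0_integralZl_EFin// => x _; rewrite lee_fin.
- by move=> x _; rewrite -EFinM lee_fin mulr_ge0.
- exact: emeasurable_funM.
- by move=> x _; rewrite -EFinM lee_fin mulr_ge0.
- exact: emeasurable_funM.
Qed.

(** * Removing the sets [E i] on a tree of nested partitions *)

Section TreeDomination.
Context d (T : measurableType d) (R : realType) (mu : {measure set T -> \bar R}).
Context (J : countType) (c : nat -> T -> J) (E : nat -> set T) (k : R).
Hypothesis mc : forall i j, measurable (c i @^-1` [set j]).
Hypothesis c_nested : forall i, cellwise (c i.+1) (c i).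
Hypothesis mE : forall i, measurable (E i).
Hypothesis k0 : 0 < k.
Hypothesis kE : forall i x,
  (k%:E * mu (c i @^-1` [set c i x]) <= mu (E i `&` c i @^-1` [set c i x]))%E.
Variable b : nat -> T -> R.
Hypothesis b0 : forall i x, 0 <= b i x.
Hypothesis cb : forall i, cellwise (c i) (b i).

Let A n x := \sum_(i < n) b i x.
Let B n x := \sum_(i < n) b i x * \1_(E i) x.

Let c_nestedW i j : (i <= j)%N -> cellwise (c j) (c i).
Proof.
by move/subnK <-; elim: (j - i)%N => // l IH x y /c_nested; exact: IH.
Qed.

Let cA n m : (n <= m.+1)%N -> cellwise (c m) (A n).
Proof.
move=> nm x y xy; apply: eq_bigr => i _; apply: cb.
by apply: c_nestedW xy; rewrite -ltnS (leq_trans _ nm).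
Qed.

Let A0 n x : 0 <= A n x. Proof. by apply: sumr_ge0. Qed.

Let B0 n x : 0 <= B n x. Proof. by apply: sumr_ge0 => i _; rewrite mulr_ge0. Qed.

Let mb i : measurable_fun [set: T] (b i).
Proof. exact: (measurable_cellwise (mc i)). Qed.

Let mA n : measurable_fun [set: T] (A n).
Proof. exact: measurable_sum. Qed.

Let mB n : measurable_fun [set: T] (B n).
Proof. by apply: measurable_sum => i; apply: measurable_funM => //; exact: measurable_indic. Qed.

Let BA n x : B n x <= A n x.
Proof.
apply: ler_sum => i _; rewrite indicE.
by case: (_ \in _); rewrite ?mulr1// mulr0.
Qed.

Let mpow (f : T -> R) s : measurable_fun [set: T] f ->
  measurable_fun [set: T] (fun x => (f x `^ s)%:E).
Proof.
move=> mf; apply/measurable_EFinP.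
by apply: (measurableT_comp (measurable_powR s)).
Qed.

(* The increments of [A ^ s] are constant on cells, hence comparable to their
   integrals over [E i], where they are at most those of [B ^ s] because [B <= A]
   and [x ^ s] is concave. *)
Lemma tree_domination_concave s n : 0 < s -> s <= 1 ->
  (k%:E * \int[mu]_x (A n x `^ s)%:E <= \int[mu]_x (B n x `^ s)%:E)%E.
Proof.
move=> s0 s1; elim: n => [|n IH].
  rewrite /A /B; under eq_integral do rewrite big_ord0 powR0 ?gt_eqF//.
  by under [leRHS]eq_integral do rewrite big_ord0 powR0 ?gt_eqF//; rewrite integral0 mule0.
have AS x : A n.+1 x = A n x + b n x by rewrite /A big_ord_recr.
have BS x : B n.+1 x = B n x + b n x * \1_(E n) x by rewrite /B big_ord_recr.
pose f x := A n.+1 x `^ s - A n x `^ s.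
have f0 x : 0 <= f x.
  by rewrite subr_ge0; apply: ge0_ler_powR; rewrite ?nnegrE ?(ltW s0)// AS lerDl.
have mf : measurable_fun [set: T] (fun x => (f x)%:E).
  by apply/measurable_EFinP; apply: measurable_funB; apply/measurable_EFinP; exact: mpow.
have -> : (\int[mu]_x (A n.+1 x `^ s)%:E = \int[mu]_x (A n x `^ s)%:E + \int[mu]_x (f x)%:E)%E.
  rewrite -ge0_integralD//.
  - by apply: eq_integral => x _; rewrite -EFinD addrC subrK.
  - by move=> x _; rewrite lee_fin powR_ge0.
  - exact: mpow.
  - by move=> x _; rewrite lee_fin.
have -> : (\int[mu]_x (B n.+1 x `^ s)%:E =
    \int[mu]_x (B n x `^ s)%:E + \int[mu]_x (B n.+1 x `^ s - B n x `^ s)%:E)%E.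
  rewrite -ge0_integralD//.
  - by apply: eq_integral => x _; rewrite -EFinD addrC subrK.
  - by move=> x _; rewrite lee_fin powR_ge0.
  - exact: mpow.
  - move=> x _; rewrite lee_fin subr_ge0.
    by apply: ge0_ler_powR; rewrite ?nnegrE ?(ltW s0)// BS lerDl mulr_ge0.
  - by apply/measurable_EFinP; apply: measurable_funB; apply/measurable_EFinP; exact: mpow.
rewrite ge0_muleDr ?integral_ge0//; [|by move=> x _; rewrite lee_fin ?powR_ge0..].
apply: leeD => //.
apply: (@le_trans _ _ (\int[mu]_(x in E n) (f x)%:E)%E).
  apply: (cellwise_integral_le (mc n) (ltW k0)) => //.
  by move=> x y xy; rewrite /f !(cA _ xy).
rewrite integral_mkcond; apply: ge0_le_integral_nomeas => x _.
  by rewrite patchE; case: ifP => //; rewrite lee_fin.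
rewrite patchE; case: ifPn => [xE|xE]; rewrite lee_fin BS indicE ?xE ?mulr1.
  by rewrite /f AS; exact: powR_increment_decreasing.
by rewrite (negbTE xE) mulr0 addr0 subrr.
Qed.

(** For s >= 1 the increment of A^s at step m is at most s A_(m+1)^(s-1) b_m, which is constant on
    cells of level m, so that its integral is comparable to the one over [E m]. Enlarging A_(m+1) to
    A_n and summing bounds k times the integral of A_n^s by s times that of B_n A_n^(s-1); Young's
    inequality then allows absorption. *)
Lemma tree_domination_convex s n : 1 <= s -> (\int[mu]_x (B n x `^ s)%:E < +oo)%E ->
  (\int[mu]_x (A n x `^ s)%:E <=
     (2 / k * (s * (k / (2 * s)) `^ (1 - s)))%:E * \int[mu]_x (B n x `^ s)%:E)%E.
Proof.
move=> s1 finB; have s0 : 0 < s by lra.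
have pge0 (f : T -> R) x r : (0 <= (f x `^ r)%:E)%E by rewrite lee_fin powR_ge0.
have BAE i : (k%:E * \int[mu]_x (b i x `^ s)%:E <= \int[mu]_x ((b i x * \1_(E i) x) `^ s)%:E)%E.
  apply: (@le_trans _ _ (\int[mu]_(x in E i) (b i x `^ s)%:E)%E).
    apply: (cellwise_integral_le (mc i) (ltW k0)) => //.
    - by move=> x y xy; rewrite (cb xy).
    - by move=> x; exact: powR_ge0.
  rewrite integral_mkcond; apply: ge0_le_integral_nomeas => x _.
    by rewrite patchE; case: ifP => //; rewrite lee_fin powR_ge0.
  rewrite patchE indicE; case: ifPn => [xE|xE]; first by rewrite mulr1.
  by rewrite mulr0 powR0 ?gt_eqF.
(* Absorption needs a finite integral of A_n^s. Each b_m has one, because its restriction to [E m]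
   is below B_n and carries a fixed part of the integral of b_m^s. *)
have finA m : (m <= n)%N -> (\int[mu]_x (A m x `^ s)%:E < +oo)%E.
  elim: m => [_|m IH mn].
    by rewrite /A; under eq_integral do rewrite big_ord0 powR0 ?gt_eqF//; rewrite integral0.
  apply: (@le_lt_trans _ _ ((2 `^ s)%:E * (\int[mu]_x (A m x `^ s)%:E + \int[mu]_x (b m x `^ s)%:E))%E).
    rewrite -ge0_integralD//; [|exact: mpow..].
    rewrite -ge0_integralZl_EFin//; last 2 first.
    - by move=> x _; rewrite adde_ge0.
    - by apply: emeasurable_funD; exact: mpow.
    apply: ge0_le_integral_nomeas => x _ //.
    rewrite -EFinD -EFinM lee_fin /A big_ord_recr/= -/(A m x).
    apply: (@le_trans _ _ ((2 * Num.max (A m x) (b m x)) `^ s)).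
      apply: ge0_ler_powR; rewrite ?nnegrE ?(ltW s0) ?addr_ge0 ?mulr_ge0 ?le_max ?A0//.
      by rewrite mulr_natl mulr2n lerD// le_max lexx ?orbT.
    rewrite powRM ?le_max ?A0// ler_wpM2l ?powR_ge0//.
    by rewrite /Num.max; case: ifP => _; rewrite (lerDl, lerDr) powR_ge0.
  apply: lte_mul_pinfty; rewrite ?lee_fin ?powR_ge0//.
  apply: lte_add_pinfty; first exact: IH (ltnW mn).
  have : (k%:E * \int[mu]_x (b m x `^ s)%:E < +oo)%E.
    apply: le_lt_trans (BAE m) _; apply: le_lt_trans finB.
    apply: ge0_le_integral_nomeas => x _; first by rewrite lee_fin powR_ge0.
    rewrite lee_fin.
    apply: ge0_ler_powR; rewrite ?nnegrE ?(ltW s0)// ?mulr_ge0//.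
    rewrite /B (bigD1 (Ordinal mn))//= lerDl; apply: sumr_ge0 => i _.
    by rewrite mulr_ge0.
  by rewrite !ltey; apply: contra => /eqP ->; rewrite gt0_muley.
have mBA m : measurable_fun [set: T] (fun x => (s * (B m x * A n x `^ (s - 1)))%:E).
  apply/measurable_EFinP; apply: measurable_funM => //; apply: measurable_funM => //.
  by apply/measurable_EFinP; exact: mpow.
have BA0 m x : (0 <= (s * (B m x * A n x `^ (s - 1)))%:E)%E.
  by rewrite lee_fin !mulr_ge0 ?powR_ge0 ?(ltW s0).
have key m : (m <= n)%N ->
    (k%:E * \int[mu]_x (A m x `^ s)%:E <= \int[mu]_x (s * (B m x * A n x `^ (s - 1)))%:E)%E.
  elim: m => [_|m IH mn].
    rewrite /A; under eq_integral do rewrite big_ord0 powR0 ?gt_eqF//.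
    by rewrite integral0 mule0; exact: integral_ge0.
  have AS x : A m.+1 x = A m x + b m x by rewrite /A big_ord_recr.
  have BS x : B m.+1 x = B m x + b m x * \1_(E m) x by rewrite /B big_ord_recr.
  have Sle x : A m.+1 x <= A n x.
    rewrite /A -(subnKC mn) big_split_ord/= lerDl; exact: sumr_ge0.
  pose f x := s * A m.+1 x `^ (s - 1) * b m x.
  have f0 x : 0 <= f x by rewrite !mulr_ge0 ?powR_ge0 ?(ltW s0).
  have mf : measurable_fun [set: T] (fun x => (f x)%:E).
    apply/measurable_EFinP; apply: measurable_funM => //; apply: measurable_funM => //.
    by apply/measurable_EFinP; exact: mpow.
  apply: (@le_trans _ _ (k%:E * (\int[mu]_x (A m x `^ s)%:E + \int[mu]_x (f x)%:E))%E).
    rewrite lee_wpmul2l ?lee_fin ?(ltW k0)// -ge0_integralD//; last 2 first.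
    - exact: mpow.
    - by move=> x _; rewrite lee_fin.
    apply: ge0_le_integral_nomeas => x _ //; rewrite -EFinD lee_fin.
    have := @powR_increment_le R s (A m.+1 x) (A m x) s1 (A0 m x).
    by rewrite AS lerDl => /(_ (b0 _ _)); rewrite addrAC subrr add0r /f AS; lra.
  rewrite ge0_muleDr ?integral_ge0//; last by move=> x _; rewrite lee_fin.
  rewrite [leRHS](_ : _ = \int[mu]_x (s * (B m x * A n x `^ (s - 1)))%:E +
      \int[mu]_x (s * (b m x * \1_(E m) x * A n x `^ (s - 1)))%:E)%E; last first.
    rewrite -ge0_integralD//.
    - by apply: eq_integral => x _; rewrite -EFinD BS; congr EFin; ring.
    - by move=> x _; rewrite lee_fin !mulr_ge0 ?powR_ge0 ?(ltW s0).
    - apply/measurable_EFinP; do 2 apply: measurable_funM => //.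
      - by apply: measurable_funM => //; exact: measurable_indic.
      - by apply/measurable_EFinP; exact: mpow.
  apply: leeD; first exact: IH (ltnW mn).
  apply: (@le_trans _ _ (\int[mu]_(x in E m) (f x)%:E)%E).
    apply: (cellwise_integral_le (mc m) (ltW k0)) => //.
    by move=> x y xy; rewrite /f (cb xy) (cA _ xy).
  rewrite integral_mkcond; apply: ge0_le_integral_nomeas => x _.
    by rewrite patchE; case: ifP => //; rewrite lee_fin.
  rewrite patchE indicE; case: ifPn => [xE|xE].
    rewrite mulr1 lee_fin /f -mulrA ler_wpM2l ?(ltW s0)// mulrC ler_wpM2l//.
    by apply: ge0_ler_powR; rewrite ?nnegrE ?subr_ge0.
  by rewrite mulr0 mul0r mulr0.
(* With this parameter in Young's inequality, and after the factor s, the power A_n^s has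
   coefficient k / 2, half of the one on the left. *)
have ks0 : 0 < k / (2 * s) by rewrite divr_gt0// mulr_gt0.
have Afin := finA n (leqnn n).
apply: (ereal_absorb_half k0).
- exact: integral_ge0.
- exact: Afin.
- exact: integral_ge0.
- exact: finB.
apply: le_trans (key n (leqnn n)) _; apply: integral_le_combination => //.
- by apply/measurable_EFinP; exact: mpow.
- by apply/measurable_EFinP; exact: mpow.
- by move=> x; exact: powR_ge0.
- by move=> x; exact: powR_ge0.
- by rewrite divr_ge0// ltW.
- by rewrite mulr_ge0 ?powR_ge0 ?(ltW s0).
- by move=> x; rewrite -lee_fin.
move=> x; have := powR_absorb s1 ks0 (B0 n x) (A0 n x).
move=> /(ler_wpM2l (ltW s0)) /le_trans; apply.
rewrite mulrDr mulrA (_ : s * (k / (2 * s)) = k / 2) ?mulrA//.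
by field; rewrite gt_eqF.
Qed.

End TreeDomination.

Definition tree_const (R : realType) (k s : R) : R :=
  if s <= 1 then k^-1 else 2 / k * (s * (k / (2 * s)) `^ (1 - s)).

Lemma tree_const_gt0 (R : realType) (k s : R) : 0 < k -> 0 < s -> 0 < tree_const k s.
Proof.
move=> k0 s0; rewrite /tree_const; case: ifP => _; rewrite ?invr_gt0//.
by rewrite mulr_gt0 ?divr_gt0// mulr_gt0// powR_gt0// divr_gt0// mulr_gt0.
Qed.

Section TreeNorm.
Context d (T : measurableType d) (R : realType) (mu : {measure set T -> \bar R}).
Context (J : countType) (c : nat -> T -> J) (E : nat -> set T) (k : R).
Hypothesis mc : forall i j, measurable (c i @^-1` [set j]).
Hypothesis c_nested : forall i, cellwise (c i.+1) (c i).
Hypothesis mE : forall i, measurable (E i).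
Hypothesis k0 : 0 < k.
Hypothesis kE : forall i x,
  (k%:E * mu (c i @^-1` [set c i x]) <= mu (E i `&` c i @^-1` [set c i x]))%E.

Lemma tree_domination (b : nat -> T -> R) s n :
  (forall i x, 0 <= b i x) -> (forall i, cellwise (c i) (b i)) -> 0 < s ->
  (\int[mu]_x ((\sum_(i < n) b i x) `^ s)%:E <= (tree_const k s)%:E *
   \int[mu]_x ((\sum_(i < n) b i x * \1_(E i) x) `^ s)%:E)%E.
Proof.
move=> b0 cb s0; have [Bf|] := ltP (\int[mu]_x ((\sum_(i < n) b i x * \1_(E i) x) `^ s)%:E)%E +oo%E; last first.
  by rewrite leye_eq => /eqP ->; rewrite gt0_muley ?leey// lte_fin tree_const_gt0.
rewrite /tree_const; case: ifPn => s1.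
  rewrite lee_pdivlMl//.
  exact: (tree_domination_concave mc).
apply: (tree_domination_convex mc) => //.
by rewrite leNgt ltNge ltW// ltNge.
Qed.

Lemma tree_lq_norm (a : nat -> T -> R) (G : T -> R) p q n :
  (forall i x, 0 <= a i x) -> (forall i, cellwise (c i) (a i)) ->
  (forall x, 0 <= G x) -> 0 < p -> 0 < q ->
  (forall x, \sum_(i < n) a i x `^ q * \1_(E i) x <= G x `^ q) ->
  (\int[mu]_x ((\sum_(i < n) a i x `^ q) `^ (p / q))%:E <=
   (tree_const k (p / q))%:E * \int[mu]_x (G x `^ p)%:E)%E.
Proof.
move=> a0 ca G0 p0 q0 aG.
apply: le_trans (tree_domination (b := fun i x => a i x `^ q) _ _ _ _) _.
- by move=> i x; exact: powR_ge0.
- by move=> i x y xy; rewrite (ca i x y xy).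
- exact: divr_gt0.
apply: lee_wpmul2l; first by rewrite lee_fin ltW// tree_const_gt0// divr_gt0.
apply: ge0_le_integral_nomeas => x _; first by rewrite lee_fin powR_ge0.
rewrite lee_fin (_ : G x `^ p = (G x `^ q) `^ (p / q)); last first.
  by rewrite -powRrM mulrCA mulfV ?mulr1// gt_eqF.
apply: ge0_ler_powR; rewrite ?nnegrE ?divr_ge0 ?powR_ge0 ?(ltW p0) ?(ltW q0)//.
by apply: sumr_ge0 => i _; rewrite mulr_ge0 ?powR_ge0.
Qed.

(** The maximum of n terms is compared with their l^q norm for q = p n. Then p / q = 1 / n is at
    most 1, so the concave constant 1 / k does not depend on n, and passing from the maximum to l^q
    costs n^(p/q) = n^(1/n) <= 2. *)
Lemma tree_sup_norm (a : nat -> T -> R) (G : T -> R) p n :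
  (forall i x, 0 <= a i x) -> (forall i, cellwise (c i) (a i)) ->
  (forall x, 0 <= G x) -> measurable_fun [set: T] G -> 0 < p ->
  (forall i x, E i x -> a i x <= G x) ->
  (\int[mu]_x ((\big[Num.max/0]_(i < n) a i x) `^ p)%:E <=
   (2 / k)%:E * \int[mu]_x (G x `^ p)%:E)%E.
Proof.
move=> a0 ca G0 mG p0 aG.
have [->|n0] := posnP n.
  under eq_integral do rewrite big_ord0 powR0 ?gt_eqF//.
  rewrite integral0 mule_ge0// ?lee_fin ?divr_ge0 ?(ltW k0)//.
  by apply: integral_ge0 => x _; rewrite lee_fin powR_ge0.
pose q := p * n%:R.
have q0 : 0 < q by rewrite mulr_gt0 ?ltr0n.
have pq : p / q = n%:R^-1 by rewrite /q; field; rewrite !gt_eqF// ltr0n.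
apply: (@le_trans _ _ (\int[mu]_x ((\sum_(i < n) a i x `^ q) `^ (p / q))%:E)%E).
  apply: ge0_le_integral_nomeas => x _; first by rewrite lee_fin powR_ge0.
  rewrite lee_fin.
  set M := \big[_/_]_(_ < _) _.
  have M0 : 0 <= M by apply/bigmax_geP; left.
  have -> : M `^ p = (M `^ q) `^ (p / q).
    by rewrite -powRrM mulrCA mulfV ?mulr1// gt_eqF.
  apply: ge0_ler_powR; rewrite ?nnegrE ?divr_ge0 ?powR_ge0 ?(ltW p0) ?(ltW q0)//.
    by apply: sumr_ge0 => i _; exact: powR_ge0.
  rewrite /M; have [|i _ ->] := @eq_bigmax _ _ _ 0 (Ordinal n0) xpredT (fun i : 'I_n => a i x) isT.
    by move=> i _; exact: a0.
  by rewrite (bigD1 i)//= lerDl; apply: sumr_ge0 => j _; exact: powR_ge0.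
have C0 : 0 <= (n%:R : R) `^ q^-1 by exact: powR_ge0.
apply: le_trans (tree_lq_norm (G := fun x => n%:R `^ q^-1 * G x) _ _ _ p0 q0 _) _.
- exact: a0.
- exact: ca.
- by move=> x; rewrite mulr_ge0.
- move=> x; rewrite powRM// -powRrM mulVf ?gt_eqF// powRr1//.
  rewrite -[leLHS]/(\sum_(i < n) _) mulr_natl -[X in _ *+ X]card_ord -sumr_const.
  apply: ler_sum => i _; rewrite indicE; case: (boolP (x \in E i)) => [/set_mem xE|_].
    by rewrite mulr1 ge0_ler_powR ?nnegrE ?(ltW q0)// aG.
  by rewrite mulr0 powR_ge0.
have -> : tree_const k (p / q) = k^-1.
  by rewrite /tree_const pq invf_le1 ?ltr0n// ler1n n0.
rewrite EFinM (muleC 2%:E) -muleA; apply: lee_wpmul2l; first by rewrite lee_fin invr_ge0 ltW.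
rewrite -ge0_integralZl_EFin//; last 2 first.
- by move=> x _; rewrite lee_fin powR_ge0.
- apply/measurable_EFinP; exact: (measurableT_comp (measurable_powR p)).
apply: ge0_le_integral_nomeas => x _; first by rewrite lee_fin powR_ge0.
rewrite -EFinM lee_fin powRM// -powRrM (_ : q^-1 * p = n%:R^-1); last by rewrite mulrC.
rewrite ler_wpM2r ?powR_ge0//.
rewrite [leRHS](_ : 2 = (2 `^ n%:R) `^ n%:R^-1); last first.
  by rewrite -powRrM mulfV ?powRr1// gt_eqF// ltr0n.
apply: ge0_ler_powR; rewrite ?nnegrE ?invr_ge0 ?powR_ge0//.
by rewrite powR_mulrn// -natrX ler_nat ltnW// ltn_expl.
Qed.

End TreeNorm.

(** * Volumes of boxes, and cubic grids *)

Section Boxes.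
Context (R : realType).

Lemma integral_indic_mulr (D A : set R) (c : \bar R) : measurable D -> measurable A ->
  (0 <= c)%E -> (\int[@lebesgue_measure R]_(x in D) ((\1_A x)%:E * c) =
                 @lebesgue_measure R (A `&` D) * c)%E.
Proof.
move=> mD mA c0; rewrite ge0_integralZr//.
- by rewrite integral_indic.
- by apply/measurable_EFinP; apply: measurable_funTS; exact: measurable_indic.
Qed.

Lemma measurable_box n (A : 'I_n -> set R) : (forall i, measurable (A i)) ->
  measurable [set x : n.-tuple R | forall i, A i (tnth x i)].
Proof.
move=> mA; rewrite (_ : mkset _ = \bigcap_(i in [set: 'I_n]) ((fun x => tnth x i) @^-1` A i)).
  apply: fin_bigcap_measurable => [|i _]; first exact: finite_finset.
  by rewrite -[X in measurable X]setTI; exact: measurable_tnth.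
by apply/seteqP; split=> x h i; [move=> _; exact: h|exact: (h i)].
Qed.

Lemma leb_n_box n (A : 'I_n -> set R) : (forall i, measurable (A i)) ->
  leb_n [set x : n.-tuple R | forall i, A i (tnth x i)] =
  (\prod_(i < n) @lebesgue_measure R (A i))%E.
Proof.
elim: n A => [|n IH] A mA.
  rewrite big_ord0 /leb_n /= indicE mem_set//; by case.
rewrite big_ord_recl /leb_n /=.
pose X := [set x : n.-tuple R | forall i, A (lift ord0 i) (tnth x i)].
have mX : measurable X by exact: (measurable_box (A := fun i => A (lift ord0 i))).
under eq_integral => x _.
  rewrite (_ : (fun y => _) = fun y : n.-tuple R => ((\1_(A ord0) x)%:E * (\1_X y)%:E)%E).
    rewrite int_RnZ//; last first.
      by apply/measurable_EFinP; exact: measurable_indic.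
    rewrite (IH (fun i => A (lift ord0 i)) (fun i => mA _) : int_Rn _ = _); over.
  apply/funext => y; rewrite -EFinM; congr EFin; rewrite !indicE -natrM mulnb; congr (_%:R).
  congr nat_of_bool; apply/idP/andP => [/set_mem h|[/set_mem h0 /set_mem hX]].
    split; apply/mem_set; first exact: (h ord0).
    by move=> i; have := h (lift ord0 i); rewrite tnthS.
  apply/mem_set => i; case: (unliftP ord0 i) => [j|] -> //=.
  by have := hX j; rewrite tnthS.
rewrite integral_indic_mulr//; last by apply: prode_ge0 => i _.
by congr (_ * _)%E; exact: (congr1 (@lebesgue_measure R) (setIT (A ord0))).
Qed.

Lemma measH_setX n (X : set (n.-tuple R)) (S : set R) : measurable X -> measurable S ->
  S `<=` [set t | 0 < t] -> measH [set z | X z.1 /\ S z.2] = (leb_n X * @lebesgue_measure R S)%E.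
Proof.
move=> mX mS S0; rewrite /measH /intH.
under eq_integral => t _.
  rewrite (_ : (fun y => _) = fun y : n.-tuple R => ((\1_S t)%:E * (\1_X y)%:E)%E).
    rewrite int_RnZ//; last by apply/measurable_EFinP; exact: measurable_indic.
    over.
  apply/funext => y; rewrite -EFinM; congr EFin; rewrite !indicE -natrM mulnb; congr (_%:R).
  congr nat_of_bool; apply/idP/andP => [/set_mem[/= h1 h2]|[/set_mem h0 /set_mem hX]].
    by split; apply/mem_set.
  exact/mem_set.
rewrite integral_indic_mulr//; last by apply: int_Rn_ge0 => x; rewrite lee_fin.
rewrite muleC; congr (_ * _)%E; apply: (congr1 (@lebesgue_measure R)).
by apply/setIidPl => t /S0 /=; rewrite in_itv/= andbT.
Qed.

End Boxes.

Section Grids.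
Context (R : realType) (n : nat).
Implicit Types (x y : n.-tuple R) (L : R) (o : 'I_n -> R).

Definition gcell L o x : n.-tuple int := [tuple Num.floor (tnth x i / L + o i) | i < n].

Lemma gcellP L o x (j : n.-tuple int) : 0 < L -> gcell L o x = j <->
  forall i, L * ((tnth j i)%:~R - o i) <= tnth x i < L * ((tnth j i)%:~R + 1 - o i).
Proof.
move=> L0; split=> [<- i|h].
  rewrite tnth_mktuple; have := floor_itv (tnth x i / L + o i).
  by rewrite rmorphD/= -lerBlDr -ltrBrDr ler_pdivlMr// ltr_pdivrMr// !(mulrC L).
apply: eq_from_tnth => i; rewrite tnth_mktuple; apply: floor_def.
have := h i; rewrite rmorphD/= -lerBlDr -ltrBrDr ler_pdivlMr// ltr_pdivrMr//.
by rewrite !(mulrC L).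
Qed.

Let gitv L o (j : n.-tuple int) (i : 'I_n) : set R :=
  `[L * ((tnth j i)%:~R - o i), L * ((tnth j i)%:~R + 1 - o i)[%classic.

Let gcell_fiber L o (j : n.-tuple int) : 0 < L -> gcell L o @^-1` [set j] =
  [set x | forall i, gitv L o j i (tnth x i)].
Proof.
by move=> L0; apply/seteqP; split=> x /=; rewrite gcellP// => h i;
  have := h i; rewrite /gitv /= in_itv.
Qed.

Lemma measurable_gcell L o j : 0 < L -> measurable (gcell L o @^-1` [set j]).
Proof.
move=> L0; rewrite gcell_fiber//; apply: (measurable_box (A := gitv L o j)) => i.
exact: measurable_itv.
Qed.

Lemma leb_n_gcell L o j : 0 < L -> leb_n (gcell L o @^-1` [set j]) = (L ^+ n)%:E.
Proof.
move=> L0; rewrite gcell_fiber// (leb_n_box (A := gitv L o j)); last first.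
  by move=> i; exact: measurable_itv.
rewrite (eq_bigr (fun=> L%:E)) => [|i _]; last first.
  rewrite lebesgue_measure_itv/= lte_fin.
  rewrite ltr_pM2l// ifT; last by lra.
  by rewrite -EFinB; congr EFin; ring.
by rewrite big_const_ord; elim: n => [//|m IH]; rewrite iterS IH -EFinM exprS.
Qed.

Lemma gcell_exists L o j : 0 < L -> exists x, gcell L o x = j.
Proof.
move=> L0; exists [tuple L * ((tnth j i)%:~R - o i) | i < n].
apply/gcellP => // i; rewrite tnth_mktuple lexx ltr_pM2l//=; lra.
Qed.

(* One-third trick: points closer than [L / 2] share a cell of a grid shifted by 0 or
   1/2 in each coordinate, and these grids are nested under tripling of [L] because
   3 is odd. *)
Definition half_shift (s : {ffun 'I_n -> bool}) (i : 'I_n) : R := (s i)%:R / 2.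

Lemma gcell_triple L s : 0 < L ->
  cellwise (gcell L (half_shift s)) (gcell (3 * L) (half_shift s)).
Proof.
move=> L0 x y xy; apply: eq_from_tnth => i; rewrite !tnth_mktuple.
have : Num.floor (tnth x i / L + half_shift s i) = Num.floor (tnth y i / L + half_shift s i).
  by have := congr1 (fun t => tnth t i) xy; rewrite !tnth_mktuple.
(* In the fine coordinate w = u / L + s/2 the coarse one is (w + s) / 3 with an integer s, because
   3s/2 = s/2 + s. Its floor depends only on the floor of w. *)
have E (u : R) : u / (3 * L) + half_shift s i = (u / L + half_shift s i + (s i)%:R) / 3.
  by rewrite /half_shift; field; rewrite gt_eqF.
rewrite !E; move: (_ / L + _) (_ / L + _) => u v uv.
have key (w : R) (k : int) :
    (k <= Num.floor ((w + (s i)%:R) / 3)) = (3 * k - (s i)%:Z <= Num.floor w).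
  rewrite !floor_ge_int ler_pdivlMr// rmorphB rmorphM/= lerBlDr mulrC.
  by case: (s i).
by apply/eqP; rewrite eq_le key -uv -key lexx key uv -key lexx.
Qed.

Lemma half_shift_near L x y : 0 < L -> (forall i, `|tnth x i - tnth y i| < L / 2) ->
  exists s, gcell L (half_shift s) x = gcell L (half_shift s) y.
Proof.
move=> L0 xy.
(* If an integer separates two reals less than 1/2 apart, both are within 1/2 of it, and adding 1/2
   brings both into the unit interval that starts at this integer. *)
have key (u v : R) : u <= v -> v < u + 2^-1 -> Num.floor u != Num.floor v ->
    Num.floor (u + 2^-1) = Num.floor (v + 2^-1).
  move=> uv vu uv'; have /andP[v1 v2] := floor_itv v.
  have um : u < (Num.floor v)%:~R.
    rewrite -floor_lt_int lt_neqAle uv'/=; exact: le_floor.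
  rewrite rmorphD/= in v2.
  by rewrite (@floor_def _ (u + 2^-1) (Num.floor v)) ?(@floor_def _ (v + 2^-1) (Num.floor v))//
    rmorphD/=; apply/andP; split; lra.
(* A coordinate is shifted exactly when a wall of the unshifted grid separates [x] from [y] in
   it. *)
exists [ffun i => Num.floor (tnth x i / L) != Num.floor (tnth y i / L)].
apply: eq_from_tnth => i; rewrite !tnth_mktuple /half_shift !ffunE.
have [e|ne] := eqVneq (Num.floor (tnth x i / L)) (Num.floor (tnth y i / L)).
  by rewrite mul0r !addr0.
rewrite mul1r.
have := xy i; rewrite ltr_norml => /andP[h1 h2].
have E : tnth x i / L - tnth y i / L = (tnth x i - tnth y i) / L by ring.
have l1 : - 2^-1 < tnth x i / L - tnth y i / L.
  by rewrite E ltr_pdivlMr//; lra.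
have l2 : tnth x i / L - tnth y i / L < 2^-1.
  by rewrite E ltr_pdivrMr//; lra.
have [xy'|yx'] := leP (tnth x i / L) (tnth y i / L).
  by apply: key => //; lra.
by apply/esym/key; [exact: ltW|lra|rewrite eq_sym].
Qed.

(** Index of the small cell at position [d] inside the large cell [j]. The large side is an even
    multiple [2 * H] of the small one, so a half shift of the large grid is [H] whole small cells,
    and the unshifted small grid refines every shifted large one. *)
Definition subcell (H : nat) (s : {ffun 'I_n -> bool}) (d : {ffun 'I_n -> 'I_(2 * H)})
    (j : n.-tuple int) : n.-tuple int :=
  [tuple (2 * H)%:Z * tnth j i - H%:Z * (s i)%:Z + (d i)%:Z | i < n].

Lemma floor_subcell (H : nat) (b : bool) (u : R) (j : int) : (0 < H)%N ->
  (Num.floor (u / (2 * H)%:R + b%:R / 2) == j) =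
  ((2 * H)%:Z * j - H%:Z * b%:Z <= Num.floor u < (2 * H)%:Z * j - H%:Z * b%:Z + (2 * H)%:Z).
Proof.
move=> H0; have H0' : (0 : R) < H%:R by rewrite ltr0n.
have E : ((2 * H)%:Z * j - H%:Z * b%:Z)%:~R = 2 * H%:R * j%:~R - H%:R * b%:R :> R.
  by rewrite rmorphB/= !intrM -!pmulrn natrM.
rewrite floor_eq floor_ge_int floor_lt_int (rmorphD _ (_ - _)) (rmorphD _ j) E /= -!pmulrn natrM.
set h := H%:R : R in H0' *.
have -> : u / (2 * h) + b%:R / 2 = (u + h * b%:R) / (2 * h) by field; rewrite gt_eqF.
rewrite ler_pdivlMr ?mulr_gt0// ltr_pdivrMr ?mulr_gt0//.
by congr (_ && _); apply/idP/idP => hh; lra.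
Qed.

Lemma gcell_subcell L H s x j : 0 < L -> (0 < H)%N ->
  gcell ((2 * H)%:R * L) (half_shift s) x = j <->
  exists d : {ffun 'I_n -> 'I_(2 * H)}, gcell L (fun=> 0) x = subcell s d j.
Proof.
move=> L0 H0.
have E (u : R) : u / ((2 * H)%:R * L) = u / L / (2 * H)%:R.
  by rewrite invfM mulrA mulrAC.
split=> [<-|[d xd]].
  have dP i : {d : 'I_(2 * H) | Num.floor (tnth x i / L) =
     (2 * H)%:Z * tnth (gcell ((2 * H)%:R * L) (half_shift s) x) i - H%:Z * (s i)%:Z + d%:Z}.
    rewrite tnth_mktuple E /half_shift.
    have := eqxx (Num.floor (tnth x i / L / (2 * H)%:R + (s i)%:R / 2)).
    rewrite floor_subcell//; set k := Num.floor (_ / _ + _); set f := Num.floor (tnth x i / L) => hf.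
    have lt : (`|(f - ((2 * H)%:Z * k - H%:Z * (s i)%:Z))%R| < 2 * H)%N by lia.
    by exists (Ordinal lt) => /=; lia.
  exists [ffun i => sval (dP i)]; apply: eq_from_tnth => i.
  rewrite [RHS]tnth_mktuple ffunE; case: (dP i) => d /= <-.
  by rewrite tnth_mktuple addr0.
apply: eq_from_tnth => i; rewrite tnth_mktuple E /half_shift.
apply/eqP; rewrite floor_subcell//.
have := congr1 (fun t => tnth t i) xd; rewrite !tnth_mktuple addr0 => ->.
by have := ltn_ord (d i); lia.
Qed.

End Grids.

(** * Gauges of L^r *)

Section Gauge.
Context (R : realType).
Implicit Types (r : \bar R) (x y k : R).
Local Open Scope ereal_scope.

(* [gauge r] is the Orlicz-type gauge of L^r, so that for every exponent,
   finite or not, the average of [gauge r (h / l)] is bounded by 1 iff the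
   normalised L^r norm of h is at most l. *)
Definition gauge r x : \bar R :=
  if r == +oo then (if (x <= 1)%R then 0 else +oo) else (x `^ fine r)%:E.

Variant exponent_spec r : Type :=
  | ExponentFin (s : R) of (0 < s)%R & r = s%:E & einv r = (s^-1)%R
  | ExponentInf of r = +oo & einv r = 0%R.

Lemma exponentP r : 0 < r -> exponent_spec r.
Proof.
case: r => [s| |] //= r0; last by apply: ExponentInf => //; rewrite /einv eqxx.
by apply: (@ExponentFin _ s).
Qed.

Lemma einv_ge0 r : 0 < r -> (0 <= einv r)%R.
Proof. by case/exponentP => [s s0 _ ->|_ -> //]; rewrite invr_ge0 ltW. Qed.

Lemma einv_eq0 r : 0 < r -> einv r = 0%R -> r = +oo.
Proof. by case/exponentP => [s s0 _ -> /eqP|->//]; rewrite invr_eq0 gt_eqF. Qed.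

Lemma gauge_ge0 r x : 0 <= gauge r x.
Proof. by rewrite /gauge; case: ifP => _; [case: ifP|rewrite lee_fin powR_ge0]. Qed.

Lemma gauge_fin (s x : R) : gauge s%:E x = (x `^ s)%:E. Proof. by []. Qed.

Lemma gauge_inf x : gauge +oo x = if (x <= 1)%R then 0 else +oo.
Proof. by rewrite /gauge eqxx. Qed.

Lemma gauge0 r : 0 < r -> gauge r 0 = 0.
Proof.
case/exponentP => [s s0 -> _|-> _]; last by rewrite gauge_inf ler01.
by rewrite gauge_fin powR0// gt_eqF.
Qed.

Lemma gauge_le r x y : 0 < r -> (0 <= x)%R -> (x <= y)%R -> gauge r x <= gauge r y.
Proof.
case/exponentP => [s s0 -> _|-> _] x0 xy; rewrite ?gauge_fin ?gauge_inf.
  by rewrite lee_fin powR_ler// ltW.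
by case: (leP y 1%R) => y1; [rewrite (le_trans xy)|rewrite leey].
Qed.

Lemma measurable_gauge r : measurable_fun [set: R] (gauge r).
Proof.
rewrite /gauge; case: (r == +oo); last by apply/measurable_EFinP; exact: measurable_powR.
by apply: measurable_fun_ifT => //; exact: measurable_fun_ler.
Qed.

(** A substitute for homogeneity: factors in front of a gauge are traded for factors in its
    argument. The gauge of [+oo] has only the values 0 and [+oo], on which multiplication by [k] has
    no effect, so [c = 1] works there. *)
Lemma gauge_scale r k : 0 < r -> (0 < k)%R ->
  exists2 c : R, (0 < c)%R & forall x, (0 <= x)%R -> k%:E * gauge r (c * x) <= gauge r x.
Proof.
case/exponentP => [s s0 -> _|-> _] k0; last first.
  exists 1%R => // x _; rewrite mul1r gauge_inf; case: ifP => _; first by rewrite mule0.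
  by rewrite leey.
exists (k `^ (- s^-1))%R; first exact: powR_gt0.
move=> x x0; rewrite !gauge_fin -EFinM lee_fin powRM ?powR_ge0// -powRrM mulNr mulVf ?gt_eqF//.
by rewrite powR_inv1 ?(ltW k0)// mulrA mulfV ?gt_eqF// mul1r.
Qed.

(** Let w be the larger of x^s1 and y^s2. Then x <= w^(1/s1) and y <= w^(1/s2), and the exponents
    add up to 1/s0. *)
Lemma powR_mul_le (s0 s1 s2 x y : R) : (0 < s0)%R -> (0 < s1)%R -> (0 < s2)%R ->
  (s0^-1 = s1^-1 + s2^-1 -> 0 <= x -> 0 <= y -> (x * y) `^ s0 <= x `^ s1 + y `^ s2)%R.
Proof.
move=> s00 s10 s20 E x0 y0; set w := Num.max (x `^ s1)%R (y `^ s2)%R.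
have w0 : (0 <= w)%R by rewrite le_max powR_ge0.
have xw : (x <= w `^ s1^-1)%R.
  rewrite -[leLHS](powRr1 x0) -(mulfV (lt0r_neq0 s10)) powRrM.
  by rewrite powR_ler ?powR_ge0 ?invr_ge0 ?(ltW s10)// le_max lexx.
have yw : (y <= w `^ s2^-1)%R.
  rewrite -[leLHS](powRr1 y0) -(mulfV (lt0r_neq0 s20)) powRrM.
  by rewrite powR_ler ?powR_ge0 ?invr_ge0 ?(ltW s20)// le_max lexx orbT.
apply: (@le_trans _ _ w); last first.
  by rewrite /w /Num.max; case: ifP => _; rewrite (lerDl, lerDr) powR_ge0.
rewrite -[leRHS](powRr1 w0) -(mulVf (lt0r_neq0 s00)) powRrM E.
rewrite powRD; last by rewrite gt_eqF ?addr_gt0 ?invr_gt0.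
by rewrite powR_ler ?mulr_ge0 ?(ltW s00)// ler_pM.
Qed.

(** Pointwise form of Hölder's inequality. A factor with infinite exponent adds 0 if it is at most
    1, and makes the right side infinite otherwise. *)
Lemma gauge_mul r0 r1 r2 x y : 0 < r0 -> 0 < r1 -> 0 < r2 ->
  einv r0 = (einv r1 + einv r2)%R -> (0 <= x)%R -> (0 <= y)%R ->
  gauge r0 (x * y) <= gauge r1 x + gauge r2 y.
Proof.
move=> h0 h1 h2 + x0 y0.
case/exponentP: h1 => [s1 s10 -> ->|-> ->]; case/exponentP: h2 => [s2 s20 -> ->|-> ->];
  case/exponentP: h0 => [s0 s00 -> ->|-> ->]; rewrite ?addr0 ?add0r => E.
- by rewrite !gauge_fin -EFinD lee_fin powR_mul_le.
- by have : (0 < s1^-1 + s2^-1)%R; [rewrite addr_gt0 ?invr_gt0|rewrite -E ltxx].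
- rewrite gauge_inf; case: ifP => [y1|_]; last by rewrite addey ?leey// gauge_fin.
  rewrite adde0 (invr_inj E) !gauge_fin lee_fin powR_ler ?mulr_ge0 ?(ltW s10)//.
  exact: ler_piMr.
- by have : (0 < s1^-1)%R; [rewrite invr_gt0|rewrite -E ltxx].
- rewrite gauge_inf; case: ifP => [x1|_]; last by rewrite addye ?leey// gauge_fin.
  rewrite add0e (invr_inj E) !gauge_fin lee_fin powR_ler ?mulr_ge0 ?(ltW s20)//.
  exact: ler_piMl.
- by have : (0 < s2^-1)%R; [rewrite invr_gt0|rewrite -E ltxx].
- by have : (0 < s0^-1)%R; [rewrite invr_gt0|rewrite E ltxx].
- rewrite !gauge_inf; case: (leP x 1%R) => x1; case: (leP y 1%R) => y1;
    rewrite ?adde0 ?add0e ?leey//.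
  by rewrite ifT// mulr_ile1.
Qed.

(** For finite exponents the relation reads k s1 = s0 and both sides coincide. With infinite ones it
    rests on x^0 = 1 and on powers of numbers up to 1 being at most 1. *)
Lemma gauge_pow r0 r1 k x : 0 < r0 -> 0 < r1 -> (0 <= k)%R ->
  einv r1 = (k * einv r0)%R -> (0 <= x)%R -> gauge r1 (x `^ k) <= gauge r0 x.
Proof.
move=> h0 h1 k0 + x0.
case/exponentP: h1 => [s1 s10 -> ->|-> ->]; case/exponentP: h0 => [s0 s00 -> ->|-> ->] E.
- rewrite !gauge_fin lee_fin -powRrM.
  suff -> : (k * s1)%R = s0 by [].
  by rewrite -[k](mulfVK (lt0r_neq0 s00)) -E mulrAC mulVf ?mul1r// gt_eqF.
- by have : (0 < s1^-1)%R; [rewrite invr_gt0|rewrite E mulr0 ltxx].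
- move/esym/eqP: E; rewrite mulf_eq0 invr_eq0 (gt_eqF s00) orbF => /eqP ->.
  by rewrite powRr0 gauge_inf lexx gauge_ge0.
- rewrite !gauge_inf; case: (leP x 1%R) => [x1|_]; last by rewrite leey.
  by rewrite ifT// (le_trans (powR_ler k0 x0 x1))// powR1.
Qed.

Lemma gauge2_ge1 r : 0 < r -> 1 <= gauge r 2.
Proof.
case/exponentP => [s s0 -> _|-> _]; last by rewrite gauge_inf ifF ?leey// leNgt ltr1n.
by rewrite gauge_fin lee_fin -[leLHS](powRr0 2) ler_powR ?ler1n ?(ltW s0).
Qed.

End Gauge.

(** * Integrals of gauges over subsets of the half-space *)

Section WhitneyAverages.
Context (R : realType) (n : nat).
Implicit Types (h : n.-tuple R * R -> R) (r : \bar R) (A B : set (n.-tuple R * R)).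

Definition gaugeH r A h : \bar R := intH (fun z => ((\1_A z)%:E * gauge r (h z))%E).

Let term_ge0 r A h z : (0 <= (\1_A z)%:E * gauge r (h z))%E.
Proof. by rewrite mule_ge0 ?gauge_ge0. Qed.

Lemma measurable_gauge_term r A h : measurable A -> measurable_fun [set: n.-tuple R * R] h ->
  measurable_fun [set: n.-tuple R * R] (fun z => ((\1_A z)%:E * gauge r (h z))%E).
Proof.
move=> mA mh; apply: emeasurable_funM.
  by apply/measurable_EFinP; exact: measurable_indic.
by apply: (measurableT_comp (measurable_gauge r)).
Qed.

Lemma gaugeH_subset r A B h : (forall z, A z -> B z) -> (gaugeH r A h <= gaugeH r B h)%E.
Proof.
move=> AB; apply: intH_le => // z; rewrite !indicE.
case: (boolP (z \in A)) => [/set_mem/AB zB|_]; first by rewrite mem_set.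
by rewrite mul0e mule_ge0 ?gauge_ge0.
Qed.

Lemma gaugeH_le r A h h' : (0 < r)%E -> (forall z, A z -> 0 <= h z <= h' z) ->
  (gaugeH r A h <= gaugeH r A h')%E.
Proof.
move=> r0 hh; apply: intH_le => // z; rewrite !indicE.
case: (boolP (z \in A)) => [/set_mem/hh/andP[? ?]|_]; last by rewrite !mul0e.
by rewrite !mul1e gauge_le.
Qed.

Lemma gaugeH_le_mul r A h h' (c k : R) : measurable A -> measurable_fun [set: n.-tuple R * R] h' ->
  0 < k -> (forall x : R, (0 <= x)%R -> k%:E * gauge r (c * x)%R <= gauge r x)%E ->
  (forall z, A z -> 0 <= h z) -> (forall z, A z -> h' z = c * h z) ->
  (k%:E * gaugeH r A h' <= gaugeH r A h)%E.
Proof.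
move=> mA mh k0 kc h0 hh.
rewrite /gaugeH -intHZ ?(ltW k0)//; last exact: measurable_gauge_term.
apply: intH_le => z; first by rewrite mule_ge0// lee_fin ltW.
rewrite !indicE; case: (boolP (z \in A)) => [/set_mem zA|_]; last by rewrite !mul0e mule0.
by rewrite !mul1e hh// kc// h0.
Qed.

Lemma gaugeH_mul r0 r1 r2 A h1 h2 : (0 < r0)%E -> (0 < r1)%E -> (0 < r2)%E ->
  einv r0 = einv r1 + einv r2 -> measurable A ->
  measurable_fun [set: n.-tuple R * R] h1 -> measurable_fun [set: n.-tuple R * R] h2 ->
  (forall z, A z -> 0 <= h1 z) -> (forall z, A z -> 0 <= h2 z) ->
  (gaugeH r0 A (fun z => (h1 z * h2 z)%R) <= gaugeH r1 A h1 + gaugeH r2 A h2)%E.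
Proof.
move=> r00 r10 r20 E mA mh1 mh2 h10 h20.
rewrite /gaugeH -intHD//; [|exact: measurable_gauge_term..].
apply: intH_le => z; first exact: (term_ge0 r0 A (fun z => h1 z * h2 z) z).
rewrite !indicE; case: (boolP (z \in A)) => [/set_mem zA|_]; last by rewrite !mul0e adde0.
by rewrite !mul1e gauge_mul// ?h10// h20.
Qed.

Lemma gaugeH_bigcup_le r A h (J : eqType) (s : seq J) (B : J -> set (n.-tuple R * R)) :
  measurable_fun [set: n.-tuple R * R] h -> (forall j, measurable (B j)) ->
  (forall z, A z -> exists2 j, j \in s & B j z) ->
  (gaugeH r A h <= \sum_(j <- s) gaugeH r (B j) h)%E.
Proof.
move=> mh mB AB; rewrite /gaugeH -(functional_sum (@intHZ R n) (@intHD R n))//; last first.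
  by move=> j; exact: measurable_gauge_term.
apply: intH_le => // z; rewrite {1}indicE.
case: (boolP (z \in A)) => [/set_mem/AB[j js zj]|_]; last first.
  by rewrite mul0e sume_ge0.
rewrite mul1e (big_rem j)//= indicE mem_set// mul1e leeDl// sume_ge0//.
Qed.

Lemma gaugeH_finE (s l : R) A h : 0 < l -> measurable A ->
  measurable_fun [set: n.-tuple R * R] h -> (forall z, 0 <= h z) ->
  gaugeH s%:E A (fun z => h z / l) =
  ((l `^ (- s))%:E * intH (fun z => (\1_A z)%:E * poweR (h z)%:E s))%E.
Proof.
move=> l0 mA mh h0; rewrite -intHZ ?powR_ge0//.
- congr intH; apply/funext => w; rewrite gauge_fin muleCA; congr (_ * _)%E.
  by rewrite -EFinM powRM ?h0 ?invr_ge0 ?(ltW l0)// mulrC -powR_inv1 ?(ltW l0)// -powRrM mulN1r.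
- apply: emeasurable_funM; apply/measurable_EFinP; first exact: measurable_indic.
  exact: (measurableT_comp (measurable_powR s)).
- by move=> w; rewrite mule_ge0// lee_fin// powR_ge0.
Qed.

Lemma measH_bigcup_null (F : (set (n.-tuple R * R))^nat) : (forall k, measurable (F k)) ->
  (forall k, measH (F k) = 0%E) -> measH (\bigcup_k F k) = 0%E.
Proof.
move=> mF F0; apply/eqP; rewrite eq_le measure_ge0 andbT.
apply: le_trans (measure_sigma_subadditive _ _ _ (@subset_refl _ _)) _ => //.
- exact: bigcupT_measurable.
- by rewrite eseries0// => i _ _; exact: F0.
Qed.

(** As l tends to 0 the gauge of h / l becomes arbitrarily large wherever h is bounded below, so the
    set where this happens has arbitrarily small measure. It is needed on boxes whose coefficient is
    0. *)
Lemma gaugeH_null r A h (C : R) : (0 < r)%E -> measurable A ->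
  measurable_fun [set: n.-tuple R * R] h -> (forall z, A z -> 0 <= h z) ->
  (forall l : R, 0 < l -> (gaugeH r A (fun z => (h z / l)%R) <= C%:E)%E) ->
  measH [set z | A z /\ 0 < h z] = 0%E.
Proof.
move=> r0 mA mh h0 hC.
pose F k := A `&` [set z | k.+1%:R^-1 <= h z].
have mF k : measurable (F k).
  apply: measurableI => //; rewrite (_ : mkset _ = h @^-1` `[k.+1%:R^-1, +oo[).
    by rewrite -[X in measurable X]setTI; apply: mh => //; exact: measurable_itv.
  by apply/seteqP; split=> z; rewrite /= in_itv/= andbT.
have -> : [set z | A z /\ 0 < h z] = \bigcup_k F k.
  apply/seteqP; split=> z [].
    move=> Az hz; have [k hk] := ltr_add_invr hz.
    by exists k => //; split => //=; apply: ltW; rewrite add0r in hk.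
  by move=> k _ [Az /= hz]; split => //; apply: lt_le_trans hz; rewrite invr_gt0 ltr0n.
apply: measH_bigcup_null => // k.
apply/eqP; rewrite eq_le measure_ge0 andbT; apply/lee_addgt0Pr => e e0; rewrite add0e.
have Ce : (0 < (`|C| + 1) / e)%R by rewrite divr_gt0// ltr_wpDl.
have [c c0 cP] := gauge_scale r0 Ce.
set d : R := k.+1%:R^-1.
have d0 : 0 < d by rewrite invr_gt0 ltr0n.
(* On [F k] this makes h / l at least 2 / c, whose gauge is at least (|C| + 1) / e times
   [gauge r 2]. The number 2 is taken because [gauge +oo 1] is 0. *)
have l0 : 0 < d * c / 2 by rewrite divr_gt0// mulr_gt0.
have key : (((`|C| + 1) / e)%:E * measH (F k) <= C%:E)%E.
  apply: le_trans (hC _ l0); rewrite -intHZ ?(ltW Ce)//; last 1 first.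
    by apply/measurable_EFinP; exact: measurable_indic.
  apply: intH_le => z; first by rewrite mule_ge0 ?lee_fin ?(ltW Ce).
  rewrite !indicE; case: (boolP (z \in F k)) => [/set_mem[zA zd]|_]; last first.
    by rewrite mule0 mule_ge0 ?gauge_ge0.
  rewrite mem_set// mul1e mule1.
  have x0 : 0 <= 2 / c by rewrite divr_ge0// ltW.
  apply: (@le_trans _ _ (gauge r (2 / c))).
    apply: le_trans (cP _ x0); rewrite (_ : c * (2 / c) = 2); last by rewrite mulrC mulfVK// gt_eqF.
    by rewrite -[leLHS]mule1 lee_wpmul2l ?gauge2_ge1// lee_fin ltW.
  apply: gauge_le => //.
  rewrite ler_pdivlMr// (_ : 2 / c * _ = d)//; field; rewrite gt_eqF//.
have [m mE] : exists m, measH (F k) = m%:E.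
  have m0 : (0 <= measH (F k))%E by apply: intH_ge0 => z; rewrite lee_fin.
  move: m0 key; case: (measH (F k)) => [m _ _|_|//]; first by exists m.
  by rewrite gt0_muley.
rewrite mE -EFinM lee_fin in key *.
rewrite lee_fin -(ler_pM2l Ce); apply: le_trans key _.
by rewrite mulfVK ?gt_eqF// (le_trans (ler_norm _))// lerDl.
Qed.

End WhitneyAverages.

(** * Whitney boxes *)

Local Notation edist := Defs.edist.

Section EuclideanDistance.
Context (R : realType) (n : nat).
Implicit Types y z : n.-tuple R.

Lemma edistC y z : edist y z = edist z y.
Proof. by congr Num.sqrt; apply: eq_bigr => i _; rewrite -sqrrN opprB. Qed.

Lemma edistxx y : edist y y = 0.
Proof. by rewrite /edist big1 ?sqrtr0// => i _; rewrite subrr expr0n. Qed.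

Lemma coord_le_edist y z i : `|tnth y i - tnth z i| <= edist y z.
Proof.
rewrite -sqrtr_sqr ler_sqrt; last by apply: sumr_ge0 => j _; exact: sqr_ge0.
by rewrite (bigD1 i)//= lerDl; apply: sumr_ge0 => j _; exact: sqr_ge0.
Qed.

Lemma edist_lt y z (r : R) : (0 < n)%N -> 0 < r ->
  (forall i, `|tnth y i - tnth z i| < r / n%:R) -> edist y z < r.
Proof.
move=> n0 r0 yz; have nR : (0 : R) < n%:R by rewrite ltr0n.
rewrite (_ : r = Num.sqrt (r ^+ 2)); last by rewrite sqrtr_sqr gtr0_norm.
rewrite ltr_sqrt ?exprn_gt0//.
apply: (@lt_le_trans _ _ (\sum_(i < n) (r / n%:R) ^+ 2)).
  apply: ltr_sum; first by apply/hasP; exists (Ordinal n0) => //; rewrite mem_index_enum.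
  by move=> i _; rewrite -real_normK ?num_real// ltr_pXn2r// ?nnegrE// divr_ge0// ltW.
rewrite sumr_const card_ord -[_ *+ n]mulr_natl.
rewrite (_ : _ * _ = r ^+ 2 / n%:R); last by field; rewrite gt_eqF.
by rewrite ler_pdivrMr// ler_peMr ?sqr_ge0// ler1n.
Qed.

End EuclideanDistance.

Section WhitneyBoxes.
Context (R : realType) (n : nat) (a1 a2 : R).
Hypothesis hn : (0 < n)%N.
Hypothesis ha1 : 0 < a1.
Hypothesis ha12 : a1 < a2^-1.
Hypothesis ha2 : a2^-1 < 1.

Let nR : (0 : R) < n%:R. Proof. by rewrite ltr0n. Qed.

Lemma aperture_gt1 : 1 < a2.
Proof.
have : 0 < a2^-1 by exact: lt_trans ha1 ha12.
by rewrite invr_gt0 => a20; rewrite -invf_lt1.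
Qed.

Let a20 : 0 < a2. Proof. exact: lt_trans aperture_gt1. Qed.
Let a11 : a1 < 1. Proof. exact: lt_trans ha2. Qed.

(** This is a2^m for integer m; [lev t] is the integer part of the logarithm of t to base a2, and
    [tri k] is 3^k. *)
Definition scale (m : int) : R := expR (m%:~R * ln a2).
Definition lev (t : R) : int := Num.floor (ln t / ln a2).
Definition tri (k : int) : R := expR (k%:~R * ln 3).
(** Exponent of the largest power of 3 not above a1 a2^m / n. The bound makes the diameter of a cell
    small against the aperture, and the power of 3 keeps the coarse grids nested. *)
Definition trilev (m : int) : int := Num.floor ((m%:~R * ln a2 + ln (a1 / n%:R)) / ln 3).
(** The half compensates the factor 2 in [bigside], which has to be an even multiple of [side] and
    at the same time an exact power of 3. *)
Definition side (m : int) : R := tri (trilev m) / 2.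

Lemma scale_gt0 m : 0 < scale m. Proof. exact: expR_gt0. Qed.

Lemma scaleS m : scale (m + 1) = a2 * scale m.
Proof. by rewrite /scale rmorphD mulrDl mul1r expRD (lnK a20) mulrC. Qed.

Lemma scale_le m m' : m <= m' -> scale m <= scale m'.
Proof. by move=> mm; rewrite ler_expR ler_wpM2r ?ler_int// ln_ge0// ltW// aperture_gt1. Qed.

Lemma levP t : 0 < t -> scale (lev t) <= t < scale (lev t + 1).
Proof.
move=> t0; have l0 : 0 < ln a2 by rewrite ln_gt0// aperture_gt1.
suff : scale (lev t) <= expR (ln t) < scale (lev t + 1) by rewrite lnK.
rewrite ler_expR ltr_expR.
by rewrite -ler_pdivlMr// -ltr_pdivrMr//; exact: floor_itv.
Qed.

Lemma lev_eq t m : scale m <= t < scale (m + 1) -> lev t = m.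
Proof.
move=> /andP[mt tm]; have t0 : 0 < t by exact: lt_le_trans (scale_gt0 m) mt.
have l0 : 0 < ln a2 by rewrite ln_gt0// aperture_gt1.
apply: floor_def; rewrite ler_pdivlMr// ltr_pdivrMr//.
by rewrite -ler_expR -ltr_expR lnK//; apply/andP.
Qed.

Lemma tri_gt0 k : 0 < tri k. Proof. exact: expR_gt0. Qed.

Lemma triS k : tri (k + 1) = 3 * tri k.
Proof. by rewrite /tri rmorphD mulrDl mul1r expRD lnK ?posrE// mulrC. Qed.

Lemma side_gt0 m : 0 < side m. Proof. by rewrite divr_gt0// tri_gt0. Qed.

Lemma side_scale m : 2 * side m <= a1 / n%:R * scale m < 6 * side m.
Proof.
have l3 : 0 < ln 3 :> R by rewrite ln_gt0// ltr1n.
have d0 : 0 < a1 / n%:R by rewrite divr_gt0.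
rewrite /side mulrC mulfVK// (_ : 6 * _ = tri (trilev m + 1)); last first.
  by rewrite triS; field.
suff : tri (trilev m) <= expR (ln (a1 / n%:R)) * scale m < tri (trilev m + 1) by rewrite lnK.
rewrite -expRD /tri ler_expR ltr_expR -ler_pdivlMr// -ltr_pdivrMr// addrC.
exact: floor_itv.
Qed.

Lemma trilev_le m m' : m <= m' -> trilev m <= trilev m'.
Proof.
move=> mm; apply: le_floor; rewrite ler_wpM2r ?invr_ge0 ?ln_ge0 ?ler1n//.
by rewrite lerD2r ler_wpM2r ?ler_int// ln_ge0// ltW// aperture_gt1.
Qed.

Definition cell (m : int) : n.-tuple R -> n.-tuple int := gcell (side m) (fun=> 0).

Definition wbox (m : int) (j : n.-tuple int) : set (n.-tuple R * R) :=
  [set z | cell m z.1 = j /\ scale m <= z.2 < scale (m + 1)].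

Definition wvol (m : int) : R := side m ^+ n * ((a2 - 1) * scale m).

Lemma wvol_gt0 m : 0 < wvol m.
Proof. by rewrite mulr_gt0 ?exprn_gt0 ?side_gt0// mulr_gt0 ?scale_gt0// subr_gt0 aperture_gt1. Qed.

Lemma measurable_cell m j : measurable (cell m @^-1` [set j]).
Proof. exact: measurable_gcell (side_gt0 m). Qed.

Lemma wboxE m j : wbox m j = [set z | (cell m @^-1` [set j]) z.1 /\
   `[scale m, scale (m + 1)[%classic z.2].
Proof. by apply/seteqP; split=> z /=; rewrite in_itv. Qed.

Lemma measurable_wbox m j : measurable (wbox m j).
Proof.
rewrite wboxE (_ : mkset _ = (cell m @^-1` [set j]) `*` `[scale m, scale (m + 1)[%classic)//.
by apply: measurableX; [exact: measurable_cell|exact: measurable_itv].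
Qed.

Lemma measH_wbox m j : measH (wbox m j) = (wvol m)%:E.
Proof.
rewrite wboxE measH_setX//; last 2 first.
- exact: measurable_cell.
- move=> t /=; rewrite in_itv/= => /andP[h _]; exact: lt_le_trans (scale_gt0 m) h.
rewrite leb_n_gcell ?side_gt0// lebesgue_measure_itv/= lte_fin scaleS.
rewrite ltr_pMl ?scale_gt0// aperture_gt1 -EFinB -EFinM /wvol; congr EFin; ring.
Qed.

Lemma wbox_mem z : 0 < z.2 -> wbox (lev z.2) (cell (lev z.2) z.1) z.
Proof. by move=> z0; split => //; exact: levP. Qed.

Lemma cell_close m x y i : cell m x = cell m y -> `|tnth x i - tnth y i| < side m.
Proof.
move=> /(gcellP _ _ _ (side_gt0 m)) /(_ i) /andP[x1 x2].
have /(gcellP _ _ _ (side_gt0 m)) /(_ i) /andP[y1 y2] : cell m y = cell m y by [].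
rewrite ltr_norml; apply/andP; split; lra.
Qed.

Lemma cell_edist m x y : cell m x = cell m y -> edist x y < a1 * scale m.
Proof.
move=> xy; apply: edist_lt => //; first by rewrite mulr_gt0// scale_gt0.
move=> i; apply: lt_le_trans (cell_close i xy) _.
have /andP[h _] := side_scale m; have := side_gt0 m.
rewrite mulrAC; lra.
Qed.

(** Two points of a box are closer than a1 times its scale and their heights differ by a factor
    below a2. Hence an average over W(z) controls the box, whichever point z of the box is taken. *)
Lemma wbox_whitney m j z z' : wbox m j z -> wbox m j z' -> whitney a1 a2 z z'.
Proof.
move=> [<- /andP[h1 h2]] [e /andP[h3 h4]]; split.
  by apply: lt_le_trans (cell_edist e) _; rewrite ler_pM2l.
rewrite scaleS in h2 h4; apply/andP; split.
  by rewrite mulrC ltr_pdivrMr// mulrC; apply: lt_le_trans h2 _; rewrite ler_pM2l.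
by apply: lt_le_trans h4 _; rewrite ler_pM2l.
Qed.

Lemma wbox_cone m j x z : cell m x = j -> wbox m j z -> cone x z.
Proof.
move=> <- [e /andP[h1 h2]]; split; first exact: lt_le_trans (scale_gt0 m) h1.
apply: lt_le_trans (cell_edist e) _.
by apply: le_trans h1; rewrite ger_pMl ?scale_gt0// ltW.
Qed.

(** Volume of a Whitney region in units of the box at the same height: its side 2 a1 t is at most 12
    n a2 cell sides, and its height at most a2^2 times the scale, against (a2 - 1) times the scale
    for the box. *)
Definition whitney_ratio : R := (12 * n%:R * a2) ^+ n * (a2 ^+ 2 / (a2 - 1)).

Lemma whitney_ratio_gt0 : 0 < whitney_ratio.
Proof.
have h : 0 < a2 - 1 by rewrite subr_gt0 aperture_gt1.
by rewrite mulr_gt0 ?divr_gt0 ?exprn_gt0 ?mulr_gt0.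
Qed.

Lemma whitney_upper (z z' : n.-tuple R * R) : 0 < z.2 -> whitney a1 a2 z z' -> 0 < z'.2.
Proof. by move=> z0 [_ /andP[h _]]; apply: lt_trans h; rewrite mulr_gt0// invr_gt0. Qed.

Lemma measH_whitney_le (z : n.-tuple R * R) : 0 < z.2 ->
  (measH (whitney a1 a2 z) <= (whitney_ratio * wvol (lev z.2))%:E)%E.
Proof.
move=> z0; set t := z.2 in z0 *; have /andP[t1 t2] := levP z0.
set m := lev t in t1 t2 *.
pose A i : set R := `[tnth z.1 i - a1 * t, tnth z.1 i + a1 * t[%classic.
pose S : set R := `[a2^-1 * t, a2 * t[%classic.
have at0 : 0 < a1 * t by rewrite mulr_gt0.
have mA i : measurable (A i) by exact: measurable_itv.
apply: (@le_trans _ _ (measH [set p : n.-tuple R * R | [set x | forall i, A i (tnth x i)] p.1 /\ S p.2])).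
  apply: intH_le => p; first by rewrite lee_fin.
  rewrite lee_fin !indicE; case: (boolP (p \in whitney a1 a2 z)) => // /set_mem [h1 /andP[h2 h3]].
  rewrite mem_set//; split; last by rewrite /S/= in_itv/= h3 ltW.
  move=> i; rewrite /A/= in_itv/=; have := le_lt_trans (coord_le_edist p.1 z.1 i) h1.
  by rewrite ltr_norml => /andP[k1 k2]; apply/andP; split; rewrite -/t in k1 k2 *; lra.
rewrite measH_setX//; [|exact: measurable_box|exact: measurable_itv|]; last first.
  move=> s; rewrite /S/= in_itv/= => /andP[h _]; apply: lt_le_trans h.
  by rewrite mulr_gt0// invr_gt0.
rewrite leb_n_box// (eq_bigr (fun=> (2 * a1 * t)%:E)); last first.
  move=> i _; rewrite lebesgue_measure_itv/= lte_fin ifT; last by lra.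
  by rewrite -EFinB; congr EFin; ring.
rewrite lebesgue_measure_itv/= lte_fin ltr_pM2r// (lt_trans ha2 aperture_gt1) -EFinB.
have -> : (\prod_(i < n) (2 * a1 * t)%:E = ((2 * a1 * t) ^+ n)%:E)%E.
  by rewrite big_const_ord; elim: (n) => [//|k IH]; rewrite iterS IH -EFinM exprS.
rewrite -EFinM lee_fin /whitney_ratio /wvol.
rewrite [leRHS](_ : _ = (12 * n%:R * a2 * side m) ^+ n * (a2 ^+ 2 * scale m)); last first.
  rewrite [in RHS]exprMn; field; by rewrite subr_eq0 gt_eqF// aperture_gt1.
rewrite scaleS in t2.
apply: ler_pM.
- by rewrite exprn_ge0// !mulr_ge0// ltW.
- by rewrite subr_ge0 ler_pM2r// ltW// (lt_trans ha2 aperture_gt1).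
- have s0 := side_gt0 m; apply: lerXn2r; rewrite ?nnegrE.
  + by apply: ltW; rewrite mulr_gt0// mulr_gt0// mulr_gt0.
  + by apply: ltW; rewrite mulr_gt0// mulr_gt0// mulr_gt0.
  have /andP[_ h] := side_scale m.
  have h' : a1 * scale m < 6 * n%:R * side m.
    by rewrite -mulrAC ltr_pdivrMr// mulrAC in h.
  apply: (@le_trans _ _ (2 * a2 * (a1 * scale m))).
    rewrite (_ : 2 * a2 * (a1 * scale m) = 2 * a1 * (a2 * scale m)); last by ring.
    by rewrite ler_pM2l ?mulr_gt0// ltW.
  by rewrite (_ : 12 * n%:R * a2 * side m = 2 * a2 * (6 * n%:R * side m)) ?ler_pM2l; [exact: ltW|by rewrite mulr_gt0|ring].
- apply: (@le_trans _ _ (a2 * t)).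
    by rewrite gerBl mulr_ge0// ?invr_ge0 ltW.
  by rewrite expr2 -mulrA ler_pM2l// ltW.
Qed.

Lemma measurable_edist_lt (c : n.-tuple R) : measurable_fun [set: n.-tuple R] (fun y => edist y c).
Proof.
have h : measurable_fun [set: n.-tuple R] (fun y : n.-tuple R => \sum_(i < n) (tnth y i - tnth c i) ^+ 2).
  apply: measurable_sum => i; apply: measurable_funX; apply: measurable_funB => //.
  exact: measurable_tnth.
rewrite (_ : (fun y => _) = fun y => (\sum_(i < n) (tnth y i - tnth c i) ^+ 2) `^ 2^-1).
  exact: (measurableT_comp (measurable_powR 2^-1) h).
by apply/funext => y; rewrite powR12_sqrt//; apply: sumr_ge0 => i _; exact: sqr_ge0.
Qed.

Lemma measurable_whitney (z : n.-tuple R * R) : measurable (whitney a1 a2 z).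
Proof.
rewrite (_ : whitney a1 a2 z = ((fun y => edist y z.1) @^-1` `]-oo, (a1 * z.2)[%classic) `*`
    `]a2^-1 * z.2, a2 * z.2[%classic).
  apply: measurableX; last exact: measurable_itv.
  by rewrite -[X in measurable X]setTI; apply: measurable_edist_lt => //; exact: measurable_itv.
by apply/seteqP; split=> w [/=]; rewrite !in_itv.
Qed.

Lemma wvol_le_measH_whitney (z : n.-tuple R * R) : 0 < z.2 ->
  ((wvol (lev z.2))%:E <= measH (whitney a1 a2 z))%E.
Proof.
move=> z0; rewrite -(measH_wbox _ (cell (lev z.2) z.1)); apply: le_measure; rewrite ?inE.
- exact: measurable_wbox.
- exact: measurable_whitney.
- by move=> w; exact: wbox_whitney (wbox_mem z0).
Qed.

Lemma measH_whitney_fin (z : n.-tuple R * R) : 0 < z.2 ->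
  exists2 V, 0 < V & measH (whitney a1 a2 z) = V%:E.
Proof.
move=> z0; have := wvol_le_measH_whitney z0; have := measH_whitney_le z0.
case: (measH _) => [V _|//|//]; rewrite lee_fin => h.
by exists V => //; apply: lt_le_trans h; exact: wvol_gt0.
Qed.

(** Strictness matters for r = [+oo]: an essential supremum is an infimum of essential bounds, and
    only a strict inequality yields such a bound below l. *)
Lemma whitney_avg_lt_gauge r (h : n.-tuple R * R -> R) (z : n.-tuple R * R) (l : R) :
  (0 < r)%E -> measurable_fun [set: n.-tuple R * R] h -> (forall w, 0 <= h w) ->
  0 < z.2 -> 0 < l -> (whitney_avg a1 a2 r (fun w => (h w)%:E) z < l%:E)%E ->
  (gaugeH r (whitney a1 a2 z) (fun w => (h w / l)%R) <= measH (whitney a1 a2 z))%E.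
Proof.
move=> r0 mh h0 z0 l0; have [V V0 VE] := measH_whitney_fin z0.
have mW := measurable_whitney z.
rewrite /whitney_avg VE; case/exponentP: r0 => [s s0 -> _|-> _].
  rewrite gaugeH_finE//= => hl.
  set I := intH _ in hl *.
  have I0 : (0 <= I)%E by apply: intH_ge0 => w; rewrite mule_ge0// lee_fin// powR_ge0.
  have VI0 : (0 <= (V^-1)%:E * I)%E by rewrite mule_ge0// lee_fin invr_ge0 ltW.
  have {hl} : ((V^-1)%:E * I <= (l `^ s)%:E)%E.
    rewrite -[leLHS]poweRe1// -(mulVf (lt0r_neq0 s0)) poweRrM -poweR_EFin.
    by apply: gt0_ler_poweR; rewrite ?(ltW s0) ?in_itv/= ?leey ?poweR_ge0 ?lee_fin ?(ltW l0) ?(ltW hl).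
  move: I I0 {VI0} => [I| |]//= I0; last by rewrite gt0_muley// lte_fin invr_gt0.
  rewrite -!EFinM !lee_fin => hI.
  rewrite powRN ler_pdivrMl ?powR_gt0//.
  by rewrite -ler_pdivrMr// mulrC.
rewrite eqxx /esssupH => /ereal_inf_lt[M /= M0 Ml].
apply: (@le_trans _ _ 0%E); last by rewrite lee_fin ltW.
pose N := whitney a1 a2 z `&` [set w | l < h w].
have mN : measurable N.
  apply: measurableI => //; rewrite (_ : mkset _ = h @^-1` `]l, +oo[).
    by rewrite -[X in measurable X]setTI; apply: mh => //; exact: measurable_itv.
  by apply/seteqP; split=> w; rewrite /= in_itv/= andbT.
have N0 : measH N = 0%E.
  apply/eqP; rewrite eq_le; apply/andP; split; last by apply: intH_ge0 => w; rewrite lee_fin.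
  rewrite -M0; apply: intH_le => w; rewrite ?lee_fin// !indicE.
  case: (boolP (w \in N)) => // /set_mem[Ww /= lw]; rewrite mem_set//; split => //.
  by apply: lt_trans Ml _; rewrite lte_fin.
rewrite /gaugeH (_ : (fun w => _) = fun w => (+oo * (\1_N w)%:E)%E); last first.
  apply/funext => w; rewrite gauge_inf ler_pdivrMr// mul1r !indicE.
  case: (boolP (w \in N)) => [/set_mem[Ww /= lw]|/negP wN].
    by rewrite mem_set// (leNgt (h w)) lw mul1e mule1.
  rewrite mule0; case: (boolP (w \in whitney a1 a2 z)) => [Ww|_]; last by rewrite mul0e.
  case: ifP => [_|hl]; first by rewrite mule0.
  by case: wN; apply/mem_set; split; [exact: set_mem|rewrite /= ltNge hl].
rewrite intHE; last 2 first.
- apply: emeasurable_funM => //; apply/measurable_EFinP; exact: measurable_indic.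
- by move=> w; rewrite mule_ge0// lee_fin.
rewrite ge0_integralZl//.
- by rewrite integral_indic// setIT [X in (_ * X)%E]N0 mule0.
- by apply/measurable_EFinP; exact: measurable_indic.
Qed.

Lemma gauge_le_whitney_avg r (h : n.-tuple R * R -> R) (z : n.-tuple R * R) (l : R) :
  (0 < r)%E -> measurable_fun [set: n.-tuple R * R] h -> (forall w, 0 <= h w) ->
  0 < z.2 -> 0 < l ->
  (gaugeH r (whitney a1 a2 z) (fun w => (h w / l)%R) <= measH (whitney a1 a2 z))%E ->
  (whitney_avg a1 a2 r (fun w => (h w)%:E) z <= l%:E)%E.
Proof.
move=> r0 mh h0 z0 l0; have [V V0 VE] := measH_whitney_fin z0.
have mW := measurable_whitney z.
rewrite /whitney_avg VE; case/exponentP: r0 => [s s0 -> _|-> _].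
  rewrite gaugeH_finE//=.
  set I := intH _.
  have I0 : (0 <= I)%E by apply: intH_ge0 => w; rewrite mule_ge0// lee_fin// powR_ge0.
  move: I I0 => [I| |]//= I0; last by rewrite gt0_muley// lte_fin powR_gt0.
  rewrite -!EFinM !lee_fin powRN ler_pdivrMl ?powR_gt0// => hI.
  rewrite -[leRHS](powRr1 (ltW l0)) -(mulfV (lt0r_neq0 s0)) powRrM.
  rewrite powR_ler ?invr_ge0 ?mulr_ge0 ?invr_ge0 ?(ltW V0) ?(ltW s0)//.
  by rewrite ler_pdivrMl// mulrC.
rewrite eqxx /esssupH => hg; apply: ereal_inf_lbound => /=.
pose N := whitney a1 a2 z `&` [set w | l < h w].
have mN : measurable N.
  apply: measurableI => //; rewrite (_ : mkset _ = h @^-1` `]l, +oo[).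
    by rewrite -[X in measurable X]setTI; apply: mh => //; exact: measurable_itv.
  by apply/seteqP; split=> w; rewrite /= in_itv/= andbT.
rewrite (_ : mkset _ = N); last by apply/seteqP; split=> w [Ww]; rewrite /= lte_fin.
apply/eqP; rewrite -[_ == _]negbK; apply/negP => N0.
have {}N0 : (0 < measH N)%E by rewrite lt0e N0; apply: intH_ge0 => w; rewrite lee_fin.
have : (gaugeH +oo (whitney a1 a2 z) (fun w => (h w / l)%R) = +oo)%E.
  apply/eqP; rewrite -leye_eq.
  apply: (@le_trans _ _ (intH (fun w => +oo * (\1_N w)%:E)))%E.
    rewrite intHE; last 2 first.
    - apply: emeasurable_funM => //; apply/measurable_EFinP; exact: measurable_indic.
    - by move=> w; rewrite mule_ge0// lee_fin.
    rewrite ge0_integralZl//; last by apply/measurable_EFinP; exact: measurable_indic.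
    by rewrite integral_indic// setIT gt0_mulye.
  apply: intH_le => w; first by rewrite mule_ge0// lee_fin.
  rewrite gauge_inf ler_pdivrMr// mul1r !indicE.
  case: (boolP (w \in N)) => [/set_mem[Ww /= lw]|_]; last by rewrite mule0 mule_ge0//; case: ifP.
  by rewrite mem_set// (leNgt (h w)) lw mul1e mule1.
by move=> E; rewrite E in hg.
Qed.

Definition dominates r (h : n.-tuple R * R -> R) (a : int -> n.-tuple int -> R) :=
  forall m j l, a m j < l ->
    (gaugeH r (wbox m j) (fun w => (h w / l)%R) <= (whitney_ratio * wvol m)%:E)%E.

Lemma wbox_pos m j z : wbox m j z -> 0 < z.2.
Proof. by move=> [_ /andP[h _]]; exact: lt_le_trans (scale_gt0 m) h. Qed.

Lemma wbox_lev m j z : wbox m j z -> lev z.2 = m.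
Proof. by move=> [_ ?]; exact: lev_eq. Qed.

Lemma whitney_avg_lt_dominated r (h : n.-tuple R * R -> R) m j z l : (0 < r)%E ->
  measurable_fun [set: n.-tuple R * R] h -> (forall w, 0 <= h w) ->
  wbox m j z -> 0 < l -> (whitney_avg a1 a2 r (fun w => (h w)%:E) z < l%:E)%E ->
  (gaugeH r (wbox m j) (fun w => (h w / l)%R) <= (whitney_ratio * wvol m)%:E)%E.
Proof.
move=> r0 mh h0 mjz l0 hl; have z0 := wbox_pos mjz.
apply: le_trans (gaugeH_subset _ _ (fun z' => wbox_whitney mjz)) _.
apply: le_trans (whitney_avg_lt_gauge r0 mh h0 z0 l0 hl) _.
by rewrite -(wbox_lev mjz); exact: measH_whitney_le.
Qed.

(** A power of 3, so that [bigside] is one too, and so large that points within 2 a2^2 [scale m] in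
    every coordinate are closer than half of [bigside m], as the one-third trick requires. *)
Definition magnif : nat := 3 ^ Num.bound (12 * n%:R * a2 ^+ 2 / a1).

Lemma magnif_gt0 : (0 < magnif)%N. Proof. by rewrite expn_gt0. Qed.

Lemma magnif_ge : 12 * n%:R * a2 ^+ 2 / a1 <= magnif%:R.
Proof.
have h : 0 <= 12 * n%:R * a2 ^+ 2 / a1 by rewrite divr_ge0 ?mulr_ge0 ?exprn_ge0 ?(ltW a20) ?(ltW ha1).
apply: le_trans (ltW (archi_boundP h)) _.
by rewrite ler_nat ltnW// ltn_expl.
Qed.

Definition bigside (m : int) : R := (2 * magnif)%:R * side m.

Lemma bigside_gt0 m : 0 < bigside m.
Proof. by rewrite mulr_gt0 ?side_gt0// ltr0n muln_gt0/= magnif_gt0. Qed.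

Lemma bigsideE m : bigside m = tri (trilev m + (Num.bound (12 * n%:R * a2 ^+ 2 / a1))%:Z).
Proof.
rewrite /bigside /side natrM /magnif; set D := Num.bound _.
rewrite (_ : 2 * _ * _ = (3 ^ D)%:R * tri (trilev m)); last by field.
elim: D => [|D IH]; first by rewrite expn0 mul1r addr0.
by rewrite expnS natrM -mulrA IH -triS -addrA -PoszD addn1.
Qed.

Definition bigcell (s : {ffun 'I_n -> bool}) (m : int) : n.-tuple R -> n.-tuple int :=
  gcell (bigside m) (half_shift R s).

Lemma tri_cellwise s k (d : nat) : cellwise (gcell (tri k) (half_shift R s))
  (gcell (tri (k + d%:Z)) (half_shift R s) : n.-tuple R -> _).
Proof.
elim: d => [|d IH] x y xy; first by rewrite addr0.
by rewrite -addn1 PoszD addrA triS; apply: gcell_triple (tri_gt0 _) _ _ (IH _ _ xy).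
Qed.

Lemma bigcell_nested s m m' : m <= m' -> cellwise (bigcell s m) (bigcell s m').
Proof.
move=> mm x y; rewrite /bigcell !bigsideE => xy.
have h := trilev_le mm.
have -> : trilev m' + (Num.bound (12 * n%:R * a2 ^+ 2 / a1))%:Z =
   trilev m + (Num.bound (12 * n%:R * a2 ^+ 2 / a1))%:Z + `|trilev m' - trilev m|%N%:Z by clear -h; lia.
exact: tri_cellwise xy.
Qed.

(** A shifted grid together with the position of a small cell in a large one: finitely many choices,
    the same at all levels and places. *)
Definition shifts : finType := ({ffun 'I_n -> bool} * {ffun 'I_n -> 'I_(2 * magnif)})%type.

Definition subindex (i : shifts) := @subcell n magnif i.1 i.2.

(** For fixed [i], the coefficient of the small cell at position [i.2] of the large cell around [x]
    is constant on large cells. These are nested, unlike the small cells, so the tree estimates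
    apply to it. *)
Definition shifted (a : int -> n.-tuple int -> R) (i : shifts) m (x : n.-tuple R) : R :=
  a m (subindex i (bigcell i.1 m x)).

Lemma subindex_bigcell (i : shifts) m x j : cell m x = subindex i j -> bigcell i.1 m x = j.
Proof.
by move=> h; apply/(gcell_subcell _ _ _ (side_gt0 m) magnif_gt0); exists i.2.
Qed.

Lemma near_subindex m x y : (forall k, `|tnth y k - tnth x k| < 2 * a2 ^+ 2 * scale m) ->
  exists i : shifts, cell m y = subindex i (bigcell i.1 m x).
Proof.
move=> xy; have [s hs] : exists s, bigcell s m y = bigcell s m x.
  apply: half_shift_near; first exact: bigside_gt0.
  move=> k; apply: lt_le_trans (xy k) _; rewrite /bigside natrM.
  rewrite (_ : _ / 2 = magnif%:R * side m); last by field.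
  have /andP[_ h] := side_scale m.
  have h' : a1 * scale m <= 6 * n%:R * side m.
    by apply: ltW; move: h; rewrite mulrAC ltr_pdivrMr// mulrAC.
  have s0 := side_gt0 m.
  apply: le_trans (ler_wpM2r (ltW s0) magnif_ge).
  rewrite -(ler_pM2l ha1).
  rewrite (_ : a1 * (12 * n%:R * a2 ^+ 2 / a1 * side m) = 2 * a2 ^+ 2 * (6 * n%:R * side m)).
    by rewrite mulrCA ler_pM2l// mulr_gt0// exprn_gt0.
  by field; rewrite gt_eqF.
have := erefl (bigcell s m x); rewrite -{1}hs.
move/(gcell_subcell _ _ _ (side_gt0 m) magnif_gt0) => [d hd].
by exists (s, d).
Qed.

Definition step (k : 'I_3) : int := (k%:Z - 1)%R.

(** The heights t of z and t' of z' differ by a factor below a2, so their levels differ by at most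
    1. In each coordinate z' is closer to x than a1 t + t < 2 t, and t < a2 t' < a2^2 times the
    scale of z', which is the radius in [near_subindex]. *)
Lemma near_boxes x (z z' : n.-tuple R * R) : cone x z -> whitney a1 a2 z z' ->
  exists (k : 'I_3) (i : shifts),
    wbox (lev z.2 + step k) (subindex i (bigcell i.1 (lev z.2 + step k) x)) z'.
Proof.
move=> [z0 zx] zz'; have z'0 := whitney_upper z0 zz'; have := zz' => -[d /andP[u1 u2]].
have /andP[l1 l2] := levP z0; have /andP[l1' l2'] := levP z'0.
have u1' : z.2 < a2 * z'.2 by rewrite -ltr_pdivrMl.
have b1 : lev z.2 - 1 <= lev z'.2.
  rewrite leNgt; apply/negP => h.
  have /scale_le h' : lev z'.2 + 1 <= lev z.2 - 1 by clear -h; lia.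
  have := scaleS (lev z.2 - 1); rewrite subrK => E.
  have : a2 * z'.2 < a2 * scale (lev z.2 - 1) by rewrite ltr_pM2l// (lt_le_trans l2').
  by rewrite -E => h2; have := lt_trans u1' h2; rewrite ltNge l1.
have b2 : lev z'.2 <= lev z.2 + 1.
  rewrite leNgt; apply/negP => h.
  have /scale_le h' : lev z.2 + 1 + 1 <= lev z'.2 by clear -h; lia.
  rewrite scaleS in h'.
  have h2 : z'.2 < a2 * scale (lev z.2 + 1) by apply: lt_trans u2 _; rewrite ltr_pM2l.
  by have := le_lt_trans (le_trans h' l1') h2; rewrite ltxx.
have [k kE] : exists k : 'I_3, lev z'.2 = lev z.2 + step k.
  have lt : (`|(lev z'.2 - lev z.2 + 1)%R| < 3)%N by clear -b1 b2; lia.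
  by exists (Ordinal lt); rewrite /step/=; clear -b1 b2; lia.
exists k; rewrite -kE.
have [|i hi] := @near_subindex (lev z'.2) x z'.1.
  move=> c; apply: (@lt_le_trans _ _ (2 * z.2)).
    have h1 := le_lt_trans (coord_le_edist z'.1 z.1 c) d.
    have h2 := le_lt_trans (coord_le_edist z.1 x c) zx.
    have h3 : a1 * z.2 < z.2 by rewrite gtr_pMl.
    have := ler_normD (tnth z'.1 c - tnth z.1 c) (tnth z.1 c - tnth x c).
    by rewrite addrA subrK; lra.
  rewrite -mulrA ler_pM2l// expr2 -mulrA.
  apply: ltW; apply: lt_trans u1' _; rewrite ltr_pM2l//.
  by rewrite scaleS in l2'.
by exists i; rewrite -hi; exact: wbox_mem.
Qed.

Lemma wvol_step m (k : 'I_3) : wvol (m + step k) <= (3 * a2) ^+ n * a2 * wvol m.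
Proof.
have s0 k' := ltW (side_gt0 k'); have sc0 k' := ltW (scale_gt0 k').
have a210 : 0 <= a2 - 1 by rewrite subr_ge0 ltW// aperture_gt1.
have h1 : wvol (m - 1) <= wvol m.
  have mm : m - 1 <= m by rewrite lerBlDr lerDl.
  apply: ler_pM.
  - exact: exprn_ge0.
  - exact: mulr_ge0.
  - apply: lerXn2r; rewrite ?nnegrE//.
    rewrite /side ler_pM2r// ler_expR ler_wpM2r ?ln_ge0 ?ler1n// ler_int.
    exact: trilev_le.
  - by rewrite ler_wpM2l//; exact: scale_le.
have h3 : wvol (m + 1) <= (3 * a2) ^+ n * a2 * wvol m.
  rewrite /wvol scaleS.
  rewrite (_ : _ * (a2 * scale m) = a2 * ((a2 - 1) * scale m)); last by ring.
  rewrite (_ : _ * _ * (_ * _) = (3 * a2 * side m) ^+ n * (a2 * ((a2 - 1) * scale m))); last first.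
    by rewrite [in RHS]exprMn; ring.
  apply: ler_wpM2r.
    by rewrite mulr_ge0 ?(ltW a20)// mulr_ge0.
  have h : side (m + 1) <= 3 * a2 * side m.
    have /andP[h _] := side_scale (m + 1); have /andP[_ h'] := side_scale m.
    rewrite scaleS (mulrCA (a1 / n%:R)) in h.
    have h2 : a2 * (a1 / n%:R * scale m) < a2 * (6 * side m) by rewrite ltr_pM2l.
    have -> : 3 * a2 * side m = a2 * (6 * side m) / 2 by field.
    by rewrite ler_pdivlMr// mulrC ltW// (le_lt_trans h).
  by apply: lerXn2r => //; rewrite nnegrE// (le_trans _ h).
have c1 : 1 <= (3 * a2) ^+ n * a2.
  have a21 := ltW aperture_gt1.
  by rewrite -[leLHS]mulr1 ler_pM// exprn_ege1//; lra.
have v0 := wvol_gt0 m.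
case: k => [[|[|[|//]]] kP]; rewrite /step/=.
- by apply: le_trans h1 _; rewrite ler_peMl// ltW.
- by rewrite subrr addr0 ler_peMl// ltW.
- by rewrite (_ : 2%:Z - 1 = 1).
Qed.

(** W(z) is covered by a bounded number of boxes of comparable volume. Adding their gauge integrals
    costs a factor K, which [gauge_scale] moves into the argument and thus into the constant. *)
Lemma whitney_avg_le_shifted r : (0 < r)%E -> exists2 C : R, 0 < C &
  forall (h : n.-tuple R * R -> R) (a : int -> n.-tuple int -> R),
    measurable_fun [set: n.-tuple R * R] h -> (forall w, 0 <= h w) ->
    (forall m j, 0 <= a m j) -> dominates r h a ->
    forall x z, cone x z ->
    (whitney_avg a1 a2 r (fun w => (h w)%:E) z <=
      (C * \sum_(k < 3) \sum_(i : shifts) shifted a i (lev z.2 + step k) x)%:E)%E.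
Proof.
move=> r0.
pose K := (3 * #|shifts|)%:R * (whitney_ratio * ((3 * a2) ^+ n * a2)).
have K0 : 0 <= K.
  have h1 := ltW whitney_ratio_gt0; have h2 := ltW a20.
  by rewrite mulr_ge0// mulr_ge0// mulr_ge0// exprn_ge0// mulr_ge0.
have K1 : 0 < K + 1 by rewrite ltr_wpDl.
have [c c0 cP] := gauge_scale r0 K1.
exists c^-1 => [|h a mh h0 pos_a ha x z xz]; first by rewrite invr_gt0.
have z0 : 0 < z.2 by case: xz.
set V := \sum_(k < 3) _.
have V0 : 0 <= V by do 2 apply: sumr_ge0 => ? _; exact: pos_a.
have aV (k : 'I_3) (i : shifts) : shifted a i (lev z.2 + step k) x <= V.
  rewrite /V (bigD1 k)//= (bigD1 i)//= -addrA lerDl addr_ge0//.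
    by apply: sumr_ge0 => ? _; exact: pos_a.
  by do 2 apply: sumr_ge0 => ? _; exact: pos_a.
(* Since V may be 0, the bound is proved for l > V and then l decreases to V. *)
suff key l : V < l -> (whitney_avg a1 a2 r (fun w => (h w)%:E) z <= (c^-1 * l)%:E)%E.
  apply/lee_addgt0Pr => e e0; apply: le_trans (key (V + c * e) _) _.
    by rewrite ltrDl mulr_gt0.
  by rewrite -EFinD lee_fin mulrDr mulKf ?gt_eqF.
move=> Vl; have l0 : 0 < l by exact: le_lt_trans Vl.
have mhl (t : R) : measurable_fun [set: n.-tuple R * R] (fun w => h w / t) by exact: measurable_funM.
have mW := measurable_whitney z.
have h1 : (gaugeH r (whitney a1 a2 z) (fun w => (h w / l)%R) <= (K * wvol (lev z.2))%:E)%E.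
  pose s := [seq (k, i) | k <- enum 'I_3, i <- enum shifts].
  pose B (p : 'I_3 * shifts) := wbox (lev z.2 + step p.1) (subindex p.2 (bigcell p.2.1 (lev z.2 + step p.1) x)).
  apply: le_trans (gaugeH_bigcup_le (s := s) (B := B) r (mhl l) _ _) _.
  - by move=> p; exact: measurable_wbox.
  - move=> w /(near_boxes xz)[k [i hw]]; exists (k, i) => //.
    by apply/allpairsP; exists (k, i); rewrite !mem_enum.
  apply: (@le_trans _ _ (\sum_(p <- s) (whitney_ratio * ((3 * a2) ^+ n * a2) * wvol (lev z.2))%:E)%E).
    apply: lee_sum => p _; apply: le_trans (ha _ _ l _) _.
      by apply: le_lt_trans Vl; exact: aV.
    by rewrite lee_fin -mulrA ler_wpM2l ?(ltW whitney_ratio_gt0)//; exact: wvol_step.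
  rewrite sumEFin lee_fin big_const_seq count_predT iter_addr_0 size_allpairs -!cardE card_ord.
  by rewrite -[X in X <= _]mulr_natl /K -!mulrA.
have V' := wvol_le_measH_whitney z0.
have [M M0 ME] := measH_whitney_fin z0; rewrite ME lee_fin in V'.
apply: (gauge_le_whitney_avg r0 mh h0 z0); first by rewrite mulr_gt0 ?invr_gt0.
rewrite ME.
have h2 := @gaugeH_le_mul _ _ r (whitney a1 a2 z) (fun w => h w / l) (fun w => h w / (c^-1 * l)) c _ mW (mhl _) K1 cP.
have {}h2 := le_trans (h2 (fun w _ => divr_ge0 (h0 w) (ltW l0)) _) h1.
have := h2 _; rewrite -lee_pdivlMl// => h3; apply: le_trans (h3 _) _.
  by move=> w _; rewrite invfM invrK mulrCA.
rewrite -EFinM lee_fin ler_pdivrMl//.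
apply: ler_pM => //; first exact/ltW/wvol_gt0.
by rewrite lerDl.
Qed.
(** * Certificates *)

(* Levels M, M - 1, ..., - M, i.e. from coarse to fine. *)
Definition winlev (M : nat) (i : nat) : int := M%:Z - i%:Z.

(** Sums over all levels are expressed by bounds uniform in finite symmetric windows, since the tree
    lemmas concern finite sums that start from a coarsest level. *)
Definition lq_bound (q : \bar R) (u : int -> R) (G : R) : Prop :=
  if q == +oo%E then forall m, u m <= G
  else forall M, \sum_(i < (2 * M).+1) u (winlev M i) `^ fine q <= G `^ fine q.

Definition lp_unit (p : \bar R) (g : n.-tuple R -> R) : Prop :=
  if p == +oo%E then forall x, g x <= 1
  else (\int[@leb_n R n]_x (g x `^ fine p)%:E <= 1)%E.

(* [certificate k p q K a] replaces a norm bound [<= K] of the sequence [a] in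
   the discrete tent space: up to constants it is equivalent to it in all four
   cases, p finite or not and q finite or not. *)
Definition certificate (k : R) (p q : \bar R) (K : R) (a : int -> n.-tuple int -> R)
    (E : int -> set (n.-tuple R)) (g : n.-tuple R -> R) : Prop :=
  [/\ forall m, measurable (E m),
      forall m j, (k%:E * leb_n (cell m @^-1` [set j]) <= leb_n (E m `&` cell m @^-1` [set j]))%E,
      measurable_fun [set: n.-tuple R] g /\ (forall x, 0 <= g x),
      lp_unit p g &
      forall x, lq_bound q (fun m => a m (cell m x) * \1_(E m) x) (K * g x)].

Lemma winlevS M i : winlev M i = winlev M i.+1 + 1.
Proof. by rewrite /winlev -addn1 PoszD; ring. Qed.

Lemma leb_n_cell m j : leb_n (cell m @^-1` [set j]) = (side m ^+ n)%:E.
Proof. by rewrite leb_n_gcell// side_gt0. Qed.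

Lemma leb_n_bigcell s m j : leb_n (bigcell s m @^-1` [set j]) = (bigside m ^+ n)%:E.
Proof. by rewrite leb_n_gcell// bigside_gt0. Qed.

Lemma measurable_bigcell s m j : measurable (bigcell s m @^-1` [set j]).
Proof. exact: measurable_gcell (bigside_gt0 m). Qed.

(** Here the cell of [x] is itself the selected subcell, so the shifted coefficient at [x] is the
    one the certificate controls at [x]. *)
Definition shifted_set (E : int -> set (n.-tuple R)) (i : shifts) m : set (n.-tuple R) :=
  E m `&` [set x | cell m x = subindex i (bigcell i.1 m x)].

Lemma measurable_shifted_set E i m : (forall m, measurable (E m)) ->
  measurable (shifted_set E i m).
Proof.
move=> mE; apply: measurableI => //.
apply: (@measurable_preimage_cell _ _ _ (fun x => (cell m x, bigcell i.1 m x)) _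
  [set p | p.1 = subindex i p.2]) => -[j j'].
rewrite (_ : _ @^-1` _ = cell m @^-1` [set j] `&` bigcell i.1 m @^-1` [set j']).
  by apply: measurableI; [exact: measurable_cell|exact: measurable_bigcell].
by apply/seteqP; split=> x /= [-> ->].
Qed.

(** A subcell fills the fraction (2 [magnif])^(-n) of its large cell. *)
Definition shifted_frac (k : R) : R := k / (2 * magnif)%:R ^+ n.

Lemma shifted_frac_gt0 k : 0 < k -> 0 < shifted_frac k.
Proof. by move=> k0; rewrite divr_gt0// exprn_gt0// ltr0n muln_gt0/= magnif_gt0. Qed.

Lemma shifted_set_frac k p q K a E g i m x : certificate k p q K a E g ->
  ((shifted_frac k)%:E * leb_n (bigcell i.1 m @^-1` [set bigcell i.1 m x]) <=
   leb_n (shifted_set E i m `&` bigcell i.1 m @^-1` [set bigcell i.1 m x]))%E.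
Proof.
case=> mE kE _ _ _; set j := bigcell i.1 m x.
have -> : shifted_set E i m `&` bigcell i.1 m @^-1` [set j] = E m `&` cell m @^-1` [set subindex i j].
  apply/seteqP; split=> [y [[Ey /= h] /= hj]|y [Ey /= h]].
    by split => //=; rewrite h hj.
  have hj := subindex_bigcell h.
  by split => //; split => //=; rewrite h hj.
apply: le_trans (kE m (subindex i j)); rewrite leb_n_cell leb_n_bigcell -!EFinM lee_fin.
rewrite /shifted_frac /bigside exprMn mulrA mulfVK// lt0r_neq0// exprn_gt0// ltr0n.
by rewrite muln_gt0/= magnif_gt0.
Qed.

(** * Bounds for shifted coefficients, free of the sets [E m] *)

Section ShiftedBounds.
Variables (k : R) (p q : \bar R) (K : R) (a : int -> n.-tuple int -> R).
Variables (E : int -> set (n.-tuple R)) (g : n.-tuple R -> R).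
Hypothesis k0 : 0 < k.
Hypothesis K0 : 0 < K.
Hypothesis a0 : forall m j, 0 <= a m j.
Hypothesis cert : certificate k p q K a E g.

Let mE m : measurable (E m). Proof. by case: cert. Qed.
Let mg : measurable_fun [set: n.-tuple R] g. Proof. by case: cert => _ _ []. Qed.
Let g0 x : 0 <= g x. Proof. by case: cert => _ _ []. Qed.

Let mKg : measurable_fun [set: n.-tuple R] (fun x => K * g x).
Proof. exact: measurable_funM. Qed.

Let Kg0 x : 0 <= K * g x. Proof. by rewrite mulr_ge0// ltW. Qed.

Lemma shifted_ge0 i m x : 0 <= shifted a i m x. Proof. exact: a0. Qed.

Lemma shifted_cellwise i m : cellwise (bigcell i.1 m) (shifted a i m).
Proof. by move=> x y xy; rewrite /shifted xy. Qed.

Lemma shifted_on_set i m x : shifted_set E i m x -> shifted a i m x = a m (cell m x) * \1_(E m) x.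
Proof. by move=> [Ex /= h]; rewrite /shifted -h indicE mem_set// mulr1. Qed.

Let nested (i : shifts) M : forall l, cellwise (bigcell i.1 (winlev M l.+1)) (bigcell i.1 (winlev M l)).
Proof. by move=> l; apply: bigcell_nested; rewrite (winlevS M l) lerDl. Qed.

Lemma integral_KgE (s : R) : p = s%:E -> 0 < s ->
  (\int[@leb_n R n]_x ((K * g x) `^ s)%:E <= (K `^ s)%:E)%E.
Proof.
move=> ps s0; have : lp_unit p g by case: cert.
rewrite /lp_unit ps/= => h.
under eq_integral do rewrite powRM ?(ltW K0)// EFinM.
rewrite ge0_integralZl_EFin ?powR_ge0//.
- by rewrite -[leRHS]mule1 lee_wpmul2l ?lee_fin ?powR_ge0.
- by move=> x _; rewrite lee_fin powR_ge0.
- by apply/measurable_EFinP; exact: (measurableT_comp (measurable_powR s)).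
Qed.

Let lqb x : lq_bound q (fun m => a m (cell m x) * \1_(E m) x) (K * g x).
Proof. by case: cert. Qed.

Lemma shifted_lq_on_set (t : R) i M x : q = t%:E -> 0 < t ->
  \sum_(l < (2 * M).+1) shifted a i (winlev M l) x `^ t * \1_(shifted_set E i (winlev M l)) x
    <= (K * g x) `^ t.
Proof.
move=> qt t0; have := lqb x; rewrite /lq_bound qt/= => /(_ M); apply: le_trans.
apply: ler_sum => l _; rewrite [in leLHS]indicE.
case: (boolP (x \in shifted_set _ _ _)) => [/set_mem xE|_].
  by rewrite mulr1 shifted_on_set.
by rewrite mulr0 powR_ge0.
Qed.

Lemma shifted_lp_lq (s t : R) i M : p = s%:E -> 0 < s -> q = t%:E -> 0 < t ->
  (\int[@leb_n R n]_x ((\sum_(l < (2 * M).+1) shifted a i (winlev M l) x `^ t) `^ (s / t))%:E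
    <= (tree_const (shifted_frac k) (s / t) * K `^ s)%:E)%E.
Proof.
move=> ps s0 qt t0.
apply: le_trans (@tree_lq_norm _ _ _ (@leb_n R n) _ (fun l => bigcell i.1 (winlev M l))
  (fun l => shifted_set E i (winlev M l)) (shifted_frac k) _ _ _ _ _
  (fun l => shifted a i (winlev M l)) (fun x => K * g x) s t (2 * M).+1 _ _ _ _ _ _) _ => //.
- by move=> l j; exact: measurable_bigcell.
- by move=> l; exact: measurable_shifted_set.
- exact: shifted_frac_gt0.
- by move=> l x; exact: shifted_set_frac cert.
- by move=> l x; exact: shifted_ge0.
- by move=> l; exact: shifted_cellwise.
- by move=> x; exact: shifted_lq_on_set.
rewrite EFinM lee_wpmul2l ?integral_KgE// lee_fin; apply/ltW/tree_const_gt0.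
  exact: shifted_frac_gt0.
exact: divr_gt0.
Qed.

Lemma shifted_lp_sup (s : R) i M : p = s%:E -> 0 < s -> q = +oo%E ->
  (\int[@leb_n R n]_x ((\big[Num.max/0]_(l < (2 * M).+1) shifted a i (winlev M l) x) `^ s)%:E
    <= (2 / shifted_frac k * K `^ s)%:E)%E.
Proof.
move=> ps s0 qt.
apply: le_trans (@tree_sup_norm _ _ _ (@leb_n R n) _ (fun l => bigcell i.1 (winlev M l))
  (fun l => shifted_set E i (winlev M l)) (shifted_frac k) _ _ _ _ _
  (fun l => shifted a i (winlev M l)) (fun x => K * g x) s (2 * M).+1 _ _ _ _ _ _) _ => //.
- by move=> l j; exact: measurable_bigcell.
- by move=> l; exact: measurable_shifted_set.
- exact: shifted_frac_gt0.
- by move=> l x; exact: shifted_set_frac cert.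
- by move=> l x; exact: shifted_ge0.
- by move=> l; exact: shifted_cellwise.
- move=> l x xE; rewrite shifted_on_set//; have := lqb x.
  by rewrite /lq_bound qt eqxx => /(_ (winlev M l)).
rewrite [in leRHS]EFinM lee_wpmul2l ?integral_KgE// lee_fin divr_ge0//.
by apply: ltW; exact: shifted_frac_gt0.
Qed.

(** The sum enters linearly, so the sets can be removed level by level. Only levels up to [m0] are
    summed: their large cells lie in those of level [m0], which makes the indicator of the region
    constant on them. *)
Lemma shifted_carleson (t : R) i M (m0 : int) (S : set (n.-tuple int)) :
  p = +oo%E -> q = t%:E -> 0 < t ->
  (\int[@leb_n R n]_(x in bigcell i.1 m0 @^-1` S)
     (\sum_(l < (2 * M).+1 | winlev M l <= m0) shifted a i (winlev M l) x `^ t)%:E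
    <= ((shifted_frac k)^-1 * K `^ t)%:E * leb_n (bigcell i.1 m0 @^-1` S))%E.
Proof.
move=> pT qt t0; have f0 := shifted_frac_gt0 k0.
set B := bigcell i.1 m0 @^-1` S.
have mB : measurable B by apply: measurable_preimage_cell => j; exact: measurable_bigcell.
have mu' (l : nat) : measurable_fun [set: n.-tuple R] (fun x => (shifted a i (winlev M l) x `^ t)%:E).
  apply/measurable_EFinP; apply: (measurableT_comp (measurable_powR t)).
  exact: (measurable_cellwise (measurable_bigcell i.1 (winlev M l)) (@shifted_cellwise i _)).
pose f l x := \1_B x * shifted a i (winlev M l) x `^ t.
have f00 l x : 0 <= f l x by rewrite mulr_ge0 ?powR_ge0.
have mf l : measurable_fun [set: n.-tuple R] (fun x => (f l x)%:E).
  apply/measurable_EFinP; apply: measurable_funM; first exact: measurable_indic.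
  by apply/measurable_EFinP; exact: mu'.
have key (l : nat) : winlev M l <= m0 -> ((shifted_frac k)%:E * \int[@leb_n R n]_x (f l x)%:E <=
    \int[@leb_n R n]_x (\1_(shifted_set E i (winlev M l)) x * f l x)%:E)%E.
  move=> lm; rewrite -[leRHS]integral_setE.
  apply: (cellwise_integral_le (measurable_bigcell i.1 (winlev M l)) (ltW f0)).
  - exact: measurable_shifted_set.
  - move=> x y xy; rewrite /f (shifted_cellwise xy); congr (_ * _).
    have BE : B x = B y by rewrite /B /preimage/= (bigcell_nested lm xy).
    rewrite !indicE; congr (nat_of_bool _)%:R.
    by apply/idP/idP => /set_mem h; apply/mem_set; rewrite ?BE// -BE.
  - exact: f00.
  - by move=> x; exact: shifted_set_frac cert.
rewrite integral_setE (_ : (fun x => _) = fun x => (\sum_(l < (2 * M).+1)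
    (if (winlev M l <= m0)%R then (f l x)%:E else 0))%E); last first.
  apply/funext => x; rewrite mulr_sumr -sumEFin big_mkcond/=.
  by apply: eq_bigr => l _; case: ifP.
rewrite ge0_integral_sum//; last 2 first.
- by move=> l; case: (winlev M l <= m0); [exact: mf|exact: measurable_cst].
- by move=> l x _; case: ifP => //; rewrite lee_fin.
rewrite EFinM -muleA -[X in (X <= _)%E]mul1e -(mulVf (lt0r_neq0 f0)) EFinM -muleA.
rewrite lee_wpmul2l ?lee_fin ?invr_ge0 ?(ltW f0)//.
rewrite ge0_sume_distrr; last first.
  by move=> l _; apply: integral_ge0 => x _; case: ifP => //; rewrite lee_fin.
apply: (@le_trans _ _ (\sum_(l < (2 * M).+1) \int[@leb_n R n]_x
    (\1_B x * (shifted a i (winlev M l) x `^ t * \1_(shifted_set E i (winlev M l)) x))%:E)%E).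
  apply: lee_sum => l _; case: (boolP (winlev M l <= m0)) => lm.
    apply: le_trans (key l lm) _; apply: ge0_le_integral_nomeas => x _.
      by rewrite lee_fin mulr_ge0.
    by rewrite lee_fin /f mulrCA (mulrC (\1_(shifted_set _ _ _) x)).
  rewrite integral0 mule0; apply: integral_ge0 => x _.
  by rewrite lee_fin !mulr_ge0 ?powR_ge0.
rewrite -ge0_integral_sum//; last 2 first.
- move=> l; apply/measurable_EFinP; apply: measurable_funM; first exact: measurable_indic.
  apply: measurable_funM; first by apply/measurable_EFinP; exact: mu'.
  by apply: measurable_indic; exact: measurable_shifted_set.
- by move=> l x _; rewrite lee_fin !mulr_ge0 ?powR_ge0.
have -> : ((K `^ t)%:E * leb_n B = \int[@leb_n R n]_x ((K `^ t)%:E * (\1_B x)%:E))%E.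
  rewrite ge0_integralZl_EFin ?powR_ge0//.
  - by rewrite integral_indic// setIT.
  - by apply/measurable_EFinP; exact: measurable_indic.
apply: ge0_le_integral_nomeas => x _.
  by rewrite sume_ge0// => l _; rewrite lee_fin !mulr_ge0 ?powR_ge0.
rewrite sumEFin -mulr_sumr -EFinM lee_fin mulrC ler_wpM2r//.
apply: le_trans (shifted_lq_on_set i M x qt t0) _.
apply: powR_ler; rewrite ?(ltW t0)// ler_piMr ?(ltW K0)//.
have : lp_unit p g by case: cert.
by rewrite /lp_unit pT eqxx; exact.
Qed.

(** A set of positive measure has a point, at which the pointwise bound is read off. *)
Lemma shifted_sup_bound i m x : p = +oo%E -> q = +oo%E -> shifted a i m x <= K.
Proof.
move=> pT qT.
have [y [yE /= yx]] : exists y, (shifted_set E i m `&` bigcell i.1 m @^-1` [set bigcell i.1 m x]) y.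
  apply/set0P/eqP => S0; have := shifted_set_frac i m x cert.
  rewrite S0 measure0 leb_n_bigcell -EFinM lee_fin leNgt mulr_gt0//.
    exact: shifted_frac_gt0.
  by rewrite exprn_gt0// bigside_gt0.
rewrite -(shifted_cellwise yx) shifted_on_set//.
have := lqb y; rewrite /lq_bound qT eqxx => /(_ m) /le_trans; apply.
rewrite ler_piMr ?(ltW K0)//.
have : lp_unit p g by case: cert.
by rewrite /lp_unit pT eqxx; exact.
Qed.

End ShiftedBounds.

(** * From certificates to norm bounds *)

Lemma mid_le_add (x y z : \bar R) : (0 <= y -> 0 <= z -> x <= y + (x + z))%E.
Proof. by move=> y0 z0; apply: le_trans (leeDr _ y0); exact: leeDl. Qed.

Lemma winlev_recl M i : winlev M.+1 i.+1 = winlev M i.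
Proof. by rewrite /winlev; lia. Qed.

Lemma winsum_nd (M : nat) (b : (int -> \bar R)) : (forall m, 0 <= b m)%E ->
  (\sum_(l < (2 * M).+1) b (winlev M l) <= \sum_(l < (2 * M.+1).+1) b (winlev M.+1 l))%E.
Proof.
move=> b0; rewrite [in leRHS]mulnS [leRHS]big_ord_recl [X in (_ <= _ + X)%E]big_ord_recr/=.
rewrite (_ : (\sum_(l < (2 * M).+1) b (winlev M l) = \sum_(l < (2 * M).+1) b (winlev M.+1 (bump 0 l)))%E); last first.
  by apply: eq_bigr => l _; rewrite /bump leq0n add1n winlev_recl.
exact: mid_le_add.
Qed.

Lemma winsum_ndW (M M' : nat) (b : (int -> \bar R)) : (forall m, 0 <= b m)%E -> (M <= M')%N ->
  (\sum_(l < (2 * M).+1) b (winlev M l) <= \sum_(l < (2 * M').+1) b (winlev M' l))%E.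
Proof.
move=> b0 /subnK <-; elim: (M' - M)%N => // d IH.
by rewrite addSn; apply: le_trans IH _; exact: winsum_nd.
Qed.

(** Moving by one level stays inside the window enlarged by one level at both ends. *)
Lemma winsum_step (M : nat) (b : (int -> \bar R)) (k : 'I_3) : (forall m, 0 <= b m)%E ->
  (\sum_(l < (2 * M).+1) b (winlev M l + step k)%R <= \sum_(l < (2 * M.+1).+1) b (winlev M.+1 l))%E.
Proof.
move=> b0; rewrite -(big_mkord xpredT (fun l => b (winlev M l + step k)%R)).
rewrite -(big_mkord xpredT (fun l => b (winlev M.+1 l))).
have E l : winlev M l + step k = winlev M.+1 (l + (2 - k))%N.
  by rewrite /winlev /step; have := ltn_ord k; lia.
under eq_bigr do rewrite E.
rewrite -[X in (\sum_(0 <= _ < X) _ <= _)%E](addnK (2 - k)).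
rewrite -(big_addn 0 _ (2 - k) xpredT (fun l => b (winlev M.+1 l))) add0n.
rewrite (@big_cat_nat _ _ _ (2 - k) 0)//=; last by lia.
rewrite [X in (_ <= _ + X)%E](@big_cat_nat _ _ _ ((2 * M).+1 + (2 - k)))//=; [|by lia..].
by apply: mid_le_add; apply: sume_ge0.
Qed.

Lemma winlev_mem (m : int) : exists l : 'I_(2 * `|m|).+1, winlev `|m| l = m.
Proof.
have h : (`|(`|m|%:Z - m)%R| < (2 * `|m|).+1)%N by lia.
by exists (Ordinal h); rewrite /winlev/=; lia.
Qed.

Lemma winsum_ge (m : int) (b : (int -> \bar R)) : (forall m, 0 <= b m)%E ->
  (b m <= \sum_(l < (2 * `|m|).+1) b (winlev `|m| l))%E.
Proof.
move=> b0; have [l lm] := winlev_mem m.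
by rewrite (bigD1 l)//= lm leeDl// sume_ge0.
Qed.

(** The layer of level m has length (a2 - 1) [scale m], which cancels the weight 1 / [scale m] and
    leaves a sum over levels. *)
Lemma layer_integral (f : R -> \bar R) (d : int -> \bar R) (B : \bar R) :
  (forall s : R, 0 < s -> (0 <= f s)%E) -> (forall m, (0 <= d m)%E) ->
  (forall s : R, 0 < s -> (f s <= d (lev s) * ((scale (lev s))^-1)%:E)%E) ->
  (forall M : nat, (a2 - 1)%:E * \sum_(l < (2 * M).+1) d (winlev M l) <= B)%E ->
  (\int[@lebesgue_measure R]_(s in `]0%R, +oo[) f s <= B)%E.
Proof.
move=> f0 d0 fd dB.
pose J m : set R := `[scale m, scale (m + 1)[%classic.
pose b s m := (d m * ((scale m)^-1)%:E * (\1_(J m) s)%:E)%E.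
have b0 s m : (0 <= b s m)%E by rewrite !mule_ge0// lee_fin ?invr_ge0 ?(ltW (scale_gt0 m)).
(* Step functions equal to d m / [scale m] on the layers of a window. They are measurable and
   increase with the window, which permits monotone convergence for an arbitrary [f]. *)
pose F (M : nat) s := (\sum_(l < (2 * M).+1) b s (winlev M l))%E.
have mb m : measurable_fun [set: R] (fun s => b s m).
  apply: emeasurable_funM => //; apply/measurable_EFinP.
  by apply: measurable_indic; exact: measurable_itv.
have mF M : measurable_fun [set: R] (F M) by apply: emeasurable_sum => l; exact: mb.
apply: (@le_trans _ _ (\int[@lebesgue_measure R]_(s in `]0%R, +oo[) limn (F ^~ s))%E).
  apply: ge0_le_integral_nomeas => s /=; rewrite in_itv/= andbT => s0; first exact: f0.
  apply: le_trans (fd s s0) _.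
  apply: (@le_trans _ _ (F `|lev s|%N s)).
    apply: le_trans (winsum_ge (lev s) (b0 s)).
    by rewrite /b indicE mem_set ?mule1// /J/= in_itv/=; exact: levP.
  have nd : nondecreasing_seq (F ^~ s) by move=> M M' MM; exact: winsum_ndW.
  rewrite (cvg_lim _ (ereal_nondecreasing_cvgn nd))//.
  by apply: ereal_sup_ubound; exists `|lev s|%N.
rewrite monotone_convergence//; last 3 first.
- by move=> M; apply: measurable_funTS; exact: mF.
- by move=> M s _; apply: sume_ge0.
- by move=> s _ M M' MM; exact: winsum_ndW.
apply: lime_le.
  apply: ereal_nondecreasing_is_cvgn => M M' MM; apply: ge0_le_integral_nomeas => s _.
    by apply: sume_ge0.
  exact: winsum_ndW.
near=> M; apply: le_trans (dB M).
rewrite ge0_integral_sum//; last first.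
  by move=> l; apply: measurable_funTS; exact: mb.
rewrite ge0_sume_distrr//; apply: lee_sum => l _.
set m := winlev M l.
rewrite /b; under eq_integral do rewrite muleC.
rewrite integral_indic_mulr//; last 2 first.
- exact: measurable_itv.
- by rewrite mule_ge0// lee_fin invr_ge0 (ltW (scale_gt0 m)).
have sm := scale_gt0 m.
have -> : J m `&` `]0%R, +oo[%classic = J m.
  apply/setIidPl => s; rewrite /J/= !in_itv/= andbT => /andP[h _].
  exact: lt_le_trans h.
rewrite /J lebesgue_measure_itv/= lte_fin scaleS ltr_pMl// aperture_gt1 -EFinB.
rewrite muleCA -EFinM muleC lee_wpmul2r// lee_fin.
rewrite (_ : (a2 * _ - _) / _ = a2 - 1)//.
by field; rewrite gt_eqF.
Unshelve. all: by end_near. Qed.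

(** Comparison with the largest term works for every positive exponent, below and above 1. *)
Lemma sum_powR_le (J : finType) (v : J -> R) (e : R) : (forall j, 0 <= v j) -> 0 < e ->
  (\sum_j v j) `^ e <= (#|J|%:R `^ e) * \sum_j v j `^ e.
Proof.
move=> v0 e0.
have [j0|/(_ _)/negP h] := pickP (fun _ : J => true); last first.
  rewrite !big_pred0 ?powR0 ?mulr0 ?gt_eqF// => j; by have := h j.
move=> _.
pose M := \big[Num.max/0]_(j : J) v j.
have [|j1 _ ME] := @eq_bigmax _ _ _ 0 j0 xpredT v isT; first by move=> j _; exact: v0.
have M0 : 0 <= M by rewrite /M ME.
apply: (@le_trans _ _ ((#|J|%:R * M) `^ e)).
  apply: powR_ler; rewrite ?(ltW e0) ?sumr_ge0//.
  rewrite mulr_natl -sumr_const; apply: ler_sum => j _; exact: le_bigmax.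
rewrite powRM// ler_wpM2l ?powR_ge0// /M ME (bigD1 j1)//= lerDl.
by apply: sumr_ge0 => j _; exact: powR_ge0.
Qed.

Lemma lp_limit (J : n.-tuple R -> \bar R) (Y : nat -> n.-tuple R -> R) (e B : R) :
  (forall x, 0 <= J x)%E -> (forall M x, 0 <= Y M x) ->
  (forall M, measurable_fun [set: n.-tuple R] (Y M)) ->
  (forall x, {homo Y ^~ x : M M' / (M <= M')%N >-> M <= M'}) -> 0 < e ->
  (forall x, J x <= ereal_sup (range (fun M => (Y M x)%:E)))%E ->
  (forall M, \int[@leb_n R n]_x (Y M x `^ e)%:E <= B%:E)%E ->
  (int_Rn (fun x => poweR (J x) e) <= B%:E)%E.
Proof.
move=> J0 Y0 mY ndY e0 JY YB.
pose F M x := (Y M x `^ e)%:E.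
have ndF x : {homo F ^~ x : M M' / (M <= M')%N >-> (M <= M')%E}.
  by move=> M M' MM; rewrite lee_fin powR_ler ?(ltW e0)//; exact: ndY.
have mF M : measurable_fun [set: n.-tuple R] (F M).
  by apply/measurable_EFinP; apply: (measurableT_comp (measurable_powR e)).
have F0 M x : (0 <= F M x)%E by rewrite lee_fin powR_ge0.
apply: (@le_trans _ _ (int_Rn (fun x => limn (F ^~ x)))).
  apply: int_Rn_le => x; first exact: poweR_ge0.
  have cF := ereal_nondecreasing_cvgn (ndF x).
  rewrite (cvg_lim _ cF)//.
  set S := ereal_sup _.
  have S0 : (0 <= S)%E by apply: le_trans (F0 0%N x) _; apply: ereal_sup_ubound; exists 0%N.
  rewrite -[leRHS]poweRe1// -(mulVf (lt0r_neq0 e0)) poweRrM.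
  apply: gt0_ler_poweR; rewrite ?(ltW e0) ?in_itv/= ?leey ?poweR_ge0 ?J0//.
  apply: le_trans (JY x) _; apply: ge_ereal_sup => _ [M _ <-].
  rewrite -[leLHS]poweRe1 ?lee_fin// -(mulfV (lt0r_neq0 e0)) poweRrM.
  apply: gt0_ler_poweR; rewrite ?invr_ge0 ?(ltW e0) ?in_itv/= ?leey ?poweR_ge0 ?S0//.
    by rewrite andbT; exact: F0.
  by apply: ereal_sup_ubound; exists M.
rewrite int_Rn_mct//; apply: lime_le.
  by apply: ereal_nondecreasing_is_cvgn => M M' MM; apply: int_Rn_le => // x; exact: ndF.
by near=> M; rewrite int_RnE//; exact: YB.
Unshelve. all: by end_near. Qed.

Definition nearby (a : int -> n.-tuple int -> R) (m : int) (x : n.-tuple R) : R :=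
  \sum_(k < 3) \sum_(i : shifts) shifted a i (m + step k) x.

(** Common end of the two cases with finite p: [J] is the area or the maximal functional, and the
    [W i M] are the shifted quantities that dominate it as the window grows. *)
Lemma lp_finish (J : n.-tuple R -> \bar R) (W : shifts -> nat -> n.-tuple R -> R)
    (c e D s K : R) :
  (forall x, 0 <= J x)%E -> (forall i M x, 0 <= W i M x) ->
  (forall i M, measurable_fun [set: n.-tuple R] (W i M)) ->
  (forall i x, {homo (W i) ^~ x : M M' / (M <= M')%N >-> M <= M'}) ->
  0 < e -> 0 < s -> 0 <= c -> 0 <= D -> 0 < K ->
  (forall x, J x <= ereal_sup (range (fun M => (c * \sum_i W i M x)%:E)))%E ->
  (forall i M, \int[@leb_n R n]_x (W i M x `^ e)%:E <= (D * K `^ s)%:E)%E ->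
  (poweR (int_Rn (fun x => poweR (J x) e)) s^-1 <=
    ((c `^ e * #|shifts|%:R `^ e * (#|shifts|%:R * D)) `^ s^-1 * K)%:E)%E.
Proof.
move=> J0 W0 mW ndW e0 s0 c0 D0 K0 JW WD.
have mWe i M : measurable_fun [set: n.-tuple R] (fun x => (W i M x `^ e)%:E).
  by apply/measurable_EFinP; apply: (measurableT_comp (measurable_powR e)).
set C := c `^ e * _ * _.
have C0 : 0 <= C by rewrite /C mulr_ge0 ?mulr_ge0 ?powR_ge0.
have key : (int_Rn (fun x => poweR (J x) e) <= (C * K `^ s)%:E)%E.
  apply: (lp_limit (Y := fun M x => c * \sum_i W i M x)) => //.
  - by move=> M x; rewrite mulr_ge0// sumr_ge0.
  - by move=> M; apply: measurable_funM => //; apply: measurable_sum.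
  - by move=> x M M' MM; rewrite ler_wpM2l//; apply: ler_sum => i _; exact: ndW.
  move=> M; apply: (@le_trans _ _ (\int[@leb_n R n]_x ((c `^ e * #|shifts|%:R `^ e)%:E *
      \sum_i (W i M x `^ e)%:E))%E).
    apply: ge0_le_integral_nomeas => x _; first by rewrite lee_fin powR_ge0.
    rewrite sumEFin -EFinM lee_fin powRM ?sumr_ge0// -mulrA ler_wpM2l ?powR_ge0//.
    exact: sum_powR_le.
  rewrite ge0_integralZl_EFin//; last 3 first.
  - by move=> x _; apply: sume_ge0 => i _; rewrite lee_fin powR_ge0.
  - exact: emeasurable_sum.
  - by rewrite mulr_ge0 ?powR_ge0.
  have -> : ((C * K `^ s)%:E = (c `^ e * #|shifts|%:R `^ e)%:E * (#|shifts|%:R * D * K `^ s)%:E)%E.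
    by rewrite /C -EFinM !mulrA.
  rewrite lee_wpmul2l ?lee_fin ?mulr_ge0 ?powR_ge0//.
  rewrite ge0_integral_sum//; last by move=> i x _; rewrite lee_fin powR_ge0.
  apply: (@le_trans _ _ (\sum_(i : shifts) (D * K `^ s)%:E)%E); first exact: lee_sum.
  by rewrite sumEFin lee_fin sumr_const -[_ *+ _]mulr_natl mulrA.
have -> : C `^ s^-1 * K = (C * K `^ s) `^ s^-1.
  by rewrite powRM ?powR_ge0// -powRrM mulfV ?gt_eqF// powRr1// ltW.
rewrite -poweR_EFin; apply: gt0_ler_poweR => //; rewrite ?invr_ge0 ?(ltW s0)//.
- by rewrite in_itv/= leey andbT; apply: int_Rn_ge0 => x; exact: poweR_ge0.
- by rewrite in_itv/= leey andbT lee_fin mulr_ge0 ?powR_ge0.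
Qed.

Lemma leb_n_cube (c : n.-tuple R) (r : R) : 0 < r ->
  leb_n [set y : n.-tuple R | forall i, `]tnth c i - r, tnth c i + r[%classic (tnth y i)] =
  ((2 * r) ^+ n)%:E.
Proof.
move=> r0; rewrite (leb_n_box (A := fun i => `]tnth c i - r, tnth c i + r[%classic)); last first.
  by move=> i; exact: measurable_itv.
rewrite (eq_bigr (fun=> (2 * r)%:E)) => [|i _]; last first.
  rewrite lebesgue_measure_itv/= lte_fin ifT; last by lra.
  by rewrite -EFinB; congr EFin; ring.
by rewrite big_const_ord; elim: (n) => [//|k IH]; rewrite iterS IH -EFinM exprS.
Qed.

Lemma measurable_cube (c : n.-tuple R) (r : R) :
  measurable [set y : n.-tuple R | forall i, `]tnth c i - r, tnth c i + r[%classic (tnth y i)].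
Proof.
by apply: (measurable_box (A := fun i => `]tnth c i - r, tnth c i + r[%classic)) => i; exact: measurable_itv.
Qed.

Lemma edist_lt_cube (c y : n.-tuple R) (r : R) : edist y c < r ->
  forall i, `]tnth c i - r, tnth c i + r[%classic (tnth y i).
Proof.
move=> h i; have := le_lt_trans (coord_le_edist y c i) h.
by rewrite ltr_norml /= in_itv/= => /andP[h1 h2]; apply/andP; split; lra.
Qed.

Lemma nearby_ge0 a m x : (forall m j, 0 <= a m j) -> 0 <= nearby a m x.
Proof. by move=> a0; do 2 apply: sumr_ge0 => ? _; exact: a0. Qed.

Lemma nearby_powR_le a m x (t : R) : (forall m j, 0 <= a m j) -> 0 < t ->
  nearby a m x `^ t <= (3 * #|shifts|)%:R `^ t *
    \sum_(k < 3) \sum_(i : shifts) shifted a i (m + step k) x `^ t.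
Proof.
move=> a0 t0; rewrite /nearby !pair_big/=.
apply: le_trans (sum_powR_le (v := fun p : 'I_3 * shifts => shifted a p.2 (m + step p.1) x) _ t0) _.
  by move=> p; exact: a0.
by rewrite card_prod card_ord.
Qed.

Lemma nearby_window_le a M x (t : R) : (forall m j, 0 <= a m j) -> 0 < t ->
  \sum_(l < (2 * M).+1) nearby a (winlev M l) x `^ t <=
  (3 * #|shifts|)%:R `^ t * 3 *
    \sum_(i : shifts) \sum_(l < (2 * M.+1).+1) shifted a i (winlev M.+1 l) x `^ t.
Proof.
move=> a0 t0; apply: (@le_trans _ _ (\sum_(l < (2 * M).+1) ((3 * #|shifts|)%:R `^ t *
    \sum_(k < 3) \sum_(i : shifts) shifted a i (winlev M l + step k) x `^ t))).
  by apply: ler_sum => l _; exact: nearby_powR_le.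
rewrite -mulr_sumr -mulrA ler_wpM2l ?powR_ge0//.
rewrite exchange_big/= mulr_natl -[in leRHS](card_ord 3) -sumr_const.
apply: ler_sum => k _; rewrite exchange_big/=; apply: ler_sum => i _.
rewrite -lee_fin -!sumEFin.
apply: (@winsum_step M (fun m => (shifted a i m x `^ t)%:E) k) => m.
by rewrite lee_fin powR_ge0.
Qed.

Lemma measurable_shifted a (i : shifts) m : measurable_fun [set: n.-tuple R] (shifted a i m).
Proof. exact: (measurable_cellwise (measurable_bigcell i.1 m) (@shifted_cellwise _ _ _)). Qed.

(** The slice of the cone at height s lies in a cube of volume (2 s)^n, so that 1/s remains of the
    weight s^(-n-1) and [layer_integral] applies. *)
Lemma cone_integral_le (t Cw : R) (a : int -> n.-tuple int -> R) (G : n.-tuple R * R -> \bar R) x :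
  (forall m j, 0 <= a m j) -> 0 < t -> 0 < Cw ->
  (forall z, 0 < z.2 -> (0 <= G z)%E) ->
  (forall z, cone x z -> (G z <= (Cw * nearby a (lev z.2) x)%:E)%E) ->
  (intH (fun z => (\1_(cone x) z)%:E * (poweR (G z) t * ((z.2 ^+ n.+1)^-1)%:E))%E <=
   ereal_sup (range (fun M => ((a2 - 1) * (2 ^+ n * Cw `^ t) * ((3 * #|shifts|)%:R `^ t * 3) *
     \sum_(i : shifts) \sum_(l < (2 * M.+1).+1) shifted a i (winlev M.+1 l) x `^ t)%:E)))%E.
Proof.
move=> a0 t0 Cw0 G0 GS.
have sg m := nearby_ge0 m x a0.
pose d m : \bar R := (2 ^+ n * Cw `^ t * nearby a m x `^ t)%:E.
have d0 m : (0 <= d m)%E by rewrite lee_fin !mulr_ge0 ?exprn_ge0 ?powR_ge0.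
apply: (layer_integral (d := d)) => //.
- move=> s s0; apply: int_Rn_ge0 => y; rewrite indicE.
  case: (boolP ((y, s) \in cone x)) => [/set_mem h|_]; last by rewrite mul0e.
  by rewrite mul1e mule_ge0 ?poweR_ge0// lee_fin invr_ge0 exprn_ge0// ltW.
- move=> s s0; have /andP[s1 s2] := levP s0.
  pose Q := [set y : n.-tuple R | forall i, `]tnth x i - s, tnth x i + s[%classic (tnth y i)].
  have mQ : measurable Q by exact: measurable_cube.
  pose c := (Cw * nearby a (lev s) x) `^ t * (s ^+ n.+1)^-1.
  have c0 : 0 <= c by rewrite mulr_ge0 ?powR_ge0// invr_ge0 exprn_ge0// ltW.
  apply: (@le_trans _ _ (int_Rn (fun y => c%:E * (\1_Q y)%:E)))%E.
    apply: int_Rn_le => y; rewrite !indicE.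
      by rewrite mule_ge0// mule_ge0 ?poweR_ge0// lee_fin invr_ge0 exprn_ge0// ltW.
    case: (boolP ((y, s) \in cone x)) => [/set_mem h|_]; last first.
      by rewrite mul0e mule_ge0// lee_fin.
    rewrite mem_set; last by apply: edist_lt_cube; case: h.
    rewrite mul1e mule1 /c EFinM lee_wpmul2r//.
      by rewrite lee_fin invr_ge0 exprn_ge0// ltW.
    rewrite -poweR_EFin; apply: gt0_ler_poweR; rewrite ?(ltW t0)//.
    + by rewrite in_itv/= leey andbT; exact: G0.
    + by rewrite in_itv/= leey andbT lee_fin mulr_ge0// ltW.
    + exact: GS h.
  rewrite int_RnZ//; last by apply/measurable_EFinP; exact: measurable_indic.
  have -> : int_Rn (fun y => (\1_Q y)%:E) = ((2 * s) ^+ n)%:E by exact: leb_n_cube.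
  rewrite /d -!EFinM lee_fin /c powRM ?(ltW Cw0)// exprMn exprS invfM.
  have -> : Cw `^ t * nearby a (lev s) x `^ t * (s^-1 * (s ^+ n)^-1) * (2 ^+ n * s ^+ n) =
    2 ^+ n * Cw `^ t * nearby a (lev s) x `^ t * s^-1.
    by field; rewrite expf_neq0 ?gt_eqF.
  rewrite ler_wpM2l ?mulr_ge0 ?exprn_ge0 ?powR_ge0//.
  by rewrite lef_pV2 ?posrE// ?scale_gt0.
- move=> M; apply: le_trans (ereal_sup_ubound (ex_intro2 _ _ M I erefl)).
  rewrite /d sumEFin -EFinM lee_fin -mulr_sumr mulrA -[leRHS]mulrA.
  apply: ler_wpM2l.
    by rewrite mulr_ge0 ?mulr_ge0 ?exprn_ge0 ?powR_ge0// subr_ge0 ltW// aperture_gt1.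
  exact: nearby_window_le.
Qed.

Lemma tent_upper_AA (s t k Cw : R) : 0 < s -> 0 < t -> 0 < k -> 0 < Cw ->
  exists2 C : R, 0 < C & forall K a E g G, 0 < K -> (forall m j, 0 <= a m j) ->
    certificate k s%:E t%:E K a E g -> (forall z, 0 < z.2 -> (0 <= G z)%E) ->
    (forall x z, cone x z -> (G z <= (Cw * nearby a (lev z.2) x)%:E)%E) ->
    (tent_norm s%:E t%:E G <= (C * K)%:E)%E.
Proof.
move=> s0 t0 k0 Cw0; set c := (a2 - 1) * (2 ^+ n * Cw `^ t) * ((3 * #|shifts|)%:R `^ t * 3).
set D := tree_const (shifted_frac k) (s / t).
have c0 : 0 <= c.
  by rewrite !mulr_ge0 ?exprn_ge0 ?powR_ge0// subr_ge0 ltW// aperture_gt1.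
have st0 : 0 < s / t by rewrite divr_gt0.
have D0 : 0 <= D by apply/ltW/tree_const_gt0 => //; exact: shifted_frac_gt0.
(* The summand 1 only serves to make the constant positive. *)
exists ((c `^ (s / t) * #|shifts|%:R `^ (s / t) * (#|shifts|%:R * D)) `^ s^-1 + 1).
  by rewrite ltr_wpDl// powR_ge0.
move=> K a E g G K0 a0 cert G0 GS.
apply: (@le_trans _ _ ((c `^ (s / t) * #|shifts|%:R `^ (s / t) * (#|shifts|%:R * D)) `^ s^-1 * K)%:E); last first.
  by rewrite lee_fin ler_wpM2r ?(ltW K0)// lerDl.
rewrite /tent_norm/=.
apply: (lp_finish (W := fun i M x => \sum_(l < (2 * M.+1).+1) shifted a i (winlev M.+1 l) x `^ t)) => //.
- move=> x; apply: intH_ge0 => z; rewrite indicE.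
  case: (boolP (z \in cone x)) => [/set_mem[z0 _]|_]; last by rewrite mul0e.
  by rewrite mul1e mule_ge0 ?poweR_ge0// lee_fin invr_ge0 exprn_ge0// ltW.
- by move=> i M x; apply: sumr_ge0 => l _; exact: powR_ge0.
- move=> i M; apply: measurable_sum => l; apply: (measurableT_comp (measurable_powR t)).
  exact: measurable_shifted.
- move=> i x M M' MM; rewrite -lee_fin -!sumEFin.
  apply: (@winsum_ndW M.+1 M'.+1 (fun m => (shifted a i m x `^ t)%:E)) => // m.
  by rewrite lee_fin powR_ge0.
- by move=> x; apply: cone_integral_le => //; exact: GS.
- by move=> i M; exact: (shifted_lp_lq k0 K0 a0 cert).
Qed.

Lemma bigmax_window_ndW (f : int -> R) M M' : (M <= M')%N ->
  \big[Num.max/0]_(l < (2 * M).+1) f (winlev M l) <= \big[Num.max/0]_(l < (2 * M').+1) f (winlev M' l).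
Proof.
move=> MM; apply: bigmax_le => [|l _]; first by apply/bigmax_geP; left.
have h : (l + (M' - M) < (2 * M').+1)%N by have := ltn_ord l; clear -MM; lia.
apply/bigmax_geP; right; exists (Ordinal h) => //=.
by rewrite (_ : winlev M' _ = winlev M l)// /winlev; clear -MM; lia.
Qed.

Lemma measurable_bigmax (N : nat) (f : nat -> n.-tuple R -> R) :
  (forall l, measurable_fun [set: n.-tuple R] (f l)) ->
  measurable_fun [set: n.-tuple R] (fun x => \big[Num.max/0]_(l < N) f l x).
Proof.
elim: N f => [|N IH] f mf; first by under eq_fun do rewrite big_ord0; exact: measurable_cst.
under eq_fun do rewrite big_ord_recl.
by apply: measurable_maxr => //; apply: (IH (fun l => f l.+1)) => l.
Qed.

Lemma tent_upper_C (s k Cw : R) : 0 < s -> 0 < k -> 0 < Cw ->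
  exists2 C : R, 0 < C & forall K a E g G, 0 < K -> (forall m j, 0 <= a m j) ->
    certificate k s%:E +oo%E K a E g -> (forall z, 0 < z.2 -> (0 <= G z)%E) ->
    (forall x z, cone x z -> (G z <= (Cw * nearby a (lev z.2) x)%:E)%E) ->
    (tent_norm s%:E +oo%E G <= (C * K)%:E)%E.
Proof.
move=> s0 k0 Cw0; set D := 2 / shifted_frac k.
have D0 : 0 <= D by rewrite divr_ge0//; apply: ltW; exact: shifted_frac_gt0.
have c0 : 0 <= Cw * 3 by rewrite mulr_ge0// ltW.
exists (((Cw * 3) `^ s * #|shifts|%:R `^ s * (#|shifts|%:R * D)) `^ s^-1 + 1).
  by rewrite ltr_wpDl// powR_ge0.
move=> K a E g G K0 a0 cert G0 GS.
apply: (@le_trans _ _ (((Cw * 3) `^ s * #|shifts|%:R `^ s * (#|shifts|%:R * D)) `^ s^-1 * K)%:E); last first.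
  by rewrite lee_fin ler_wpM2r ?(ltW K0)// lerDl.
rewrite /tent_norm/=.
apply: (lp_finish (W := fun i M x => \big[Num.max/0]_(l < (2 * M.+1).+1) shifted a i (winlev M.+1 l) x)) => //.
- move=> x; apply: (@le_trans _ _ (G (x, 1))); first exact: G0.
  apply: ereal_sup_ubound; exists (x, 1) => //; split => //=; by rewrite edistxx.
- by move=> i M x; apply/bigmax_geP; left.
- move=> i M; apply: (@measurable_bigmax _ (fun l => shifted a i (winlev M.+1 l))) => l.
  exact: measurable_shifted.
- by move=> i x M M' MM; apply: (@bigmax_window_ndW (fun m => shifted a i m x)).
- move=> x; apply: ge_ereal_sup => _ [z xz <-]; apply: le_trans (GS _ _ xz) _.
  apply: le_trans (ereal_sup_ubound (ex_intro2 _ _ `|lev z.2|%N I erefl)).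
  rewrite lee_fin -mulrA ler_wpM2l ?(ltW Cw0)//.
  rewrite /nearby mulr_natl -[in leRHS](card_ord 3) -sumr_const.
  apply: ler_sum => k' _; apply: ler_sum => i _.
  have [l lm] := winlev_mem (lev z.2).
  have h : (l + (2 - k') < (2 * (`|lev z.2|).+1).+1)%N by have := ltn_ord l; clear; lia.
  apply/bigmax_geP; right; exists (Ordinal h) => //=.
  rewrite (_ : winlev _ _ = lev z.2 + step k')// -{3}lm /winlev /step.
  by have := ltn_ord k'; clear; lia.
- move=> i M; have h := shifted_lp_sup k0 K0 a0 cert i M.+1 erefl s0 erefl; apply: le_trans h _. by rewrite lexx.
Qed.

Lemma tent_upper_D (k Cw : R) : 0 < k -> 0 < Cw ->
  exists2 C : R, 0 < C & forall K a E g G, 0 < K -> (forall m j, 0 <= a m j) ->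
    certificate k +oo%E +oo%E K a E g -> (forall z, 0 < z.2 -> (0 <= G z)%E) ->
    (forall x z, cone x z -> (G z <= (Cw * nearby a (lev z.2) x)%:E)%E) ->
    (tent_norm +oo%E +oo%E G <= (C * K)%:E)%E.
Proof.
move=> k0 Cw0; exists (Cw * (3 * #|shifts|)%:R + 1).
  by rewrite ltr_wpDl// mulr_ge0// ltW.
move=> K a E g G K0 a0 cert G0 GS.
rewrite /tent_norm/= /esssupH; apply: ereal_inf_lbound => /=.
rewrite (_ : mkset _ = set0) ?measure0//.
apply/seteqP; split => // z [z0 /=]; rewrite ltNge => /negP; apply.
have xz : cone z.1 z by split => //; rewrite edistxx.
apply: le_trans (GS _ _ xz) _; rewrite lee_fin.
apply: (@le_trans _ _ (Cw * ((3 * #|shifts|)%:R * K))); last first.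
  by rewrite mulrA ler_wpM2r ?(ltW K0)// lerDl.
rewrite ler_wpM2l ?(ltW Cw0)// mulr_natl /nearby pair_big/=.
rewrite -[X in _ *+ (X * _)](card_ord 3) -card_prod -sumr_const.
by apply: ler_sum => p _; exact: (shifted_sup_bound k0 K0 cert).
Qed.

Lemma gcell_close L o (x y : n.-tuple R) i : 0 < L -> gcell L o x = gcell L o y ->
  `|tnth x i - tnth y i| < L.
Proof.
move=> L0 /(gcellP _ _ _ L0) /(_ i) /andP[x1 x2].
have /(gcellP _ _ _ L0) /(_ i) /andP[y1 y2] : gcell L o y = gcell L o y by [].
rewrite ltr_norml; apply/andP; split; lra.
Qed.

Lemma edist_translate (y : n.-tuple R) (i0 : 'I_n) (e : R) :
  edist y [tuple tnth y i + (if i == i0 then e else 0) | i < n] = `|e|.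
Proof.
rewrite /edist (bigD1 i0)//= big1 => [|i /negbTE h]; rewrite tnth_mktuple.
  by rewrite eqxx addr0 opprD addNKr sqrrN sqrtr_sqr.
by rewrite h addr0 subrr expr0n.
Qed.

(** If s > rho, the two points reached from y by moving rho forwards and backwards along an axis
    would lie in B(y, s), hence in the ball, although they are 2 rho apart in that coordinate. *)
Lemma tent_eball (c : n.-tuple R) (rho : R) (y : n.-tuple R) (s : R) :
  0 < rho -> tent (eball c rho) (y, s) -> [/\ 0 < s, eball c rho y & s <= rho].
Proof.
move=> rho0 [/= s0 h]; have yB : eball c rho y by apply: h; rewrite /eball/= edistxx.
split => //; rewrite leNgt; apply/negP => rs.
pose i0 := Ordinal hn.
have far (e : R) : `|e| < s -> `|tnth y i0 + e - tnth c i0| < rho.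
  move=> es; pose y' := [tuple tnth y i + (if i == i0 then e else 0) | i < n].
  have yy : edist y y' = `|e| := edist_translate y i0 e.
  have h' : eball c rho y' by apply: h; rewrite /eball/= edistC yy.
  by have := le_lt_trans (coord_le_edist _ _ i0) h'; rewrite tnth_mktuple eqxx.
have := far rho; rewrite gtr0_norm// => /(_ rs).
have := far (- rho); rewrite normrN gtr0_norm// => /(_ rs).
by rewrite !ltr_norml => /andP[h1 h2] /andP[h3 h4]; lra.
Qed.

Lemma measurable_eball (c : n.-tuple R) (r : R) : measurable (eball c r).
Proof.
rewrite (_ : eball c r = (fun y => edist y c) @^-1` `]-oo, r[%classic).
  by rewrite -[X in measurable X]setTI; apply: measurable_edist_lt => //; exact: measurable_itv.
by apply/seteqP; split=> y; rewrite /eball/= in_itv.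
Qed.

Lemma leb_n_eball (c : n.-tuple R) (r : R) : 0 < r ->
  exists2 b : R, leb_n (eball c r) = b%:E & (2 * r / n%:R) ^+ n <= b.
Proof.
move=> r0; have rn : 0 < r / n%:R by rewrite divr_gt0.
have h1 : (((2 * r / n%:R) ^+ n)%:E <= leb_n (eball c r))%E.
  rewrite -mulrA -(leb_n_cube c rn); apply: le_measure; rewrite ?inE.
  - exact: measurable_cube.
  - exact: measurable_eball.
  - move=> y hy; rewrite /eball/=; apply: edist_lt => // i.
    have := hy i; rewrite /= in_itv/= ltr_norml => /andP[k1 k2]; apply/andP; split; lra.
have h2 : (leb_n (eball c r) <= ((2 * r) ^+ n)%:E)%E.
  rewrite -(leb_n_cube c r0); apply: le_measure; rewrite ?inE.
  - exact: measurable_eball.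
  - exact: measurable_cube.
  - by move=> y hy; apply: edist_lt_cube.
move: h1 h2; case: (leb_n _) => [b|//|//]; rewrite !lee_fin => h1 _.
by exists b.
Qed.

Lemma lev_le s s' : 0 < s -> s <= s' -> lev s <= lev s'.
Proof.
move=> s0 ss; have s'0 := lt_le_trans s0 ss.
have /andP[h1 _] := levP s0; have /andP[_ h2] := levP s'0.
rewrite leNgt; apply/negP => h; have /scale_le h' : lev s' + 1 <= lev s by clear -h; lia.
by have := le_lt_trans (le_trans h' (le_trans h1 ss)) h2; rewrite ltxx.
Qed.

(** A large cell meeting the ball reaches at most rho + [bigside] from the centre in each
    coordinate, and at this level [bigside] is bounded by a multiple of rho. *)
Lemma bigcell_hull_le (s : {ffun 'I_n -> bool}) (c : n.-tuple R) (rho b : R) : 0 < rho ->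
  (2 * rho / n%:R) ^+ n <= b ->
  (leb_n (bigcell s (lev rho + 1)%R @^-1` (bigcell s (lev rho + 1)%R @` eball c rho)) <=
    ((n%:R + 2 * magnif%:R * a2) ^+ n * b)%:E)%E.
Proof.
move=> rho0 hb; set m := lev rho + 1.
have b0 := bigside_gt0 m.
have r0 : 0 < rho + bigside m by rewrite addr_gt0.
apply: (@le_trans _ _ ((2 * (rho + bigside m)) ^+ n)%:E).
  rewrite -(leb_n_cube c r0); apply: le_measure; rewrite ?inE.
  - by apply: measurable_preimage_cell => j; exact: measurable_bigcell.
  - exact: measurable_cube.
  - move=> y [y0 y0B /esym yy] i.
    have h1 := gcell_close i b0 yy.
    have h2 := le_lt_trans (coord_le_edist y0 c i) y0B.
    move: h1 h2; rewrite !ltr_norml => /andP[h1 h2] /andP[h3 h4].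
    by rewrite /= in_itv/=; apply/andP; split; lra.
rewrite lee_fin.
apply: (@le_trans _ _ ((n%:R + 2 * magnif%:R * a2) ^+ n * (2 * rho / n%:R) ^+ n)); last first.
  by rewrite ler_wpM2l// exprn_ge0// addr_ge0// ?mulr_ge0// ltW.
rewrite -exprMn; apply: lerXn2r; rewrite ?nnegrE.
- by rewrite mulr_ge0// ltW.
- have h2 := ltW a20; have h3 := ltW rho0.
  by rewrite mulr_ge0 ?addr_ge0 ?mulr_ge0 ?invr_ge0.
have -> : (n%:R + 2 * magnif%:R * a2) * (2 * rho / n%:R) =
    2 * (rho + 2 * magnif%:R * (1 / n%:R * (a2 * rho))).
  by field; rewrite gt_eqF.
rewrite ler_pM2l// lerD2l /bigside natrM ler_pM2l; last first.
  by rewrite mulr_gt0// ltr0n magnif_gt0.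
have /andP[h _] := side_scale m; have s0 := side_gt0 m.
apply: (@le_trans _ _ (a1 / n%:R * scale m)); first lra.
rewrite /m scaleS; have /andP[h1 _] := levP rho0.
apply: ler_pM.
- by rewrite divr_ge0// ltW.
- by rewrite mulr_ge0 ?(ltW (scale_gt0 _))// ltW.
- by rewrite ler_wpM2r ?invr_ge0// ltW.
- by rewrite ler_wpM2l// ltW.
Qed.

Lemma step_le1 (k : 'I_3) : step k <= 1.
Proof. by rewrite /step; have := ltn_ord k; lia. Qed.

Lemma int_Rn0 : int_Rn (fun _ : n.-tuple R => 0%E) = 0%E :> \bar R.
Proof. exact: (functional0 (@int_RnZ R n)). Qed.

Lemma tent_integral_le (t Cw k K : R) (a : int -> n.-tuple int -> R) E g
    (G : n.-tuple R * R -> \bar R) (c : n.-tuple R) (rho b : R) :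
  0 < t -> 0 < Cw -> 0 < k -> 0 < K -> (forall m j, 0 <= a m j) ->
  certificate k +oo%E t%:E K a E g ->
  (forall z, 0 < z.2 -> (0 <= G z)%E) ->
  (forall x z, cone x z -> (G z <= (Cw * nearby a (lev z.2) x)%:E)%E) ->
  0 < rho -> (2 * rho / n%:R) ^+ n <= b ->
  (intH (fun z => (\1_(tent (eball c rho)) z)%:E * (poweR (G z) t * (z.2^-1)%:E))%E <=
   ((a2 - 1) * (Cw `^ t * (3 * #|shifts|)%:R `^ t) *
    (3 * #|shifts|)%:R * ((shifted_frac k)^-1 * (n%:R + 2 * magnif%:R * a2) ^+ n) * (K `^ t * b))%:E)%E.
Proof.
move=> t0 Cw0 k0 K0 a0 cert G0 GS rho0 hb.
set B := eball c rho; have mB : measurable B by exact: measurable_eball.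
set m0 := lev rho.
have sg m x := nearby_ge0 m x a0.
pose f m y : \bar R := (\1_B y * (Cw * nearby a m y) `^ t)%:E.
have f0 m y : (0 <= f m y)%E by rewrite lee_fin mulr_ge0 ?powR_ge0.
have mu i m : measurable_fun [set: n.-tuple R] (fun y => shifted a i m y `^ t).
  by apply: (measurableT_comp (measurable_powR t)); exact: measurable_shifted.
have mf m : measurable_fun [set: n.-tuple R] (f m).
  apply/measurable_EFinP; apply: measurable_funM; first exact: measurable_indic.
  apply: (measurableT_comp (measurable_powR t)); apply: measurable_funM => //.
  by apply: measurable_sum => k'; apply: measurable_sum => i; exact: measurable_shifted.
(* A tent over a ball of radius rho has no points above height rho, so levels above that of rho
   contribute nothing. *)
pose d m : \bar R := if (m <= m0)%R then int_Rn (f m) else 0%E.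
have d0 m : (0 <= d m)%E by rewrite /d; case: ifP => // _; exact: int_Rn_ge0.
apply: (layer_integral (d := d)) => //.
- move=> s s0; apply: int_Rn_ge0 => y; rewrite indicE.
  case: (boolP ((y, s) \in _)) => _; last by rewrite mul0e.
  by rewrite mul1e mule_ge0 ?poweR_ge0// lee_fin invr_ge0 ltW.
- move=> s s0; have /andP[s1 s2] := levP s0.
  apply: (@le_trans _ _ (d (lev s) * (s^-1)%:E)%E); last first.
    by rewrite lee_wpmul2l// lee_fin lef_pV2 ?posrE ?scale_gt0.
  rewrite /d; case: ifPn => ls; last first.
    rewrite mul0e -int_Rn0; apply: int_Rn_le => y; rewrite indicE.
      case: (boolP ((y, s) \in _)) => _; last by rewrite mul0e.
      by rewrite mul1e mule_ge0 ?poweR_ge0// lee_fin invr_ge0 ltW.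
    case: (boolP ((y, s) \in _)) => [/set_mem h|_]; last by rewrite mul0e.
    have [_ _ sr] := tent_eball rho0 h.
    by rewrite (lev_le s0 sr) in ls.
  rewrite muleC -int_RnZ ?invr_ge0 ?(ltW s0)//; apply: int_Rn_le => y; rewrite indicE.
    case: (boolP ((y, s) \in _)) => _; last by rewrite mul0e.
    by rewrite mul1e mule_ge0 ?poweR_ge0// lee_fin invr_ge0 ltW.
  case: (boolP ((y, s) \in _)) => [/set_mem h|_]; last first.
    by rewrite mul0e mule_ge0// lee_fin invr_ge0 ltW.
  have [_ yB sr] := tent_eball rho0 h.
  rewrite mul1e muleC lee_wpmul2l ?lee_fin ?invr_ge0 ?(ltW s0)//.
  rewrite /f indicE mem_set// mul1r -poweR_EFin; apply: gt0_ler_poweR; rewrite ?(ltW t0)//.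
  + by rewrite in_itv/= leey andbT; exact: G0.
  + by rewrite in_itv/= leey andbT lee_fin mulr_ge0// ltW.
  + by apply: (GS y (y, s)); split => //=; rewrite edistxx.
- move=> M.
  pose N := (3 * #|shifts|)%:R `^ t.
  (* Neighbouring boxes may be one level higher than the point itself, hence [m0 + 1]. *)
  pose v i m : \bar R := if (m <= m0 + 1)%R then (\int[@leb_n R n]_(y in B) (shifted a i m y `^ t)%:E)%E else 0%E.
  have v0 i m : (0 <= v i m)%E.
    by rewrite /v; case: ifP => // _; apply: integral_ge0 => y _; rewrite lee_fin powR_ge0.
  have step1 m : (d m <= (Cw `^ t * N)%:E * \sum_(k' < 3) \sum_(i : shifts) v i (m + step k')%R)%E.
    rewrite /d; case: ifPn => mm; last first.
      by rewrite mule_ge0 ?lee_fin ?mulr_ge0 ?powR_ge0// sume_ge0// => k' _; exact: sume_ge0.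
    have vE i k' : v i (m + step k')%R = (\int[@leb_n R n]_y (\1_B y * shifted a i (m + step k') y `^ t)%:E)%E.
      have mk : m + step k' <= m0 + 1 by exact: lerD mm (step_le1 k').
      by rewrite /v mk integral_setE.
    under eq_bigr do under eq_bigr do rewrite vE.
    rewrite int_RnE//.
    under eq_bigr => k' _.
      rewrite -ge0_integral_sum//; last 2 first.
      - move=> i; apply/measurable_EFinP; apply: measurable_funM => //; exact: measurable_indic.
      - by move=> i y _; rewrite lee_fin mulr_ge0 ?powR_ge0.
      over.
    rewrite -ge0_integral_sum//; last 2 first.
    - move=> k'; apply: emeasurable_sum => i.
      by apply/measurable_EFinP; apply: measurable_funM => //; exact: measurable_indic.
    - by move=> k' y _; apply: sume_ge0 => i _; rewrite lee_fin mulr_ge0 ?powR_ge0.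
    rewrite -ge0_integralZl_EFin//; last 3 first.
    - by move=> y _; do 2 apply: sume_ge0 => ? _; rewrite lee_fin mulr_ge0 ?powR_ge0.
    - apply: emeasurable_sum => k'; apply: emeasurable_sum => i.
      by apply/measurable_EFinP; apply: measurable_funM => //; exact: measurable_indic.
    - by rewrite mulr_ge0 ?powR_ge0.
    apply: ge0_le_integral_nomeas => y _ //.
    rewrite /f; under eq_bigr do rewrite sumEFin; rewrite sumEFin -EFinM lee_fin.
    under eq_bigr do rewrite -mulr_sumr.
    rewrite -mulr_sumr mulrCA ler_wpM2l// powRM ?(ltW Cw0)// -mulrA ler_wpM2l ?powR_ge0//.
    exact: nearby_powR_le.
  have step2 i : (\sum_(l < (2 * M.+1).+1) v i (winlev M.+1 l) <=
      ((shifted_frac k)^-1 * K `^ t * ((n%:R + 2 * magnif%:R * a2) ^+ n * b))%:E)%E.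
    set Bi := bigcell i.1 (m0 + 1)%R @^-1` (bigcell i.1 (m0 + 1)%R @` B).
    have mBi : measurable Bi by apply: measurable_preimage_cell => j; exact: measurable_bigcell.
    have f00 := shifted_frac_gt0 k0.
    apply: (@le_trans _ _ (((shifted_frac k)^-1 * K `^ t)%:E * leb_n Bi)%E); last first.
      rewrite [leRHS]EFinM lee_wpmul2l ?lee_fin ?mulr_ge0 ?powR_ge0 ?invr_ge0 ?(ltW f00)//.
      exact: bigcell_hull_le.
    have := shifted_carleson k0 K0 cert i M.+1 (m0 + 1) (bigcell i.1 (m0 + 1)%R @` B) erefl erefl t0.
    rewrite -/Bi; apply: le_trans; rewrite integral_setE.
    under [leRHS]eq_integral => y _.
      rewrite big_mkcond mulr_sumr -sumEFin.
      over.
    rewrite ge0_integral_sum//; last 2 first.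
    - move=> l; apply/measurable_EFinP; apply: measurable_funM; first exact: measurable_indic.
      by case: (winlev M.+1 l <= m0 + 1) => //; exact: measurable_cst.
    - by move=> l y _; rewrite lee_fin mulr_ge0//; case: ifP => // _; exact: powR_ge0.
    apply: lee_sum => l _; rewrite /v; case: ifP => _; last first.
      by apply: integral_ge0 => y _; rewrite mulr0.
    rewrite integral_setE; apply: ge0_le_integral_nomeas => y _.
      by rewrite lee_fin mulr_ge0 ?powR_ge0.
    rewrite lee_fin ler_wpM2r ?powR_ge0// !indicE.
    case: (boolP (y \in B)) => // /set_mem yB.
    by rewrite mem_set//; exists y.
  apply: (@le_trans _ _ ((a2 - 1)%:E * ((Cw `^ t * N)%:E * \sum_(k' < 3) \sum_(i : shifts)
     \sum_(l < (2 * M.+1).+1) v i (winlev M.+1 l))))%E.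
    rewrite lee_wpmul2l ?lee_fin ?subr_ge0 ?(ltW aperture_gt1)//.
    apply: (@le_trans _ _ (\sum_(l < (2 * M).+1) (Cw `^ t * N)%:E * \sum_(k' < 3) \sum_(i : shifts) v i (winlev M l + step k')%R)%E).
      by apply: lee_sum => l _; exact: step1.
    rewrite -ge0_sume_distrr; last by move=> l _; apply: sume_ge0 => k' _; exact: sume_ge0.
    rewrite lee_wpmul2l ?lee_fin ?mulr_ge0 ?powR_ge0//.
    rewrite exchange_big/=; apply: lee_sum => k' _; rewrite exchange_big/=; apply: lee_sum => i _.
    exact: winsum_step.
  apply: (@le_trans _ _ ((a2 - 1)%:E * ((Cw `^ t * N)%:E * \sum_(k' < 3) \sum_(i : shifts)
      ((shifted_frac k)^-1 * K `^ t * ((n%:R + 2 * magnif%:R * a2) ^+ n * b))%:E)))%E.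
    rewrite lee_wpmul2l ?lee_fin ?subr_ge0 ?(ltW aperture_gt1)//.
    rewrite lee_wpmul2l ?lee_fin ?mulr_ge0 ?powR_ge0//.
    by apply: lee_sum => k' _; apply: lee_sum => i _; exact: step2.
  under eq_bigr do rewrite sumEFin.
  rewrite sumEFin -!EFinM lee_fin !sumr_const card_ord -mulrnA -[_ *+ _]mulr_natl -/N mulnC.
  by rewrite le_eqVlt; apply/orP; left; apply/eqP; ring.
Qed.

Lemma tent_upper_B (t k Cw : R) : 0 < t -> 0 < k -> 0 < Cw ->
  exists2 C : R, 0 < C & forall K a E g G, 0 < K -> (forall m j, 0 <= a m j) ->
    certificate k +oo%E t%:E K a E g -> (forall z, 0 < z.2 -> (0 <= G z)%E) ->
    (forall x z, cone x z -> (G z <= (Cw * nearby a (lev z.2) x)%:E)%E) ->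
    (tent_norm +oo%E t%:E G <= (C * K)%:E)%E.
Proof.
move=> t0 k0 Cw0.
set D := (a2 - 1) * (Cw `^ t * (3 * #|shifts|)%:R `^ t) *
    (3 * #|shifts|)%:R * ((shifted_frac k)^-1 * (n%:R + 2 * magnif%:R * a2) ^+ n).
have D0 : 0 <= D.
  have h1 := ltW a20; have h2 := ltW (shifted_frac_gt0 k0); have h3 := ltW aperture_gt1.
  rewrite /D mulr_ge0 ?mulr_ge0 ?powR_ge0 ?subr_ge0 ?invr_ge0//.
  by rewrite exprn_ge0// addr_ge0// mulr_ge0// mulr_ge0.
exists (D `^ t^-1 + 1); first by rewrite ltr_wpDl// powR_ge0.
move=> K a E g G K0 a0 cert G0 GS.
apply: (@le_trans _ _ (D `^ t^-1 * K)%:E); last first.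
  by rewrite lee_fin ler_wpM2r ?(ltW K0)// lerDl.
rewrite /tent_norm/=; apply: ge_ereal_sup => _ [x [c [rho [rho0 [_ ->]]]]].
have [b bE hb] := leb_n_eball c rho0.
have b0 : 0 < b by apply: lt_le_trans hb; rewrite exprn_gt0// divr_gt0// mulr_gt0.
have -> : D `^ t^-1 * K = (D * K `^ t) `^ t^-1.
  by rewrite powRM ?powR_ge0// -powRrM mulfV ?gt_eqF// powRr1// ltW.
rewrite bE/= -[X in (_ <= X)%E]poweR_EFin; set I := intH _.
have I0 : (0 <= I)%E.
  apply: intH_ge0 => z; rewrite indicE; case: (boolP (z \in _)) => [/set_mem[z0 _]|_].
    by rewrite mul1e mule_ge0 ?poweR_ge0// lee_fin invr_ge0 ltW.
  by rewrite mul0e.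
apply: gt0_ler_poweR; rewrite ?invr_ge0 ?(ltW t0)//.
- by rewrite in_itv/= leey andbT mule_ge0// lee_fin invr_ge0 ltW.
- by rewrite in_itv/= leey andbT lee_fin mulr_ge0 ?powR_ge0.
rewrite lee_pdivrMl//; apply: le_trans (tent_integral_le c t0 Cw0 k0 K0 a0 cert G0 GS rho0 hb) _.
by rewrite -EFinM lee_fin; rewrite -/D le_eqVlt; apply/orP; left; apply/eqP; ring.
Qed.

Lemma tent_norm_le_certificate p q (k Cw : R) : (0 < p)%E -> (0 < q)%E -> 0 < k -> 0 < Cw ->
  exists2 C : R, 0 < C & forall K a E g G, 0 < K -> (forall m j, 0 <= a m j) ->
    certificate k p q K a E g -> (forall z, 0 < z.2 -> (0 <= G z)%E) ->
    (forall x z, cone x z -> (G z <= (Cw * nearby a (lev z.2) x)%:E)%E) ->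
    (tent_norm p q G <= (C * K)%:E)%E.
Proof.
move=> p0 q0 k0 Cw0; case/exponentP: p0 => [s s0 -> _|-> _]; case/exponentP: q0 => [t t0 -> _|-> _].
- exact: tent_upper_AA.
- exact: tent_upper_C.
- exact: tent_upper_B.
- exact: tent_upper_D.
Qed.

(** * From norm bounds to certificates *)

Lemma measurable_ereal_sup d (T : measurableType d) (f : nat -> T -> \bar R) :
  (forall k, measurable_fun [set: T] (f k)) ->
  measurable_fun [set: T] (fun x => ereal_sup (range (f^~ x))).
Proof.
move=> mf; apply: eq_measurable_fun (measurable_fun_esups mf 0%N) => x _.
by rewrite /esups/=; congr ereal_sup; apply/seteqP; split => _ [k _ <-]; exists k.
Qed.

Lemma certificate_of_majorant (s c K : R) (q : \bar R) (al : int -> n.-tuple int -> \bar R)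
    (L : n.-tuple R -> \bar R) :
  0 < s -> (0 < q)%E -> 0 < c -> 0 < K -> measurable_fun [set: n.-tuple R] L ->
  (forall x, 0 <= L x)%E -> (int_Rn (fun x => poweR (L x) s) <= (K `^ s)%:E)%E ->
  (forall x m, (L x < +oo)%E -> (al m (cell m x) < +oo)%E) ->
  (forall x l, L x = l%:E -> lq_bound q (fun m => fine (al m (cell m x))) (c * l)) ->
  (forall m j, (al m j < +oo)%E) /\
  exists E g, certificate (3 / 4) s%:E q (c * K) (fun m j => fine (al m j)) E g.
Proof.
move=> s0 q0 c0 K0 mL L0 iL fal lq.
have mLs : measurable_fun [set: n.-tuple R] (fun x => poweR (L x) s).
  exact: measurableT_comp (measurable_poweR s) mL.
pose N := [set x | L x = +oo%E].
have mN : measurable N by rewrite -[N]setTI; apply: (mL _ [set +oo%E]) => //; exact: emeasurable_set1.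
have N0 : leb_n N = 0%E.
  have iLs : (@leb_n R n).-integrable setT (fun x => poweR (L x) s).
    apply/integrableP; split => //.
    under eq_integral => x _ do rewrite gee0_abs ?poweR_ge0//.
    rewrite -int_RnE//; last by move=> x; exact: poweR_ge0.
    by apply: le_lt_trans iL _; rewrite ltry.
  have [A [mA A0 NA]] := integrable_ae measurableT iLs.
  apply/eqP; rewrite eq_le measure_ge0 andbT -A0; apply: le_measure; rewrite ?inE//.
  move=> x Nx; apply: NA => /= /(_ I); rewrite Nx eqy_poweR//.
have NC m j : exists2 x, cell m x = j & (L x < +oo)%E.
  apply: contrapT => h.
  have : leb_n (cell m @^-1` [set j]) = 0%E.
    apply/eqP; rewrite eq_le measure_ge0 andbT -N0; apply: le_measure; rewrite ?inE//.
    + exact: measurable_cell.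
    + move=> x xj; apply: contrapT => Lx; apply: h; exists x => //.
      by rewrite ltey; apply/eqP.
  rewrite leb_n_cell => -[] /eqP; rewrite gt_eqF// exprn_gt0//; exact: side_gt0.
split=> [m j|]; first by have [x <- Lx] := NC m j; exact: fal.
exists (fun=> ~` N), (fun x => fine (L x) / K); split.
- by move=> m; exact: measurableC.
- move=> m j; have mj := measurable_cell m j.
  apply: (@le_trans _ _ (leb_n (cell m @^-1` [set j]))).
    by rewrite -[leRHS]mul1e lee_wpmul2r// lee_fin; lra.
  apply: (@le_trans _ _ (leb_n ((~` N `&` cell m @^-1` [set j]) `|` N))).
    apply: le_measure; rewrite ?inE//; first by apply: measurableU => //; apply: measurableI => //; exact: measurableC.
    by move=> x xj; case: (pselect (N x)) => Nx; [right|left].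
  rewrite -[leRHS]adde0 -[X in (_ + X)%E]N0; apply: measureU2 => //.
  by apply: measurableI => //; exact: measurableC.
- split=> [|x]; last by rewrite divr_ge0 ?fine_ge0 ?(ltW K0).
  by apply: measurable_funM => //; exact: measurableT_comp mL.
- rewrite /lp_unit/=.
  have Ks : 0 < K `^ s by rewrite powR_gt0.
  rewrite -(lee_pmul2l _ (x := (K `^ s)%:E)) ?lte_fin// mule1.
  rewrite -ge0_integralZl_EFin ?(ltW Ks)//; last 2 first.
  + by move=> x _; rewrite lee_fin powR_ge0.
  + apply/measurable_EFinP; apply: (measurableT_comp (measurable_powR s)).
    by apply: measurable_funM => //; exact: measurableT_comp mL.
  rewrite (int_RnE mLs) in iL; last by move=> x; exact: poweR_ge0.
  apply: le_trans iL; apply: ge0_le_integral_nomeas => x _; first by rewrite -EFinM lee_fin mulr_ge0 ?powR_ge0.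
  rewrite -EFinM -powRM ?(ltW K0) ?divr_ge0 ?fine_ge0 ?(ltW K0)// mulrC divfK ?gt_eqF//.
  have := L0 x; case: (L x) => [l||]//= _; rewrite ?leey//.
  by rewrite (gt_eqF s0) leey.
- move=> x; case: (boolP (x \in N)) => xN.
    have h m : fine (al m (cell m x)) * \1_(~` N) x = 0.
      by rewrite indicE in_setC xN mulr0.
    move: q0; rewrite /lq_bound; case: eqP => [_ _ m|/eqP qy q0 M].
      by rewrite h !mulr_ge0 ?invr_ge0 ?fine_ge0 ?(ltW K0) ?(ltW c0).
    rewrite big1 ?powR_ge0// => l _; rewrite h powR0// gt_eqF// fine_gt0// q0 ltey//.
  have h m : fine (al m (cell m x)) * \1_(~` N) x = fine (al m (cell m x)).
    by rewrite indicE in_setC xN mulr1.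
  rewrite (_ : (fun m => _) = (fun m => fine (al m (cell m x)))); last exact/funext.
  rewrite -mulrA [K * _]mulrC divfK ?gt_eqF//.
  apply: lq; rewrite fineK// ge0_fin_numE// ltey.
  by apply/negP => /eqP h'; move/negP: xN; apply; rewrite inE.
Qed.

(** An infimum over a box depends only on the cell, which makes it measurable in the base point, and
    it lies below [G] on the whole box. Any larger number exceeds [G] at some point of the box,
    which later yields [dominates]. *)
Definition boxinf (G : n.-tuple R * R -> \bar R) m j : \bar R := ereal_inf (G @` wbox m j).

Lemma boxinf_ge0 G m j : (forall z, 0 < z.2 -> (0 <= G z)%E) -> (0 <= boxinf G m j)%E.
Proof. by move=> G0; apply: le_ereal_inf_tmp => _ [z zj <-]; apply: G0; exact: wbox_pos zj. Qed.

Lemma boxinf_le G m j z : wbox m j z -> (boxinf G m j <= G z)%E.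
Proof. by move=> zj; apply: ge_ereal_inf; exists (G z) => //; exists z. Qed.

Lemma intH_prod (S : set R) (f : n.-tuple R -> \bar R) : measurable S -> S `<=` [set t | 0 < t] ->
  measurable_fun [set: n.-tuple R] f -> (forall y, 0 <= f y)%E ->
  intH (fun z => (\1_S z.2)%:E * f z.1)%E = (@lebesgue_measure R S * int_Rn f)%E.
Proof.
move=> mS Spos mf f0; rewrite /intH.
under eq_integral => t _ do rewrite /= int_RnZ//.
rewrite integral_indic_mulr//; last exact: int_Rn_ge0.
by congr (lebesgue_measure _ * _)%E; apply/setIidPl => t /Spos; rewrite /= in_itv/= andbT.
Qed.

Lemma winlev_inj M : injective (winlev M).
Proof. by rewrite /winlev => i j h; clear -h; lia. Qed.

(** The layers are disjoint, so at each point at most one term contributes; the factor (a2 - 1)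
    [scale] is the thickness of a layer. *)
Lemma layers_le_intH (d : int -> n.-tuple R -> \bar R) (F : n.-tuple R * R -> \bar R) M :
  (forall m, measurable_fun [set: n.-tuple R] (d m)) -> (forall m y, 0 <= d m y)%E ->
  (forall z, 0 <= F z)%E -> (forall z, 0 < z.2 -> (d (lev z.2) z.1 <= F z)%E) ->
  (\sum_(l < (2 * M).+1) ((a2 - 1) * scale (winlev M l))%:E * int_Rn (d (winlev M l)) <= intH F)%E.
Proof.
move=> md d0 F0 dF.
pose S m : set R := `[scale m, scale (m + 1)[%classic.
have SE m : @lebesgue_measure R (S m) = ((a2 - 1) * scale m)%:E.
  rewrite lebesgue_measure_itv/= lte_fin scaleS ltr_pMl ?scale_gt0// aperture_gt1 -EFinB.
  by congr EFin; ring.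
have Spos m : S m `<=` [set t | 0 < t].
  by move=> t; rewrite /S/= in_itv/= => /andP[h _]; exact: lt_le_trans (scale_gt0 _) h.
have dE m : (((a2 - 1) * scale m)%:E * int_Rn (d m) =
    intH (fun z => (\1_(S m) z.2)%:E * d m z.1))%E.
  by rewrite intH_prod ?SE//; exact: measurable_itv.
under eq_bigr do rewrite dE.
rewrite -(functional_sum (@intHZ R n) (@intHD R n)); last 2 first.
- move=> l; apply: emeasurable_funM; last exact: measurableT_comp (md _) measurable_fst.
  apply/measurable_EFinP; apply: measurableT_comp measurable_snd.
  by apply: measurable_indic; exact: measurable_itv.
- by move=> l z; rewrite mule_ge0// lee_fin.
apply: intH_le => z; first by apply: sume_ge0 => l _; rewrite mule_ge0// lee_fin.
have zS m : S m z.2 -> 0 < z.2 /\ lev z.2 = m.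
  rewrite /S/= in_itv/= => h; split; last exact: lev_eq.
  by case/andP: h => h _; exact: lt_le_trans (scale_gt0 _) h.
have S0 m : ~ S m z.2 -> ((\1_(S m) z.2)%:E * d m z.1 = 0)%E.
  by move=> h; rewrite indicE memNset// mul0e.
have [[l zl]|h] := pselect (exists l : 'I_(2 * M).+1, S (winlev M l) z.2).
  rewrite (bigD1 l)//= big1 ?adde0.
    have [z0 zE] := zS _ zl.
    by rewrite indicE mem_set// mul1e -zE; exact: dF.
  move=> i il; apply: S0 => zi; have [_ E1] := zS _ zl; have [_ E2] := zS _ zi.
  move/eqP: il; apply; apply/val_inj/(@winlev_inj M); by rewrite -E1 -E2.
by rewrite big1// => l _; apply: S0 => zl; apply: h; exists l.
Qed.

Lemma int_Rn_indicZ (A : set (n.-tuple R)) (c : \bar R) : measurable A -> (0 <= c)%E ->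
  int_Rn (fun y => (\1_A y)%:E * c)%E = (leb_n A * c)%E.
Proof.
move=> mA c0; rewrite int_RnE; last 2 first.
- by apply: emeasurable_funM => //; apply/measurable_EFinP; exact: measurable_indic.
- by move=> x; rewrite mule_ge0// lee_fin.
under eq_integral do rewrite muleC.
have mi : measurable_fun [set: n.-tuple R] (fun y => (\1_A y)%:E : \bar R).
  by apply/measurable_EFinP; exact: measurable_indic.
rewrite ge0_integralZl//.
by rewrite -int_RnE// muleC.
Qed.

Lemma poweR_inv_le (s K : R) (X : \bar R) : 0 < s -> (0 <= X)%E -> 0 < K ->
  (poweR X s^-1 <= K%:E)%E -> (X <= (K `^ s)%:E)%E.
Proof.
move=> s0 X0 K0 h; rewrite -[X]poweRe1// -(@mulVf _ s) ?gt_eqF// poweRrM -poweR_EFin.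
apply: gt0_ler_poweR => //; first exact: ltW.
  by rewrite in_itv/= leey andbT poweR_ge0.
by rewrite in_itv/= leey andbT lee_fin ltW.
Qed.

(** Lower bound for the mass of a box under dy dt / t^(n+1), the measure of the area functional. *)
Definition box_density : R := (a1 / (6 * n%:R)) ^+ n * (a2 - 1) / a2 ^+ n.+1.

Lemma box_density_gt0 : 0 < box_density.
Proof.
rewrite /box_density divr_gt0 ?exprn_gt0// mulr_gt0 ?subr_gt0 ?aperture_gt1//.
by rewrite exprn_gt0// divr_gt0// mulr_gt0.
Qed.

Lemma box_density_le m :
  box_density <= (a2 - 1) * scale m * (side m ^+ n / scale (m + 1) ^+ n.+1).
Proof.
have s0 := scale_gt0 m; have /andP[_ h] := side_scale m.
have h1 : a1 / (6 * n%:R) * scale m <= side m.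
  rewrite (_ : _ * _ = (a1 / n%:R * scale m) / 6); last by field; rewrite gt_eqF.
  by rewrite ler_pdivrMr//; lra.
have h2 : (a1 / (6 * n%:R)) ^+ n * scale m ^+ n <= side m ^+ n.
  rewrite -exprMn lerXn2r// nnegrE; last by rewrite ltW// side_gt0.
  by apply: mulr_ge0; rewrite ?(ltW s0)// divr_ge0 ?(ltW ha1)// mulr_ge0// ltW.
rewrite /box_density scaleS (exprMn _ a2) (exprS (scale m)).
rewrite (_ : (a2 - 1) * _ * _ = side m ^+ n / scale m ^+ n * (a2 - 1) / a2 ^+ n.+1); last first.
  by field; rewrite !expf_neq0 ?gt_eqF.
rewrite ler_wpM2r ?invr_ge0 ?exprn_ge0 ?(ltW a20)//.
rewrite ler_wpM2r ?subr_ge0 ?(ltW aperture_gt1)//.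
by rewrite ler_pdivlMr// exprn_gt0.
Qed.

(** At every level the cone at x contains the box over the cell of x, and these boxes are
    disjoint. *)
Lemma cone_integral_ge (t : R) (G : n.-tuple R * R -> \bar R) x M : 0 < t ->
  (forall z, 0 < z.2 -> (0 <= G z)%E) ->
  (box_density%:E * \sum_(l < (2 * M).+1) poweR (boxinf G (winlev M l) (cell (winlev M l) x)) t <=
   intH (fun z => (\1_(cone x) z)%:E * (poweR (G z) t * ((z.2 ^+ n.+1)^-1)%:E)))%E.
Proof.
move=> t0 G0.
pose A m := cell m @^-1` [set cell m x].
pose c m : \bar R := (poweR (boxinf G m (cell m x)) t * ((scale (m + 1) ^+ n.+1)^-1)%:E)%E.
have c0 m : (0 <= c m)%E by rewrite mule_ge0 ?poweR_ge0// lee_fin invr_ge0 exprn_ge0// ltW// scale_gt0.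
pose d m y : \bar R := ((\1_(A m) y)%:E * c m)%E.
apply: le_trans (@layers_le_intH d _ M _ _ _ _).
- rewrite ge0_sume_distrr; last by move=> l _; exact: poweR_ge0.
  apply: lee_sum => l _; set m := winlev M l.
  rewrite int_Rn_indicZ//; last exact: measurable_cell.
  rewrite leb_n_cell /c -/m; set X := poweR _ _.
  rewrite (muleCA _ X) (muleCA _ X) [leLHS]muleC lee_wpmul2l ?poweR_ge0//.
  by rewrite -!EFinM lee_fin; exact: box_density_le.
- move=> m; apply: emeasurable_funM => //; apply/measurable_EFinP; apply: measurable_indic.
  exact: measurable_cell.
- by move=> m y; rewrite mule_ge0// lee_fin.
- move=> z; rewrite indicE; case: (boolP (z \in _)) => [/set_mem[z0 _]|_]; last by rewrite mul0e.
  by rewrite mul1e mule_ge0 ?poweR_ge0// lee_fin invr_ge0 exprn_ge0// ltW.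
- move=> z z0; rewrite /d indicE; case: (boolP (z.1 \in _)) => [/set_mem/= zA|_]; last first.
    rewrite mul0e mule_ge0 ?lee_fin// mule_ge0 ?poweR_ge0// lee_fin invr_ge0 exprn_ge0// ltW//.
  have zb : wbox (lev z.2) (cell (lev z.2) x) z by rewrite -zA; exact: wbox_mem.
  have zc : cone x z by apply: wbox_cone zb.
  rewrite indicE mem_set// !mul1e; apply: lee_pmul; rewrite ?poweR_ge0//.
  + by rewrite lee_fin invr_ge0 exprn_ge0// ltW// scale_gt0.
  + apply: gt0_ler_poweR; rewrite ?(ltW t0)// ?in_itv/= ?leey ?andbT.
    * exact: boxinf_ge0.
    * exact: G0.
    * exact: boxinf_le.
  + rewrite lee_fin lef_pV2 ?posrE ?exprn_gt0 ?scale_gt0//.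
    by rewrite lerXn2r// ?nnegrE ?(ltW z0) ?(ltW (scale_gt0 _))//; case/andP: (levP z0) => _ /ltW.
Qed.

(** The majorant is the discrete area function (c S)^(1/t), with S the sum over all levels and c the
    [box_density], which [cone_integral_ge] puts below the area function of [G]. The constant
    c^(-1/t) undoes this factor. *)
Lemma certificate_exists_AA (s t : R) : 0 < s -> 0 < t ->
  exists2 C : R, 0 < C & forall K G, 0 < K -> (forall z, 0 < z.2 -> (0 <= G z)%E) ->
    (tent_norm s%:E t%:E G <= K%:E)%E ->
    (forall m j, (boxinf G m j < +oo)%E) /\
    exists E g, certificate (3 / 4) s%:E t%:E (C * K) (fun m j => fine (boxinf G m j)) E g.
Proof.
move=> s0 t0; have k0 := box_density_gt0.
exists (box_density `^ (- t^-1)); first by rewrite powR_gt0.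
move=> K G K0 G0; rewrite /tent_norm/= => Gle.
pose I x := intH (fun z => (\1_(cone x) z)%:E * (poweR (G z) t * ((z.2 ^+ n.+1)^-1)%:E))%E.
pose A M x := (\sum_(l < (2 * M).+1) poweR (boxinf G (winlev M l) (cell (winlev M l) x)) t)%E.
pose S x := ereal_sup (range (fun M => A M x)).
have A0 M x : (0 <= A M x)%E by apply: sume_ge0 => l _; exact: poweR_ge0.
have AS M x : (A M x <= S x)%E by apply: ereal_sup_ubound; exists M.
have S0 x : (0 <= S x)%E by apply: le_trans (AS 0%N x).
have SI x : (box_density%:E * S x <= I x)%E.
  rewrite -lee_pdivlMl//; apply: ge_ereal_sup => _ [M _ <-]; rewrite lee_pdivlMl//.
  exact: cone_integral_ge.
pose L x := poweR (box_density%:E * S x)%E t^-1.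
have bS m x : (poweR (boxinf G m (cell m x)) t <= S x)%E.
  apply: le_trans (AS `|m|%N x).
  by apply: (winsum_ge m (b := fun m => poweR (boxinf G m (cell m x)) t)) => m'; exact: poweR_ge0.
apply: (@certificate_of_majorant s _ K _ _ L) => //.
- by rewrite powR_gt0.
- apply: measurableT_comp (measurable_poweR _) _; apply: emeasurable_funM => //.
  apply: measurable_ereal_sup => M; apply: emeasurable_sum => l.
  apply: measurableT_comp (measurable_poweR _) _.
  apply: (@measurable_cellwise _ _ _ (cell (winlev M l))); first exact: measurable_cell.
  by move=> x y ->.
- by move=> x; exact: poweR_ge0.
- apply: (@le_trans _ _ (int_Rn (fun x => poweR (I x) (s / t)))).
    apply: int_Rn_le => x; first exact: poweR_ge0.
    rewrite /L -poweRrM mulrC; apply: gt0_ler_poweR; rewrite ?divr_ge0 ?(ltW s0) ?(ltW t0)//.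
    + by rewrite in_itv/= leey andbT mule_ge0// lee_fin ltW.
    + rewrite in_itv/= leey andbT; apply: le_trans (SI x).
      by rewrite mule_ge0// lee_fin ltW.
  apply: poweR_inv_le => //.
  by apply: int_Rn_ge0 => x; exact: poweR_ge0.
- move=> x m Lx.
  have : (box_density%:E * S x < +oo)%E by apply: lty_poweRy Lx; rewrite gt_eqF ?invr_gt0.
  rewrite -lte_pdivlMl// gt0_muley ?lte_fin ?invr_gt0// => Sx.
  by apply: (@lty_poweRy _ _ t); rewrite ?gt_eqF//; exact: le_lt_trans (bS m x) Sx.
- move=> x l Ll M; rewrite /=.
  have l0 : 0 <= l by rewrite -lee_fin -Ll poweR_ge0.
  have kS : (box_density%:E * S x = (l `^ t)%:E)%E.
    rewrite -poweR_EFin -Ll /L -poweRrM mulVf ?gt_eqF// poweRe1//.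
    by rewrite mule_ge0// lee_fin ltW.
  have SE : (S x = (box_density^-1 * l `^ t)%:E)%E.
    by rewrite EFinM -kS muleA -EFinM mulVf ?gt_eqF// mul1e.
  rewrite powRM ?powR_ge0// -powRrM mulNr mulVf ?gt_eqF// powR_inv1 ?(ltW k0)//.
  rewrite -lee_fin -SE -sumEFin; apply: le_trans (AS M x).
  apply: lee_sum => i _; rewrite -poweR_EFin fineK// ge0_fin_numE ?boxinf_ge0//.
  apply: (@lty_poweRy _ _ t); rewrite ?gt_eqF//; apply: le_lt_trans (bS _ x) _.
  by rewrite SE ltry.
Qed.

Lemma wbox_scale m x : wbox m (cell m x) (x, scale m).
Proof.
by split => //=; rewrite lexx/= scaleS ltr_pMl ?scale_gt0// aperture_gt1.
Qed.

Lemma certificate_exists_C (s : R) : 0 < s ->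
  forall K G, 0 < K -> (forall z, 0 < z.2 -> (0 <= G z)%E) ->
    (tent_norm s%:E +oo%E G <= K%:E)%E ->
    (forall m j, (boxinf G m j < +oo)%E) /\
    exists E g, certificate (3 / 4) s%:E +oo%E (1 * K) (fun m j => fine (boxinf G m j)) E g.
Proof.
move=> s0 K G K0 G0; rewrite /tent_norm/= => Gle.
(* Levels are listed by their codes, as a measurable supremum is taken along the natural numbers; a
   code of no level contributes 0. *)
pose b (k : nat) x : \bar R := if unpickle k is Some m then boxinf G m (cell m x) else 0%E.
pose L x := ereal_sup (range (fun k => b k x)).
have bL m x : (boxinf G m (cell m x) <= L x)%E.
  by apply: ereal_sup_ubound; exists (pickle m) => //; rewrite /b pickleK.
have L0 x : (0 <= L x)%E by apply: le_trans (bL 0 x); exact: boxinf_ge0.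
apply: (@certificate_of_majorant s _ K _ _ L) => //.
- apply: measurable_ereal_sup => k; rewrite /b; case: (unpickle k) => [m|]//.
  apply: (@measurable_cellwise _ _ _ (cell m)); first exact: measurable_cell.
  by move=> x y ->.
- apply: (@le_trans _ _ (int_Rn (fun x => poweR (ereal_sup (G @` cone x)) s))).
    apply: int_Rn_le => x; first exact: poweR_ge0.
    have LG : (L x <= ereal_sup (G @` cone x))%E.
      have h m : (boxinf G m (cell m x) <= ereal_sup (G @` cone x))%E.
        apply: (@le_trans _ _ (G (x, scale m))); first exact: boxinf_le (wbox_scale m x).
        apply: ereal_sup_ubound; exists (x, scale m) => //.
        exact: wbox_cone (wbox_scale m x).
      apply: ge_ereal_sup => _ [k _ <-]; rewrite /b; case: (unpickle k) => [m|] //.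
      by apply: le_trans (h 0); exact: boxinf_ge0.
    apply: gt0_ler_poweR; rewrite ?(ltW s0)// in_itv/= leey andbT//.
    exact: le_trans (L0 x) LG.
  apply: poweR_inv_le => //.
  by apply: int_Rn_ge0 => x; exact: poweR_ge0.
- by move=> x m; exact: le_lt_trans (bL m x).
- move=> x l Ll; rewrite /lq_bound/= => m; rewrite mul1r -lee_fin -Ll fineK//.
  rewrite ge0_fin_numE ?boxinf_ge0//; apply: le_lt_trans (bL m x) _.
  by rewrite Ll ltry.
Qed.

(** Each coordinate moves by less than a2 [scale m0] inside B(y, s) and by less than [side m0]
    inside the cell, together less than 3 a2 [scale m0]; the factor n passes from coordinates to the
    distance. *)
Lemma tent_cell m0 (y0 y : n.-tuple R) (s : R) : cell m0 y = cell m0 y0 -> 0 < s ->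
  s <= scale (m0 + 1) -> tent (eball y0 (3 * n%:R * a2 * scale m0)) (y, s).
Proof.
move=> yy s0 ss; split => //= w wy.
have c0 := scale_gt0 m0; have a2' := aperture_gt1.
have ca : scale m0 < a2 * scale m0 by rewrite ltr_pMl.
apply: edist_lt => //; first by rewrite !mulr_gt0.
move=> i; rewrite (_ : _ / _ = 3 * (a2 * scale m0)); last by field; rewrite gt_eqF.
have h1 := le_lt_trans (coord_le_edist w y i) wy.
have h2 := cell_close i yy.
have h3 : side m0 < scale m0.
  have /andP[h _] := side_scale m0; have g0 := side_gt0 m0.
  suff : a1 / n%:R * scale m0 <= scale m0 by lra.
  rewrite ler_piMl ?(ltW c0)// ler_pdivrMr// mul1r (le_trans (ltW a11))//.
  by rewrite ler1n.
rewrite scaleS in ss.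
have := ler_normD (tnth w i - tnth y i) (tnth y i - tnth y0 i).
by rewrite addrA subrK; lra.
Qed.

Lemma leb_n_eball_le (c : n.-tuple R) (r : R) : 0 < r ->
  (leb_n (eball c r) <= ((2 * r) ^+ n)%:E)%E.
Proof.
move=> r0; rewrite -(leb_n_cube c r0); apply: le_measure; rewrite ?inE.
- exact: measurable_eball.
- exact: measurable_cube.
- by move=> y; exact: edist_lt_cube.
Qed.

Definition lower_levels (G : n.-tuple R * R -> \bar R) (t : R) m0 m (x : n.-tuple R) : \bar R :=
  if m <= m0 then poweR (boxinf G m (cell m x)) t else 0%E.

Lemma lower_levels_ge0 G t m0 m x : (0 <= lower_levels G t m0 m x)%E.
Proof. by rewrite /lower_levels; case: ifP => // _; exact: poweR_ge0. Qed.

Lemma measurable_lower_levels G t m0 m : measurable_fun [set: n.-tuple R] (lower_levels G t m0 m).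
Proof.
rewrite /lower_levels; case: (m <= m0) => //; apply: measurableT_comp (measurable_poweR _) _.
apply: (@measurable_cellwise _ _ _ (cell m)); first exact: measurable_cell.
by move=> x y ->.
Qed.

(** The first factor comes from dt / t >= (a2 - 1) / a2 on one layer, the second bounds the volume
    of the ball in [tent_cell] relative to the cell. *)
Definition carleson_const : R := a2 / (a2 - 1) * (36 * n%:R ^+ 2 * a2 / a1) ^+ n.

Lemma carleson_const_gt0 : 0 < carleson_const.
Proof.
rewrite mulr_gt0 ?divr_gt0 ?subr_gt0 ?aperture_gt1// exprn_gt0// divr_gt0// !mulr_gt0//.
Qed.

Lemma cell_carleson (t K : R) G m0 j M : 0 < t -> 0 < K -> (forall z, 0 < z.2 -> (0 <= G z)%E) ->
  (tent_norm +oo%E t%:E G <= K%:E)%E ->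
  (int_Rn (fun x => (\1_(cell m0 @^-1` [set j]) x)%:E *
     \sum_(l < (2 * M).+1) lower_levels G t m0 (winlev M l) x) <=
   (carleson_const * K `^ t * side m0 ^+ n)%:E)%E.
Proof.
move=> t0 K0 G0; rewrite /tent_norm/= => Gle.
have [y0 yj] : exists y0, cell m0 y0 = j by apply: gcell_exists; exact: side_gt0.
set Q := _ @^-1` _; have mQ : measurable Q by exact: measurable_cell.
have c0 := scale_gt0 m0; have a2' := aperture_gt1.
set rho := 3 * n%:R * a2 * scale m0; have rho0 : 0 < rho by rewrite !mulr_gt0.
have [b bE hb] := leb_n_eball y0 rho0.
have b0 : 0 < b by apply: lt_le_trans hb; rewrite exprn_gt0// divr_gt0// mulr_gt0.
have bD : b <= (36 * n%:R ^+ 2 * a2 / a1) ^+ n * side m0 ^+ n.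
  have := leb_n_eball_le y0 rho0; rewrite bE lee_fin => /le_trans; apply.
  have D0 : 0 < 36 * n%:R ^+ 2 * a2 / a1 by rewrite divr_gt0// !mulr_gt0// exprn_gt0.
  rewrite -exprMn lerXn2r ?nnegrE ?(ltW (mulr_gt0 D0 (side_gt0 m0))) ?(ltW (mulr_gt0 _ rho0))//.
  have /andP[_ h] := side_scale m0.
  rewrite (_ : 2 * rho = 6 * n%:R ^+ 2 * a2 / a1 * (a1 / n%:R * scale m0)); last first.
    by rewrite /rho; field; rewrite !gt_eqF.
  rewrite (_ : 36 * _ * _ / _ * _ = 6 * n%:R ^+ 2 * a2 / a1 * (6 * side m0)); last by ring.
  by rewrite ler_wpM2l ?(ltW h)// divr_ge0 ?mulr_ge0 ?exprn_ge0 ?(ltW a20) ?(ltW ha1).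
pose F z := ((\1_(tent (eball y0 rho)) z)%:E * (poweR (G z) t * (z.2^-1)%:E))%E.
have F0 z : (0 <= F z)%E.
  rewrite /F indicE; case: (boolP (z \in _)) => [/set_mem[z0 _]|_]; last by rewrite mul0e.
  by rewrite mul1e mule_ge0 ?poweR_ge0// lee_fin invr_ge0 ltW.
have IF : (intH F <= (b * K `^ t)%:E)%E.
  rewrite EFinM -lee_pdivrMl//; apply: poweR_inv_le => //.
    by rewrite mule_ge0 ?intH_ge0// lee_fin invr_ge0 ltW.
  apply: le_trans Gle; apply: ereal_sup_ubound; exists y0, y0, rho; split => //.
  by split; rewrite ?bE// /eball/= edistxx.
pose e m y := ((\1_Q y)%:E * lower_levels G t m0 m y)%E.
have me m : measurable_fun [set: n.-tuple R] (e m).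
  by apply: emeasurable_funM (measurable_lower_levels _ _ _ _); apply/measurable_EFinP; exact: measurable_indic.
have e0 m y : (0 <= e m y)%E by rewrite mule_ge0 ?lee_fin ?lower_levels_ge0.
have h : (\sum_(l < (2 * M).+1) ((a2 - 1) * scale (winlev M l))%:E *
    int_Rn (fun y => ((scale (winlev M l + 1))^-1)%:E * e (winlev M l) y) <= intH F)%E.
  apply: (@layers_le_intH (fun m y => ((scale (m + 1))^-1)%:E * e m y)%E) => //.
  - by move=> m; exact: emeasurable_funM.
  - by move=> m y; rewrite mule_ge0// lee_fin invr_ge0 ltW// scale_gt0.
  move=> z z0; rewrite /e indicE; case: (boolP (z.1 \in Q)) => [/set_mem/= zQ|_]; last first.
    by rewrite mul0e mule0.
  rewrite mul1e /lower_levels; case: ifPn => lm; last by rewrite mule0.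
  have /andP[_ zs] := levP z0.
  rewrite /F indicE mem_set; last first.
    rewrite [z]surjective_pairing; apply: tent_cell => //; first by rewrite yj.
    by apply: le_trans (ltW zs) _; apply: scale_le; rewrite lerD2r.
  rewrite mul1e muleC; apply: lee_pmul; rewrite ?poweR_ge0//.
  - by rewrite lee_fin invr_ge0 ltW// scale_gt0.
  - apply: gt0_ler_poweR; rewrite ?(ltW t0)// ?in_itv/= ?leey ?andbT.
    + exact: boxinf_ge0.
    + exact: G0.
    + by apply: boxinf_le; exact: wbox_mem.
  - by rewrite lee_fin lef_pV2 ?posrE ?scale_gt0// ltW.
have termE m : (((a2 - 1) * scale m)%:E * int_Rn (fun y => ((scale (m + 1))^-1)%:E * e m y) =
    ((a2 - 1) / a2)%:E * int_Rn (e m))%E.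
  rewrite int_RnZ//; last by rewrite invr_ge0 ltW// scale_gt0.
  rewrite muleA -EFinM scaleS; congr (_%:E * _)%E; field.
  by rewrite !gt_eqF// scale_gt0.
rewrite (eq_bigr _ (fun l _ => termE _)) -ge0_sume_distrr in h; last first.
  by move=> l _; exact: int_Rn_ge0.
have k0 : 0 < (a2 - 1) / a2 by rewrite divr_gt0// subr_gt0.
rewrite (_ : (fun x => _) = (fun x => \sum_(l < (2 * M).+1) e (winlev M l) x)%E); last first.
  by apply/funext => x; rewrite ge0_sume_distrr// => l _; exact: lower_levels_ge0.
rewrite (functional_sum (@int_RnZ R n) (@int_RnD R n))//.
move: (le_trans h IF); rewrite -lee_pdivlMl// => /le_trans; apply.
rewrite -EFinM lee_fin /carleson_const.
have i0 : 0 <= ((a2 - 1) / a2)^-1 by rewrite invr_ge0 ltW.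
apply: le_trans (ler_wpM2l i0 (ler_wpM2r (powR_ge0 K t) bD)) _.
by rewrite invf_div le_eqVlt; apply/orP; left; apply/eqP; ring.
Qed.

(** Chebyshev's inequality for each window; the exceptional sets increase with the window, so the
    bound survives the supremum. *)
Lemma chebyshev_sup_le (f : nat -> n.-tuple R -> \bar R) (Q : set (n.-tuple R)) (T B : R) :
  measurable Q -> (forall M, measurable_fun [set: n.-tuple R] (f M)) ->
  (forall M x, 0 <= f M x)%E -> (forall x, {homo f^~ x : M M' / (M <= M')%N >-> (M <= M')%E}) ->
  0 < T -> (forall M, (int_Rn (fun x => (\1_Q x)%:E * f M x) <= (T * B)%:E)%E) ->
  (leb_n (Q `&` [set x | T%:E < ereal_sup (range (f^~ x))]%E) <= B%:E)%E.
Proof.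
move=> mQ mf f0 fnd T0 fB.
pose F M := Q `&` [set x | (T%:E < f M x)%E].
have mF M : measurable (F M).
  by apply: measurableI => //; rewrite -[X in measurable X]setTI; exact: emeasurable_fun_o_infty.
have -> : Q `&` [set x | (T%:E < ereal_sup (range (f^~ x)))%E] = \bigcup_M F M.
  apply/seteqP; split => [x [Qx /ereal_sup_gt[_ [M _ <-] h]]|x [M _ [Qx h]]]; first by exists M.
  by split => //; apply: (lt_le_trans h); apply: ereal_sup_ubound; exists M.
have Fnd : nondecreasing_seq F.
  move=> M M' MM; rewrite subsetEset => x [Qx h]; split => //.
  exact: lt_le_trans h (fnd x _ _ MM).
have FB M : (leb_n (F M) <= B%:E)%E.
  rewrite -(lee_pmul2l _ (x := T%:E)) ?lte_fin// -EFinM; apply: le_trans (fB M).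
  rewrite muleC -int_Rn_indicZ ?lee_fin ?(ltW T0)//.
  apply: int_Rn_le => x; first by rewrite mule_ge0 ?lee_fin// ltW.
  rewrite indicE; case: (boolP (x \in F M)) => [/set_mem[Qx h]|_]; last by rewrite mul0e mule_ge0 ?lee_fin.
  by rewrite indicE mem_set// !mul1e ltW.
have mU : measurable (\bigcup_M F M) by exact: bigcup_measurable.
have h := nondecreasing_cvg_mu (mu := @leb_n R n) mF mU Fnd.
rewrite -(cvg_lim _ h)//; apply: lime_le; first by apply/cvg_ex; eexists; exact: h.
by apply: nearW => M; exact: FB.
Qed.

Lemma certificate_exists_B (t : R) : 0 < t ->
  exists2 C : R, 0 < C & forall K G, 0 < K -> (forall z, 0 < z.2 -> (0 <= G z)%E) ->
    (tent_norm +oo%E t%:E G <= K%:E)%E ->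
    (forall m j, (boxinf G m j < +oo)%E) /\
    exists E g, certificate (3 / 4) +oo%E t%:E (C * K) (fun m j => fine (boxinf G m j)) E g.
Proof.
move=> t0; have D0 := carleson_const_gt0.
exists ((4 * carleson_const) `^ t^-1); first by apply: powR_gt0; rewrite mulr_gt0.
move=> K G K0 G0 Gle.
(* Four times the Carleson bound, so that the exceptional set takes at most 1/4 of each cell. *)
set T := 4 * carleson_const * K `^ t.
have Ks : 0 < K `^ t by rewrite powR_gt0.
have C4 : 0 < 4 * carleson_const by rewrite mulr_gt0.
have T0 : 0 < T by exact: mulr_gt0.
pose A m0 M x := (\sum_(l < (2 * M).+1) lower_levels G t m0 (winlev M l) x)%E.
have A0 m0 M x : (0 <= A m0 M x)%E by apply: sume_ge0 => l _; exact: lower_levels_ge0.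
pose S m0 x := ereal_sup (range (fun M => A m0 M x)).
have AS m0 M x : (A m0 M x <= S m0 x)%E by apply: ereal_sup_ubound; exists M.
have mA m0 M : measurable_fun [set: n.-tuple R] (A m0 M).
  by apply: emeasurable_sum => l; exact: measurable_lower_levels.
have mS m0 : measurable_fun [set: n.-tuple R] (S m0) by apply: measurable_ereal_sup.
pose E m0 := [set x | (S m0 x <= T%:E)%E].
have mE m0 : measurable (E m0).
  by rewrite -[X in measurable X]setTI; exact: emeasurable_fun_infty_c.
have EQ m0 j : ((3 / 4)%:E * leb_n (cell m0 @^-1` [set j]) <= leb_n (E m0 `&` cell m0 @^-1` [set j]))%E.
  set Q := _ @^-1` _; have mQ : measurable Q by exact: measurable_cell.
  have QE : leb_n Q = (side m0 ^+ n)%:E by exact: leb_n_cell.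
  have h : (leb_n (Q `&` [set x | T%:E < S m0 x]%E) <= (1 / 4 * side m0 ^+ n)%:E)%E.
    apply: chebyshev_sup_le => //.
    - by move=> x M M' MM; exact: (winsum_ndW (fun m => lower_levels_ge0 G t m0 m x) MM).
    - move=> M; apply: le_trans (cell_carleson m0 j M t0 K0 G0 Gle) _.
      by rewrite lee_fin /T le_eqVlt; apply/orP; left; apply/eqP; field.
  have mS' : measurable (Q `&` [set x | T%:E < S m0 x]%E).
    by apply: measurableI => //; rewrite -[X in measurable X]setTI; exact: emeasurable_fun_o_infty.
  have : (leb_n Q <= leb_n (E m0 `&` Q) + (1 / 4 * side m0 ^+ n)%:E)%E.
    apply: (@le_trans _ _ (leb_n ((E m0 `&` Q) `|` (Q `&` [set x | T%:E < S m0 x]%E)))).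
      apply: le_measure; rewrite ?inE//; first by apply: measurableU => //; exact: measurableI.
      move=> x Qx; have [h'|h'] := leP (S m0 x) T%:E; [by left|by right].
    apply: le_trans (measureU2 _ _ _) _ => //; first exact: measurableI.
    by rewrite leeD2l.
  rewrite QE -leeBlDr// => /(le_trans _); apply.
  by rewrite -EFinM -EFinB lee_fin; lra.
have bS m m0 x : m <= m0 -> (poweR (boxinf G m (cell m x)) t <= S m0 x)%E.
  move=> mm; apply: le_trans (AS m0 `|m|%N x).
  have := winsum_ge m (b := fun m => lower_levels G t m0 m x) (fun m => lower_levels_ge0 _ _ _ _ _).
  by rewrite {1}/lower_levels mm.
have bfin m j : (boxinf G m j < +oo)%E.
  have [x [Ex xj]] : exists x, E m x /\ cell m x = j.
    apply: contrapT => h; have := EQ m j.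
    rewrite (_ : E m `&` _ = set0) ?measure0; last first.
      by apply/seteqP; split => // x [Ex xj]; apply: h; exists x.
    rewrite leb_n_cell -EFinM lee_fin leNgt mulr_gt0 ?exprn_gt0 ?side_gt0//; lra.
  rewrite -xj; apply: (@lty_poweRy _ _ t); rewrite ?gt_eqF//.
  by apply: le_lt_trans (bS m m x (lexx _)) _; apply: le_lt_trans Ex _; rewrite ltry.
split=> //; exists E, (fun=> 1); split => //.
move=> x M; rewrite /= mulr1.
have -> : ((4 * carleson_const) `^ t^-1 * K) `^ t = T.
  rewrite powRM ?powR_ge0 ?(ltW K0)// -powRrM mulVf ?gt_eqF// powRr1// ltW// mulr_gt0//.
have [[l0 El0]|h] := pselect (exists l : 'I_(2 * M).+1, x \in E (winlev M l)); last first.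
  rewrite big1 ?(ltW T0)// => l _; rewrite indicE.
  case: (boolP (x \in _)) => [xl|_]; first by case: h; exists l.
  by rewrite mulr0 powR0// gt_eqF.
(* [E m0] controls only the levels up to [m0]. Among the levels of the window whose set contains x
   the coarsest is chosen, which has the smallest index: all the others are finer, so its bound
   covers the whole sum. *)
case: (arg_minnP (P := fun l : 'I_(2 * M).+1 => x \in E (winlev M l)) (fun l => nat_of_ord l) El0) => l1 El1 lmin.
rewrite -lee_fin; apply: (@le_trans _ _ (A (winlev M l1) M x)); last first.
  by apply: le_trans (AS _ _ _) _; move/set_mem: El1.
rewrite -sumEFin; apply: lee_sum => l _; rewrite indicE.
case: (boolP (x \in _)) => [xl|_]; last first.
  by rewrite mulr0 powR0 ?gt_eqF// lower_levels_ge0.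
have ll : winlev M l <= winlev M l1 by have := lmin l xl; rewrite /winlev; clear; lia.
rewrite mulr1 /lower_levels ll -poweR_EFin fineK// ge0_fin_numE ?boxinf_ge0//.
Qed.

Lemma measH_le_set (A B : set (n.-tuple R * R)) : A `<=` B -> (measH A <= measH B)%E.
Proof.
move=> AB; apply: intH_le => z; first by rewrite lee_fin.
rewrite lee_fin !indicE; case: (boolP (z \in A)) => [/set_mem/AB zB|_]; last by rewrite ler0n.
by rewrite mem_set.
Qed.

Lemma certificate_exists_D : forall K G, 0 < K -> (forall z, 0 < z.2 -> (0 <= G z)%E) ->
    (tent_norm +oo%E +oo%E G <= K%:E)%E ->
    (forall m j, (boxinf G m j < +oo)%E) /\
    exists E g, certificate (3 / 4) +oo%E +oo%E (2 * K) (fun m j => fine (boxinf G m j)) E g.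
Proof.
move=> K G K0 G0; rewrite /tent_norm/= => Gle.
(* The factor 2 makes the inequality strict, which provides an essential bound below 2 K. *)
have : (esssupH (@upper R n) G < (2 * K)%:E)%E.
  by apply: le_lt_trans Gle _; rewrite lte_fin; lra.
move=> /ereal_inf_lt[L /= L0 LK].
have bL m j : (boxinf G m j <= L)%E.
  rewrite leNgt; apply/negP => h.
  have : (measH (wbox m j) <= 0)%E.
    rewrite -L0; apply: measH_le_set => z zj; split; first exact: wbox_pos zj.
    exact: lt_le_trans h (boxinf_le _ zj).
  by rewrite measH_wbox lee_fin leNgt wvol_gt0.
have bfin m j : (boxinf G m j < +oo)%E.
  by apply: le_lt_trans (bL m j) _; apply: lt_trans LK _; rewrite ltry.
split => //; exists (fun=> setT), (fun=> 1); split => //.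
- move=> m j; rewrite setTI -[leRHS]mul1e lee_wpmul2r// lee_fin; lra.
- move=> x m; rewrite indicT mulr1 mulr1 -lee_fin fineK ?ge0_fin_numE ?boxinf_ge0//.
  exact: le_trans (bL _ _) (ltW LK).
Qed.

Lemma certificate_exists (p q : \bar R) : (0 < p)%E -> (0 < q)%E ->
  exists2 C : R, 0 < C & forall K G, 0 < K -> (forall z, 0 < z.2 -> (0 <= G z)%E) ->
    (tent_norm p q G <= K%:E)%E ->
    (forall m j, (boxinf G m j < +oo)%E) /\
    exists E g, certificate (3 / 4) p q (C * K) (fun m j => fine (boxinf G m j)) E g.
Proof.
case/exponentP => [s s0 -> _|-> _]; case/exponentP => [t t0 -> _|-> _].
- exact: certificate_exists_AA.
- exists 1; [by []|exact: certificate_exists_C].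
- exact: certificate_exists_B.
- exists 2; [by []|exact: certificate_exists_D].
Qed.

Lemma whitney_avg_ge0 r (h : n.-tuple R * R -> R) z : 0 < z.2 -> (forall w, 0 <= h w) ->
  (0 <= whitney_avg a1 a2 r (fun w => (h w)%:E) z)%E.
Proof.
move=> z0 h0; rewrite /whitney_avg; case: eqP => _; last exact: poweR_ge0.
apply: le_ereal_inf_tmp => M /= M0; rewrite leNgt; apply/negP => Mneg.
have [V V0 VE] := measH_whitney_fin z0.
have : (measH (whitney a1 a2 z) <= 0)%E.
  rewrite -M0; apply: measH_le_set => w wz; split => //.
  by apply: lt_le_trans Mneg _; rewrite lee_fin.
by rewrite VE lee_fin leNgt V0.
Qed.

Definition boxavg r (h : n.-tuple R * R -> R) m j : R :=
  fine (boxinf (whitney_avg a1 a2 r (fun w => (h w)%:E)) m j).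

Lemma boxavg_ge0 r h m j : (forall w, 0 <= h w) -> 0 <= boxavg r h m j.
Proof. by move=> h0; apply/fine_ge0/boxinf_ge0 => z z0; exact: whitney_avg_ge0. Qed.

(** A number above [boxavg] exceeds the Whitney average at some point z of the box, and W(z)
    contains the box; this is [dominates]. *)
Lemma whitney_certificate (p q r : \bar R) : (0 < p)%E -> (0 < q)%E -> (0 < r)%E ->
  exists2 C : R, 0 < C & forall (K : R) (h : n.-tuple R * R -> R), 0 < K ->
    measurable_fun [set: n.-tuple R * R] h -> (forall w, 0 <= h w) ->
    (tent_norm p q (whitney_avg a1 a2 r (fun w => (h w)%:E)) <= K%:E)%E ->
    dominates r h (boxavg r h) /\
    exists E g, certificate (3 / 4) p q (C * K) (boxavg r h) E g.
Proof.
move=> p0 q0 r0; have [C C0 H] := certificate_exists p0 q0.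
exists C => // K h K0 mh h0 /(H _ _ K0)[|bfin cert]; first by move=> z z0; exact: whitney_avg_ge0.
split => // m j l; rewrite -lte_fin fineK; last first.
  by rewrite ge0_fin_numE//; apply: boxinf_ge0 => z z0; exact: whitney_avg_ge0.
move=> /ereal_inf_lt[_ [z zj <-] zl]; apply: (whitney_avg_lt_dominated r0 mh h0 zj _ zl).
rewrite -lte_fin; apply: le_lt_trans zl; apply: whitney_avg_ge0 => //.
exact: wbox_pos zj.
Qed.

Lemma tent_norm_dominated (p q r : \bar R) (k : R) : (0 < p)%E -> (0 < q)%E -> (0 < r)%E -> 0 < k ->
  exists2 C : R, 0 < C & forall (K : R) (h : n.-tuple R * R -> R) a E g, 0 < K ->
    measurable_fun [set: n.-tuple R * R] h -> (forall w, 0 <= h w) ->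
    (forall m j, 0 <= a m j) -> dominates r h a -> certificate k p q K a E g ->
    (tent_norm p q (whitney_avg a1 a2 r (fun w => (h w)%:E)) <= (C * K)%:E)%E.
Proof.
move=> p0 q0 r0 k0; have [Cw Cw0 HW] := whitney_avg_le_shifted r0.
have [C C0 H] := tent_norm_le_certificate p0 q0 k0 Cw0.
exists C => // K h a E g K0 mh h0 a0 dom cert; apply: H cert _ _ => //.
- by move=> z z0; exact: whitney_avg_ge0.
- by move=> x z; exact: HW.
Qed.

(** A uniform reading for all q: with q = [+oo] the gauge sum is 0 or [+oo], so being at most 1
    means that no term exceeds G. *)
Lemma lq_bound_gauge q (u : int -> R) (G : R) : (0 < q)%E -> 0 < G -> (forall m, 0 <= u m) ->
  lq_bound q u G <-> forall M, (\sum_(l < (2 * M).+1) gauge q (u (winlev M l) / G) <= 1)%E.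
Proof.
move=> q0 G0 u0; rewrite /lq_bound; case/exponentP: q0 => [t t0 -> _|-> _] /=.
  have e M : (\sum_(l < (2 * M).+1) gauge t%:E (u (winlev M l) / G) =
      ((\sum_(l < (2 * M).+1) u (winlev M l) `^ t) / G `^ t)%:E)%E.
    rewrite mulr_suml -sumEFin; apply: eq_bigr => l _; rewrite gauge_fin.
    by rewrite powRM ?invr_ge0 ?(ltW G0)// -[G^-1]powR_inv1 ?(ltW G0)// -powRrM mulN1r powRN.
  by split => h M; have := h M; rewrite e lee_fin ler_pdivrMr ?powR_gt0// mul1r.
split => [h M|h m].
  rewrite big1// => l _; rewrite gauge_inf ler_pdivrMr// mul1r h//.
rewrite leNgt; apply/negP => Gu.
have [l lE] := winlev_mem m; have := h `|m|%N.
rewrite (bigD1 l)//= lE gauge_inf ifN; last by rewrite -ltNge ltr_pdivlMr// mul1r.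
rewrite leNgt => /negP; apply; apply: lt_le_trans (ltry 1) _; apply: leeDl.
by apply: sume_ge0 => i _; exact: gauge_ge0.
Qed.

Lemma lq_bound_ge q (u : int -> R) (G : R) m : (0 < q)%E -> 0 <= G -> (forall m, 0 <= u m) ->
  lq_bound q u G -> u m <= G.
Proof.
move=> q0 G0 u0; rewrite /lq_bound; case/exponentP: q0 => [t t0 -> _|-> _]/= h; last exact: h.
have [l lE] := winlev_mem m; have := h `|m|%N; rewrite (bigD1 l)//= lE => h'.
rewrite leNgt; apply/negP => Gu; move: h'; rewrite leNgt => /negP; apply.
apply: (@lt_le_trans _ _ (u m `^ t)); last by rewrite lerDl sumr_ge0// => i _; exact: powR_ge0.
by apply: gt0_ltr_powR; rewrite ?nnegrE.
Qed.

Lemma lq_bound_zero q (u : int -> R) (G : R) : (0 < q)%E -> 0 <= G -> (forall m, u m = 0) ->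
  lq_bound q u G.
Proof.
move=> q0 G0 u0; rewrite /lq_bound; case/exponentP: q0 => [t t0 -> _|-> _]/= M; last by rewrite u0.
by rewrite big1 ?powR_ge0// => l _; rewrite u0 powR0// gt_eqF.
Qed.

Lemma lq_bound_mul q0 q1 q2 : (0 < q0)%E -> (0 < q1)%E -> (0 < q2)%E ->
  einv q0 = einv q1 + einv q2 ->
  exists2 B : R, 0 < B & forall (u1 u2 : int -> R) (G1 G2 : R), 0 <= G1 -> 0 <= G2 ->
    (forall m, 0 <= u1 m) -> (forall m, 0 <= u2 m) ->
    lq_bound q1 u1 G1 -> lq_bound q2 u2 G2 -> lq_bound q0 (fun m => u1 m * u2 m) (B * (G1 * G2)).
Proof.
move=> q00 q10 q20 qE; have [c c0 hc] := gauge_scale q00 (ltr0Sn R 1).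
exists c^-1; first by rewrite invr_gt0.
move=> u1 u2 G1 G2 G10 G20 u10 u20 h1 h2.
have GG0 : 0 <= c^-1 * (G1 * G2) by rewrite !mulr_ge0// invr_ge0 ltW.
(* The gauges need positive denominators; a zero bound forces its sequence to vanish. *)
have [G1z|G1z] := eqVneq G1 0.
  apply: lq_bound_zero => // m; rewrite (_ : u1 m = 0) ?mul0r//.
  by apply/eqP; rewrite eq_le u10 andbT -G1z; exact: lq_bound_ge h1.
have [G2z|G2z] := eqVneq G2 0.
  apply: lq_bound_zero => // m; rewrite (_ : u2 m = 0) ?mulr0//.
  by apply/eqP; rewrite eq_le u20 andbT -G2z; exact: lq_bound_ge h2.
have G1p : 0 < G1 by rewrite lt_neqAle eq_sym G1z.
have G2p : 0 < G2 by rewrite lt_neqAle eq_sym G2z.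
have e1 := (lq_bound_gauge q10 G1p u10).1 h1; have e2 := (lq_bound_gauge q20 G2p u20).1 h2.
have GG : 0 < c^-1 * (G1 * G2) by rewrite !mulr_gt0// invr_gt0.
apply/(lq_bound_gauge q00 GG) => [m|M]; first exact: mulr_ge0.
rewrite -(lee_pmul2l _ (x := 2%:E)) ?lte_fin// mule1.
apply: le_trans (_ : _ <= 1 + 1)%E _; last by rewrite -EFinD lee_fin; lra.
apply: le_trans (leeD (e1 M) (e2 M)).
rewrite ge0_sume_distrr; last by move=> l _; exact: gauge_ge0.
rewrite -big_split/=; apply: lee_sum => l _; set m := winlev M l.
have x1 : 0 <= u1 m / G1 by rewrite divr_ge0.
have x2 : 0 <= u2 m / G2 by rewrite divr_ge0.
apply: le_trans (gauge_mul q00 q10 q20 qE x1 x2).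
rewrite (_ : _ / _ = c * (u1 m / G1 * (u2 m / G2))); first by apply: hc; exact: mulr_ge0.
by field; rewrite !gt_eqF.
Qed.

(** * Multiplication *)

Lemma integral_gauge_lp_unit p (g : n.-tuple R -> R) : (0 < p)%E -> lp_unit p g ->
  (\int[@leb_n R n]_x gauge p (g x) <= 1)%E.
Proof.
case/exponentP => [s s0 -> _|-> _] //; rewrite /lp_unit/= => g1.
by rewrite integral0_eq ?lee_fin// => x _; rewrite gauge_inf g1.
Qed.

(** Integrated form of [gauge_mul]: two gauge integrals add up to at most 2, a factor which
    [gauge_scale] turns into [c]. *)
Lemma lp_unit_mul p0 p1 p2 : (0 < p0)%E -> (0 < p1)%E -> (0 < p2)%E ->
  einv p0 = einv p1 + einv p2 ->
  exists2 c : R, 0 < c & forall g1 g2 : n.-tuple R -> R,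
    measurable_fun [set: n.-tuple R] g1 -> measurable_fun [set: n.-tuple R] g2 ->
    (forall x, 0 <= g1 x) -> (forall x, 0 <= g2 x) -> lp_unit p1 g1 -> lp_unit p2 g2 ->
    lp_unit p0 (fun x => c * (g1 x * g2 x)).
Proof.
move=> p00 p10 p20 pE; have [c c0 hc] := gauge_scale p00 (ltr0Sn R 1).
exists c; first exact: c0.
move=> g1 g2 mg1 mg2 g10 g20 u1 u2.
case/exponentP: (p00) (hc) pE => [s s0 -> _|-> e0] hc' pE; last first.
  have e1 : einv p1 = 0 by have := einv_ge0 p10; have := einv_ge0 p20; lra.
  have e2 : einv p2 = 0 by have := einv_ge0 p10; have := einv_ge0 p20; lra.
  move: u1 u2; rewrite (einv_eq0 p10 e1) (einv_eq0 p20 e2) /lp_unit/= => u1 u2 x.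
  have c1 : c <= 1.
    have := hc' 1 ler01; rewrite mulr1 !gauge_inf lexx; case: (c <= 1) => //.
    by rewrite gt0_muley ?lte_fin.
  by rewrite mulr_ile1 ?mulr_ge0 ?(ltW c0)// mulr_ile1.
rewrite /lp_unit/= -(lee_pmul2l _ (x := 2%:E)) ?lte_fin// mule1.
have mp p g : measurable_fun [set: n.-tuple R] g -> measurable_fun [set: n.-tuple R] (fun x => gauge p (g x) : \bar R).
  by move=> mg; exact: measurableT_comp (measurable_gauge p) mg.
rewrite -ge0_integralZl_EFin//; last 2 first.
- by move=> x _; rewrite lee_fin powR_ge0.
- apply: (mp s%:E); apply: measurable_funM => //; exact: measurable_funM.
apply: (@le_trans _ _ (\int[@leb_n R n]_x (gauge p1 (g1 x) + gauge p2 (g2 x)))%E).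
  apply: ge0_le_integral_nomeas => x _; first by rewrite mule_ge0// lee_fin powR_ge0.
  apply: le_trans (gauge_mul _ p10 p20 pE (g10 x) (g20 x)); last by rewrite lte_fin.
  by apply: hc'; exact: mulr_ge0.
rewrite ge0_integralD//; try by [move=> x _; exact: gauge_ge0|exact: mp].
apply: le_trans (leeD (integral_gauge_lp_unit p10 u1) (integral_gauge_lp_unit p20 u2)) _.
by rewrite -EFinD lee_fin; lra.
Qed.

(** Within the cell, [A] exceeds its intersection with [B] by no more than the complement of [B]. *)
Lemma cell_frac_inter m j (A B : set (n.-tuple R)) (k l : R) : measurable A -> measurable B ->
  (k%:E * leb_n (cell m @^-1` [set j]) <= leb_n (A `&` cell m @^-1` [set j]))%E ->
  (l%:E * leb_n (cell m @^-1` [set j]) <= leb_n (B `&` cell m @^-1` [set j]))%E ->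
  ((k + l - 1)%:E * leb_n (cell m @^-1` [set j]) <= leb_n ((A `&` B) `&` cell m @^-1` [set j]))%E.
Proof.
set Q := _ @^-1` _ => mA mB; have mQ : measurable Q by exact: measurable_cell.
have QE : leb_n Q = (side m ^+ n)%:E by exact: leb_n_cell.
have fQ X : measurable X -> exists x, leb_n (X `&` Q) = x%:E.
  move=> mX; exists (fine (leb_n (X `&` Q))); rewrite fineK// ge0_fin_numE//.
  apply: (@le_lt_trans _ _ (leb_n Q)); last by rewrite QE ltry.
  apply: le_measure; rewrite ?inE//; exact: measurableI.
have [x xE] := fQ _ mA; have [y yE] := fQ _ mB.
have [z zE] := fQ _ (measurableI _ _ mA mB); have [w wE] := fQ _ (measurableC mB).
have h1 : (x <= z + w)%R.
  rewrite -lee_fin EFinD -xE -zE -wE; apply: (@le_trans _ _ (leb_n ((A `&` B `&` Q) `|` (~` B `&` Q)))).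
    apply: le_measure; rewrite ?inE; [exact: measurableI| |].
      by apply: measurableU; apply: measurableI => //; [exact: measurableI|exact: measurableC].
    by move=> t [At Qt]; case: (pselect (B t)) => Bt; [left|right].
  by apply: measureU2; apply: measurableI => //; [exact: measurableI|exact: measurableC].
have h2 : (side m ^+ n = y + w)%R.
  apply/EFin_inj; rewrite EFinD -yE -wE -QE [B `&` Q]setIC [~` B `&` Q]setIC -setDE addeC.
  exact: measureDI.
rewrite xE yE zE QE -!EFinM !lee_fin; nra.
Qed.

Lemma lq_bound_scale q (u : int -> R) (G B : R) : (0 < q)%E -> 0 <= B -> 0 <= G ->
  (forall m, 0 <= u m) -> lq_bound q u G -> lq_bound q (fun m => B * u m) (B * G).
Proof.
move=> q0 B0 G0 u0; rewrite /lq_bound; case/exponentP: q0 => [t t0 -> _|-> _] /= h m.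
  under eq_bigr do rewrite powRM//.
  by rewrite -mulr_sumr powRM// ler_wpM2l ?powR_ge0.
by rewrite ler_wpM2l.
Qed.

Lemma certificate_mul p0 p1 p2 q0 q1 q2 : (0 < p0)%E -> (0 < p1)%E -> (0 < p2)%E ->
  (0 < q0)%E -> (0 < q1)%E -> (0 < q2)%E ->
  einv p0 = einv p1 + einv p2 -> einv q0 = einv q1 + einv q2 ->
  exists2 C : R, 0 < C & forall (K1 K2 B : R) u v E1 E2 g1 g2, 0 < K1 -> 0 < K2 -> 0 < B ->
    (forall m j, 0 <= u m j) -> (forall m j, 0 <= v m j) ->
    certificate (3 / 4) p1 q1 K1 u E1 g1 -> certificate (3 / 4) p2 q2 K2 v E2 g2 ->
    exists E g, certificate (1 / 2) p0 q0 (B * (C * (K1 * K2))) (fun m j => B * (u m j * v m j)) E g.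
Proof.
move=> p00 p10 p20 q00 q10 q20 pE qE.
have [c c0 Hp] := lp_unit_mul p00 p10 p20 pE.
have [D D0 Hq] := lq_bound_mul q00 q10 q20 qE.
exists (D / c); first exact: divr_gt0.
move=> K1 K2 B u v E1 E2 g1 g2 K10 K20 B0 u0 v0.
move=> [mE1 f1 [mg1 g10] lp1 lq1] [mE2 f2 [mg2 g20] lp2 lq2].
exists (fun m => E1 m `&` E2 m), (fun x => c * (g1 x * g2 x)); split.
- by move=> m; exact: measurableI.
- move=> m j; rewrite (_ : 1 / 2 = 3 / 4 + 3 / 4 - 1); last by lra.
  exact: cell_frac_inter.
- split; last by move=> x; rewrite !mulr_ge0// ltW.
  by apply: measurable_funM => //; exact: measurable_funM.
- exact: Hp.
- move=> x; rewrite (_ : B * _ * _ = B * (D * ((K1 * g1 x) * (K2 * g2 x)))); last first.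
    by field; rewrite gt_eqF.
  rewrite (_ : (fun m => _) = (fun m => B * ((u m (cell m x) * \1_(E1 m) x) * (v m (cell m x) * \1_(E2 m) x)))); last first.
    by apply/funext => m; rewrite indicI /=; ring.
  apply: lq_bound_scale => //; [exact: ltW| | |apply: Hq => //].
  + by rewrite !mulr_ge0// ltW.
  + by move=> m; rewrite !mulr_ge0.
  + by rewrite mulr_ge0// ltW.
  + by rewrite mulr_ge0// ltW.
  + by move=> m; rewrite mulr_ge0.
  + by move=> m; rewrite mulr_ge0.
Qed.

Lemma dominates_mul r0 r1 r2 : (0 < r0)%E -> (0 < r1)%E -> (0 < r2)%E ->
  einv r0 = einv r1 + einv r2 ->
  exists2 B : R, 0 < B & forall (h1 h2 : n.-tuple R * R -> R) (u v : int -> n.-tuple int -> R),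
    measurable_fun [set: n.-tuple R * R] h1 -> measurable_fun [set: n.-tuple R * R] h2 ->
    (forall w, 0 <= h1 w) -> (forall w, 0 <= h2 w) ->
    (forall m j, 0 <= u m j) -> (forall m j, 0 <= v m j) ->
    dominates r1 h1 u -> dominates r2 h2 v ->
    dominates r0 (fun w => h1 w * h2 w) (fun m j => B * (u m j * v m j)).
Proof.
move=> r00 r10 r20 rE; have [c c0 hc] := gauge_scale r00 (ltr0Sn R 1).
exists c^-1; first by rewrite invr_gt0.
move=> h1 h2 u v mh1 mh2 h10 h20 u0 v0 d1 d2 m j l.
rewrite -ltr_pdivlMl ?invr_gt0// invrK => luv.
set x := u m j in luv *; set y := v m j in luv *.
have x0 : 0 <= x by exact: u0.
have y0 : 0 <= y by exact: v0.
(* The coefficients may be 0, so both are enlarged by a small e that keeps their product at most c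
   l. *)
have [e e0 he] : exists2 e : R, 0 < e & (x + e) * (y + e) <= c * l.
  exists (Num.min 1 ((c * l - x * y) / (x + y + 1))).
    by rewrite lt_min ltr01 divr_gt0 ?subr_gt0//; lra.
  set e := Num.min _ _; have e1 : e <= 1 by rewrite ge_min lexx.
  have e0 : 0 <= e by rewrite le_min ler01 divr_ge0 ?subr_ge0 ?(ltW luv)//; lra.
  have : e * (x + y + 1) <= c * l - x * y.
    by rewrite -ler_pdivlMr ?ge_min ?lexx ?orbT//; lra.
  by nra.
have D1 := d1 m j (x + e) (ltr_pwDr e0 (lexx _)).
have D2 := d2 m j (y + e) (ltr_pwDr e0 (lexx _)).
have xe : 0 < x + e by lra.
have ye : 0 < y + e by lra.
have l0 : 0 < l by rewrite -(pmulr_rgt0 _ c0); apply: lt_le_trans he; exact: mulr_gt0.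
have mk (h : n.-tuple R * R -> R) (k : R) : measurable_fun [set: n.-tuple R * R] h ->
    measurable_fun [set: n.-tuple R * R] (fun w => h w / k) by move=> mh; exact: measurable_funM.
pose hh w := c * (h1 w / (x + e) * (h2 w / (y + e))).
have mhh : measurable_fun [set: n.-tuple R * R] hh.
  by apply: measurable_funM => //; apply: measurable_funM; exact: mk.
apply: (@le_trans _ _ (gaugeH r0 (wbox m j) hh)).
  apply: gaugeH_le => // w _; rewrite divr_ge0 ?mulr_ge0 ?(ltW l0)//=.
  rewrite /hh (_ : c * _ = h1 w * h2 w * (c / ((x + e) * (y + e)))); last first.
    by field; rewrite !gt_eqF.
  rewrite ler_wpM2l ?mulr_ge0// ler_pdivlMr ?mulr_gt0// mulrC ler_pdivrMr//.
rewrite -(lee_pmul2l _ (x := 2%:E)) ?lte_fin//.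
apply: le_trans (@gaugeH_le_mul _ _ r0 (wbox m j) (fun w => h1 w / (x + e) * (h2 w / (y + e))) hh c 2 _ _ _ _ _ _) _ => //.
- exact: measurable_wbox.
- by move=> w _; rewrite mulr_ge0// divr_ge0// ltW.
apply: le_trans (gaugeH_mul r00 r10 r20 rE (measurable_wbox m j) (mk _ _ mh1) (mk _ _ mh2) _ _) _.
- by move=> w _; rewrite divr_ge0// ltW.
- by move=> w _; rewrite divr_ge0// ltW.
apply: le_trans (leeD D1 D2) _; rewrite -EFinD -EFinM lee_fin; lra.
Qed.

Lemma tent_mul p0 p1 p2 q0 q1 q2 r0 r1 r2 : (0 < p0)%E -> (0 < p1)%E -> (0 < p2)%E ->
  (0 < q0)%E -> (0 < q1)%E -> (0 < q2)%E -> (0 < r0)%E -> (0 < r1)%E -> (0 < r2)%E ->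
  einv p0 = einv p1 + einv p2 -> einv q0 = einv q1 + einv q2 -> einv r0 = einv r1 + einv r2 ->
  exists2 C : R, 0 < C & forall (h1 h2 : n.-tuple R * R -> R) (K1 K2 : R), 0 < K1 -> 0 < K2 ->
    measurable_fun [set: n.-tuple R * R] h1 -> measurable_fun [set: n.-tuple R * R] h2 ->
    (forall w, 0 <= h1 w) -> (forall w, 0 <= h2 w) ->
    (tent_norm p1 q1 (whitney_avg a1 a2 r1 (fun w => (h1 w)%:E)) <= K1%:E)%E ->
    (tent_norm p2 q2 (whitney_avg a1 a2 r2 (fun w => (h2 w)%:E)) <= K2%:E)%E ->
    (tent_norm p0 q0 (whitney_avg a1 a2 r0 (fun w => (h1 w * h2 w)%:E)) <= (C * (K1 * K2))%:E)%E.
Proof.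
move=> p00 p10 p20 q00 q10 q20 r00 r10 r20 pE qE rE.
have [C1 C10 H1] := whitney_certificate p10 q10 r10.
have [C2 C20 H2] := whitney_certificate p20 q20 r20.
have [C3 C30 H3] := certificate_mul p00 p10 p20 q00 q10 q20 pE qE.
have [B B0 HB] := dominates_mul r00 r10 r20 rE.
have k0 : 0 < 1 / 2 :> R by lra.
have [C4 C40 H4] := tent_norm_dominated p00 q00 r00 k0.
exists (C4 * (B * (C3 * (C1 * C2)))); first by rewrite !mulr_gt0.
move=> h1 h2 K1 K2 K10 K20 mh1 mh2 h10 h20 /(H1 _ _ K10 mh1 h10)[d1 [E1 [g1 c1]]].
move=> /(H2 _ _ K20 mh2 h20)[d2 [E2 [g2 c2]]].
have u0 m j := boxavg_ge0 r1 m j h10; have v0 m j := boxavg_ge0 r2 m j h20.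
have [E [g c]] := H3 _ _ B _ _ _ _ _ _ (mulr_gt0 C10 K10) (mulr_gt0 C20 K20) B0 u0 v0 c1 c2.
have := H4 _ (fun w => h1 w * h2 w) _ _ _ _ _ _ _ _ c.
rewrite (_ : C4 * _ = C4 * (B * (C3 * (C1 * C2))) * (K1 * K2)); last by ring.
apply.
- by rewrite !mulr_gt0.
- exact: measurable_funM.
- by move=> w; exact: mulr_ge0.
- by move=> m j; rewrite !mulr_ge0// ltW.
- exact: HB.
Qed.

(** * Factorization *)

Lemma leb_n_bigcup_le (F : (set (n.-tuple R))^nat) (B : R) : (forall k, measurable (F k)) ->
  nondecreasing_seq F -> (forall k, leb_n (F k) <= B%:E)%E -> (leb_n (\bigcup_k F k) <= B%:E)%E.
Proof.
move=> mF Fnd FB; have mU : measurable (\bigcup_k F k) by exact: bigcup_measurable.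
have h := nondecreasing_cvg_mu (mu := @leb_n R n) mF mU Fnd.
rewrite -(cvg_lim _ h)//; apply: lime_le; first by apply/cvg_ex; eexists; exact: h.
exact: nearW.
Qed.

Lemma leb_n_complement_cell m j (A : set (n.-tuple R)) (x : R) : measurable A ->
  leb_n (cell m @^-1` [set j] `&` A) = x%:E ->
  leb_n (cell m @^-1` [set j] `&` ~` A) = (side m ^+ n - x)%:E.
Proof.
set Q := _ @^-1` _ => mA xE; have mQ : measurable Q by exact: measurable_cell.
have h : leb_n Q = (leb_n (Q `\` A) + leb_n (Q `&` A))%E by exact: measureDI.
by rewrite xE leb_n_cell setDE in h; rewrite EFinB h addeK.
Qed.

(** M is the infimum of the levels l for which g <= l on at least half of the cell. Both halves are
    obtained with non-strict inequalities, because {g > M} and {g < M} are increasing unions of sets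
    filling at most half of the cell. *)
Lemma cell_median m j (g : n.-tuple R -> R) : measurable_fun [set: n.-tuple R] g ->
  (forall x, 0 <= g x) -> exists M : R, [/\ 0 <= M,
    ((1 / 2)%:E * leb_n (cell m @^-1` [set j]) <=
       leb_n ([set x | (M <= g x)%R] `&` cell m @^-1` [set j]))%E &
    ((1 / 2)%:E * leb_n (cell m @^-1` [set j]) <=
       leb_n ([set x | (g x <= M)%R] `&` cell m @^-1` [set j]))%E].
Proof.
move=> mg g0; set Q := _ @^-1` _.
have mQ : measurable Q by exact: measurable_cell.
have QE : leb_n Q = (side m ^+ n)%:E by exact: leb_n_cell.
set v := side m ^+ n in QE; have v0 : 0 < v by rewrite exprn_gt0// side_gt0.
have mle l : measurable [set x | g x <= l].
  by rewrite -[X in measurable X]setTI; apply: (mg measurableT `]-oo, l]%classic); exact: measurable_itv.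
have leC l : ~` [set x | g x <= l] = [set x | l < g x].
  by apply/seteqP; split => x /=; rewrite ltNge => /negP.
pose low l := fine (leb_n (Q `&` [set x | g x <= l])).
have lowE l : leb_n (Q `&` [set x | g x <= l]) = (low l)%:E.
  rewrite fineK// ge0_fin_numE//; apply: (@le_lt_trans _ _ (leb_n Q)); last by rewrite QE ltry.
  by apply: le_measure; rewrite ?inE//; exact: measurableI.
have highE l : leb_n (Q `&` [set x | l < g x]) = (v - low l)%:E.
  by rewrite -leC; apply: leb_n_complement_cell => //; exact: lowE.
have low_mono l l' : l <= l' -> low l <= low l'.
  move=> ll; rewrite -lee_fin -!lowE; apply: le_measure; rewrite ?inE; try exact: measurableI.
  by move=> x [Qx h]; split => //; exact: le_trans h ll.
pose L := [set l : R | 0 <= l /\ v / 2 <= low l].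
have L0 : L !=set0.
  apply: contrapT => h; have : (leb_n Q <= (v / 2)%:E)%E.
    rewrite (_ : Q = \bigcup_k (Q `&` [set x | g x <= k%:R])); last first.
      apply/seteqP; split => [x Qx|x [k _ []//]]; exists (Num.bound (g x)) => //; split => //=.
      by apply/ltW/archi_boundP.
    apply: leb_n_bigcup_le.
    - by move=> k; exact: measurableI.
    - move=> k k' kk; rewrite subsetEset => x [Qx h']; split => //=.
      by apply: le_trans h' _; rewrite ler_nat.
    - move=> k; rewrite lowE lee_fin leNgt; apply/negP => h'; apply: h.
      by exists k%:R; split; rewrite ?ler0n// ltW.
  by rewrite QE lee_fin; lra.
have Llb : has_lbound L by exists 0 => l [].
pose M := inf L.
have M0 : 0 <= M by apply: lb_le_inf => // l [].
have belowM l : l < M -> 0 <= l -> low l < v / 2.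
  move=> lM l0; rewrite ltNge; apply/negP => h.
  by move: lM; rewrite ltNge => /negP; apply; apply: ge_inf.
have aboveM l : M < l -> v / 2 <= low l.
  move=> Ml; have [l' [l'0 h] l'l] := inf_lt L0 Ml.
  by apply: le_trans h _; apply: low_mono; exact: ltW.
have high : (leb_n (Q `&` [set x | (M < g x)%R]) <= (v / 2)%:E)%E.
  rewrite (_ : _ `&` _ = \bigcup_k (Q `&` [set x | M + k.+1%:R^-1 < g x])); last first.
    apply/seteqP; split => [x [Qx /= h]|x [k _ [Qx /= h]]].
      have [k hk] := ltr_add_invr h.
      by exists k.
    by split => //=; apply: lt_trans h; rewrite ltrDl invr_gt0.
  apply: leb_n_bigcup_le.
  - by move=> k; rewrite -leC; apply: measurableI => //; exact: measurableC.
  - move=> k k' kk; rewrite subsetEset => x [Qx h']; split => //=.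
    by apply: le_lt_trans h'; rewrite lerD2l lef_pV2 ?posrE// ler_nat.
  - move=> k; rewrite highE lee_fin.
    have : v / 2 <= low (M + k.+1%:R^-1) by apply: aboveM; rewrite ltrDl invr_gt0.
    by lra.
have lowM : (leb_n (Q `&` [set x | (g x < M)%R]) <= (v / 2)%:E)%E.
  rewrite (_ : _ `&` _ = \bigcup_k (Q `&` [set x | g x <= M - k.+1%:R^-1])); last first.
    apply/seteqP; split => [x [Qx /= h]|x [k _ [Qx /= h]]].
      have [k hk] := ltr_add_invr h.
      by exists k => //; split => //=; rewrite lerBrDr ltW.
    by split => //=; apply: le_lt_trans h _; rewrite ltrBlDr ltrDl invr_gt0.
  apply: leb_n_bigcup_le.
  - by move=> k; exact: measurableI.
  - move=> k k' kk; rewrite subsetEset => x [Qx h']; split => //=.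
    by apply: le_trans h' _; rewrite lerD2l lerN2 lef_pV2 ?posrE// ler_nat.
  - move=> k; have [l0|l0] := leP 0 (M - k.+1%:R^-1).
      by rewrite lowE lee_fin ltW// belowM// ltrBlDr ltrDl invr_gt0.
    rewrite (_ : _ `&` _ = set0) ?measure0 ?lee_fin ?divr_ge0 ?(ltW v0)//.
    by apply/seteqP; split => // x [_ /= h]; have := le_lt_trans h l0; rewrite ltNge g0.
have half A : measurable A -> (leb_n (Q `&` A) <= (v / 2)%:E)%E ->
    ((1 / 2)%:E * leb_n Q <= leb_n (~` A `&` Q))%E.
  move=> mA; have : leb_n (Q `&` A) \is a fin_num.
    rewrite ge0_fin_numE//; apply: (@le_lt_trans _ _ (leb_n Q)); last by rewrite QE ltry.
    by apply: le_measure; rewrite ?inE//; exact: measurableI.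
  move=> /fineK xE; rewrite -xE lee_fin => h.
  rewrite setIC (leb_n_complement_cell mA (esym xE)) QE -EFinM lee_fin -/v; lra.
exists M; split => //.
- rewrite (_ : [set x | M <= g x] = ~` [set x | g x < M]); last first.
    by apply/seteqP; split => x /=; rewrite leNgt => /negP.
  apply: half => //.
  by rewrite -[X in measurable X]setTI; apply: (mg measurableT `]-oo, M[%classic); exact: measurable_itv.
- rewrite (_ : [set x | g x <= M] = ~` [set x | M < g x]); last first.
    by apply/seteqP; split => x /=; rewrite leNgt => /negP.
  by apply: half => //; rewrite -leC; exact: measurableC.
Qed.

Lemma lp_unit_pow p0 p1 (th : R) (g : n.-tuple R -> R) : (0 < p0)%E -> (0 < p1)%E -> 0 <= th ->
  einv p1 = th * einv p0 -> (forall x, 0 <= g x) -> lp_unit p0 g -> lp_unit p1 (fun x => g x `^ th).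
Proof.
move=> p00 p10 th0 pE g0 u; rewrite /lp_unit; case/exponentP: (p10) (p10) pE => [t t0 -> _|-> e1] p1' pE /=.
  apply: le_trans (integral_gauge_lp_unit p00 u); apply: ge0_le_integral_nomeas => x _.
    by rewrite lee_fin powR_ge0.
  exact: (gauge_pow (r1 := t%:E)).
move=> x; case/exponentP: (p00) u pE => [s s0 -> e0|-> e0] u pE.
  move: pE; rewrite e1 e0 => /esym/eqP; rewrite mulf_eq0 invr_eq0 (gt_eqF s0) orbF => /eqP ->.
  by rewrite powRr0.
by apply: le_trans (powR_ler th0 (g0 x) (u x)) _; rewrite powR1.
Qed.

(** Dividing by G^th leaves w / G^th <= (u / G)^ta, since the powers of G combine to -ta;
    [gauge_pow] then compares the gauges. *)
Lemma lq_bound_pow q0 q1 (ta th : R) (u w : int -> R) (G : R) : (0 < q0)%E -> (0 < q1)%E ->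
  0 <= ta -> einv q1 = ta * einv q0 -> 0 <= G -> (forall m, 0 <= u m) -> (forall m, 0 <= w m) ->
  (forall m, u m = 0 -> w m = 0) -> (forall m, 0 < u m -> w m <= u m `^ ta * G `^ (th - ta)) ->
  lq_bound q0 u G -> lq_bound q1 w (G `^ th).
Proof.
move=> q00 q10 ta0 qE G0 u0 w0 uw wle h.
have [Gz|Gz] := eqVneq G 0.
  apply: lq_bound_zero => // [|m]; first exact: powR_ge0.
  apply: uw; apply/eqP; rewrite eq_le u0 andbT -Gz; exact: lq_bound_ge h.
have Gp : 0 < G by rewrite lt_neqAle eq_sym Gz.
apply/lq_bound_gauge => //; first exact: powR_gt0.
move=> M; apply: le_trans ((lq_bound_gauge q00 Gp u0).1 h M); apply: lee_sum => l _.
set m := winlev M l; apply: le_trans (gauge_pow q00 q10 ta0 qE (divr_ge0 (u0 m) G0)).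
apply: gauge_le => //; first by rewrite divr_ge0 ?powR_ge0.
rewrite ler_pdivrMr ?powR_gt0//.
have [uz|uz] := eqVneq (u m) 0; first by rewrite (uw m uz) mulr_ge0 ?powR_ge0.
have up : 0 < u m by rewrite lt_neqAle eq_sym uz u0.
apply: le_trans (wle m up) _; rewrite powRM ?invr_ge0//.
rewrite -[G^-1]powR_inv1// -powRrM mulN1r -mulrA ler_wpM2l ?powR_ge0//.
by rewrite -powRD ?Gz ?implybT// addrC.
Qed.

(** The value 0 where [a] vanishes is imposed separately, since a power with exponent [ta = 0] would
    be 1 there. *)
Definition split_weights (ta th K : R) (a M : int -> n.-tuple int -> R) m j : R :=
  if a m j == 0 then 0 else a m j `^ ta * (K * M m j) `^ (th - ta).

Definition cell_median_of (g : n.-tuple R -> R) (M : int -> n.-tuple int -> R) := forall m j, [/\ 0 <= M m j,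
    ((1 / 2)%:E * leb_n (cell m @^-1` [set j]) <=
       leb_n ([set x | (M m j <= g x)%R] `&` cell m @^-1` [set j]))%E &
    ((1 / 2)%:E * leb_n (cell m @^-1` [set j]) <=
       leb_n ([set x | (g x <= M m j)%R] `&` cell m @^-1` [set j]))%E].

Lemma cell_median_exists (g : n.-tuple R -> R) : measurable_fun [set: n.-tuple R] g -> (forall x, 0 <= g x) ->
  exists M, cell_median_of g M.
Proof.
move=> mg g0.
have [M MP] := choice (fun mj : int * n.-tuple int => cell_median mj.1 mj.2 mg g0).
by exists (fun m j => M (m, j)) => m j; exact: MP (m, j).
Qed.

Lemma split_weights_ge0 ta th K a M m j : 0 <= split_weights ta th K a M m j.
Proof. by rewrite /split_weights; case: eqP => // _; rewrite mulr_ge0 ?powR_ge0. Qed.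

(** As 3/4 + 1/2 > 1, the set [E m] meets the part of the cell where g <= M, and at such a point a
    <= K g <= K M. *)
Lemma median_gt0 p q (K : R) a E g M m j : (0 < q)%E -> 0 < K ->
  certificate (3 / 4) p q K a E g -> (forall m j, 0 <= a m j) -> cell_median_of g M ->
  0 < a m j -> 0 < M m j.
Proof.
move=> q0 K0 [mE fE [mg g0] _ lq] a0 /(_ m j)[M0 _ lowM] aj.
have ml : measurable [set x | g x <= M m j].
  by rewrite -[X in measurable X]setTI; apply: (mg measurableT `]-oo, M m j]%classic); exact: measurable_itv.
have := cell_frac_inter (mE m) ml (fE m j) lowM.
have [[x [[Ex /= gx] xj]]|h] := pselect (exists x, (E m `&` [set x | g x <= M m j] `&` cell m @^-1` [set j]) x).
  move=> _; have u0 m' : 0 <= a m' (cell m' x) * \1_(E m') x by rewrite mulr_ge0.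
  have := lq_bound_ge m q0 (mulr_ge0 (ltW K0) (g0 x)) u0 (lq x).
  rewrite indicE mem_set// mulr1 xj => h.
  have := lt_le_trans aj h; rewrite pmulr_rgt0// => /lt_le_trans; exact.
rewrite (_ : _ `&` cell m @^-1` [set j] = set0) ?measure0; last first.
  by apply/seteqP; split => // x Hx; apply: h; exists x.
rewrite leb_n_cell -EFinM lee_fin leNgt mulr_gt0 ?exprn_gt0 ?side_gt0//; lra.
Qed.

Lemma powR_nonpos_le (x y e : R) : 0 < x -> x <= y -> e <= 0 -> y `^ e <= x `^ e.
Proof.
move=> x0 xy e0; have y0 := lt_le_trans x0 xy.
rewrite -[e]opprK !(powRN _ (- e)) lef_pV2 ?posrE ?powR_gt0//.
by apply: powR_ler; rewrite ?oppr_ge0// ltW.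
Qed.

(* Where [ta <= th] the weight is controlled on the half of the cell where
   [M <= g], otherwise on the half where [g <= M]. *)
Lemma factor_certificate p0 q0 p1 q1 (th ta : R) : (0 < p0)%E -> (0 < q0)%E ->
  (0 < p1)%E -> (0 < q1)%E -> 0 <= th -> 0 <= ta ->
  einv p1 = th * einv p0 -> einv q1 = ta * einv q0 ->
  forall (K B : R) a E g M, 0 < K -> 0 < B -> (forall m j, 0 <= a m j) ->
    certificate (3 / 4) p0 q0 K a E g -> cell_median_of g M ->
    exists E' g', certificate (1 / 4) p1 q1 (B * K `^ th)
      (fun m j => B * split_weights ta th K a M m j) E' g'.
Proof.
move=> p00 q00 p10 q10 th0 ta0 pE qE K B a E g M K0 B0 a0 cert med.
have Mpos m j := median_gt0 (m := m) (j := j) q00 K0 cert a0 med.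
have [mE fE [mg g0] lpg lqg] := cert.
pose D m x := if ta <= th then g x - M m (cell m x) else M m (cell m x) - g x.
have mD m : measurable_fun [set: n.-tuple R] (D m).
  have mM : measurable_fun [set: n.-tuple R] (fun x => M m (cell m x)).
    by apply: (@measurable_cellwise _ _ _ (cell m)); [exact: measurable_cell|move=> x y ->].
  by rewrite /D; case: (ta <= th); exact: measurable_funB.
pose S m := [set x | 0 <= D m x].
have mS m : measurable (S m).
  rewrite (_ : S m = setT `&` D m @^-1` `[0, +oo[%classic).
    by apply: mD => //; exact: measurable_itv.
  by rewrite setTI; apply/seteqP; split => x; rewrite /S/= in_itv/= andbT.
exists (fun m => E m `&` S m), (fun x => g x `^ th); split.
- by move=> m; apply: measurableI.
- move=> m j; rewrite (_ : 1 / 4 = 3 / 4 + 1 / 2 - 1); last by lra.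
  apply: cell_frac_inter => //; have [_ hi lo] := med m j.
  case: (leP ta th) => tt.
  + rewrite (_ : S m `&` _ = [set x | M m j <= g x] `&` cell m @^-1` [set j])//.
    by apply/seteqP; split => x [Sx xj]; split => //; move: Sx; rewrite /S /D/= tt xj subr_ge0.
  + rewrite (_ : S m `&` _ = [set x | g x <= M m j] `&` cell m @^-1` [set j])//.
    by apply/seteqP; split => x [Sx xj]; split => //; move: Sx; rewrite /S /D/= [ta <= th]leNgt tt/= xj subr_ge0.
- split; last by move=> x; exact: powR_ge0.
  by apply: (measurableT_comp (measurable_powR th)).
- exact: (lp_unit_pow p00).
move=> x; rewrite -mulrA -powRM ?(ltW K0)//.
rewrite (_ : (fun m => _) = (fun m => B * (split_weights ta th K a M m (cell m x) * \1_(E m `&` S m) x))); last first.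
  by apply/funext => m; rewrite mulrA.
have Kg : 0 <= K * g x by rewrite mulr_ge0// ltW.
have u0 m : 0 <= a m (cell m x) * \1_(E m) x by rewrite mulr_ge0.
have w0 m : 0 <= split_weights ta th K a M m (cell m x) * \1_(E m `&` S m) x.
  by rewrite mulr_ge0// split_weights_ge0.
apply: lq_bound_scale => //; [exact: ltW|exact: powR_ge0|].
apply: (lq_bound_pow q00 q10 ta0 qE Kg u0 w0 _ _ (lqg x)) => m.
- rewrite indicE; case: (boolP (x \in E m)) => [xE|xE _]; last first.
    by rewrite indicE in_setI (negbTE xE) mulr0.
  by rewrite mulr1 /split_weights => ->; rewrite eqxx mul0r.
- rewrite indicE; case: (boolP (x \in E m)) => [xE|_]; last by rewrite mulr0 ltxx.
  rewrite mulr1 => aj; rewrite indicE; case: (boolP (x \in _)) => [/set_mem[_ xS]|_]; last first.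
    by rewrite mulr0 mulr_ge0 ?powR_ge0.
  rewrite mulr1 /split_weights gt_eqF// ler_wpM2l ?powR_ge0//.
  have [M0 _ _] := med m (cell m x).
  move: xS; rewrite /S /D/=; case: (leP ta th) => tt; rewrite subr_ge0 => gM.
    apply: powR_ler; rewrite ?subr_ge0// ?mulr_ge0 ?(ltW K0)//.
    by rewrite ler_wpM2l// ltW.
  (* With a negative exponent the smaller base K g must be positive, which follows from 0 < a <= K g
     on [E m]. *)
  apply: powR_nonpos_le; last by rewrite subr_le0 ltW.
    apply: lt_le_trans aj _; have := lq_bound_ge m q00 Kg u0 (lqg x).
    by rewrite indicE xE mulr1.
  by rewrite ler_wpM2l// ltW.
Qed.

(** Points of height at most 0 form one more cell [None], so that [onbox] is constant on the cells
    of a partition of the whole space, hence measurable. *)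
Definition boxof (z : n.-tuple R * R) : option (int * n.-tuple int) :=
  if 0 < z.2 then Some (lev z.2, cell (lev z.2) z.1) else None.

Definition onbox (b : int -> n.-tuple int -> R) z : R :=
  if boxof z is Some mj then b mj.1 mj.2 else 0.

Lemma onboxE b m j z : wbox m j z -> onbox b z = b m j.
Proof.
move=> zj; rewrite /onbox /boxof (wbox_pos zj)/= (wbox_lev zj).
by case: zj => <-.
Qed.

Lemma measurable_onbox b : measurable_fun [set: n.-tuple R * R] (onbox b).
Proof.
apply: (@measurable_cellwise _ _ _ boxof); last by move=> x y; rewrite /onbox => ->.
case => [[m j]|].
  rewrite (_ : _ @^-1` _ = wbox m j); first exact: measurable_wbox.
  apply/seteqP; split => z /=.
    rewrite /boxof; case: ifPn => // z0 [<- <-]; exact: wbox_mem.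
  by move=> zj; rewrite /boxof (wbox_pos zj)/= (wbox_lev zj); case: zj => ->.
rewrite (_ : _ @^-1` _ = setT `*` `]-oo, 0]%classic).
  by apply: measurableX => //; exact: measurable_itv.
apply/seteqP; split => z /=; rewrite /boxof in_itv/=; case: ltP => //.
by move=> _ [].
Qed.

Definition factor (ka : R) (h : n.-tuple R * R -> R) a b z : R :=
  (h z / onbox a z) `^ ka * onbox b z.

Lemma measurable_factor ka h a b : measurable_fun [set: n.-tuple R * R] h ->
  measurable_fun [set: n.-tuple R * R] (factor ka h a b).
Proof.
move=> mh; apply: measurable_funM; last exact: measurable_onbox.
apply: (measurableT_comp (measurable_powR ka)); apply: measurable_funM => //.
rewrite (_ : (fun z => _) = onbox (fun m j => (a m j)^-1)); first exact: measurable_onbox.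
by apply/funext => z; rewrite /onbox; case: boxof => //; rewrite invr0.
Qed.

(** On a box the factor divided by 2^ka b is (h / (2 a))^ka, so [gauge_pow] reduces the claim to the
    bound for [h] at 2 a. The doubling is needed because [dominates] asks for a number strictly
    above a. *)
Lemma factor_dominated r0 r1 (ka : R) h a b : (0 < r0)%E -> (0 < r1)%E -> 0 <= ka ->
  einv r1 = ka * einv r0 -> (forall w, 0 <= h w) ->
  (forall m j, 0 <= a m j) -> (forall m j, 0 <= b m j) -> (forall m j, a m j = 0 -> b m j = 0) ->
  dominates r0 h a -> dominates r1 (factor ka h a b) (fun m j => 2 `^ ka * b m j).
Proof.
move=> r00 r10 ka0 rE h0 a0 b0 ab dom m j l bl.
have l0 : 0 < l by apply: le_lt_trans bl; rewrite mulr_ge0 ?powR_ge0.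
have [az|az] := eqVneq (a m j) 0.
  apply: (@le_trans _ _ 0%E); last first.
    by rewrite lee_fin mulr_ge0// ltW ?whitney_ratio_gt0 ?wvol_gt0.
  rewrite /gaugeH -(functional0 (@intHZ R n)); apply: intH_le => w; first by rewrite mule_ge0 ?gauge_ge0 ?lee_fin.
  rewrite indicE; case: (boolP (w \in _)) => [/set_mem wj|_]; last by rewrite mul0e.
  by rewrite /factor (onboxE b wj) (ab m j az) mulr0 mul0r gauge0// mule0.
have ap : 0 < a m j by rewrite lt_neqAle eq_sym az a0.
have aa : a m j < 2 * a m j by rewrite ltr_pMl// ltr1n.
apply: le_trans (dom m j _ aa); apply: intH_le => w; first by rewrite mule_ge0 ?gauge_ge0 ?lee_fin.
rewrite indicE; case: (boolP (w \in _)) => [/set_mem wj|_]; last by rewrite !mul0e.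
have x0 : 0 <= h w / (2 * a m j) by rewrite divr_ge0// ltW// mulr_gt0.
rewrite !mul1e; apply: le_trans (gauge_pow r00 r10 ka0 rE x0).
rewrite /factor (onboxE a wj) (onboxE b wj); apply: gauge_le => //.
  by rewrite divr_ge0 ?mulr_ge0 ?powR_ge0// ltW.
rewrite ler_pdivrMr//.
rewrite (_ : h w / a m j = 2 * (h w / (2 * a m j))); last by field.
rewrite (powRM _ _ x0)// mulrAC mulrC; apply: ler_wpM2l; first exact: powR_ge0.
exact: ltW.
Qed.

(** If 1/e0 = 0, both summands vanish and any weights are consistent; 1 and 0 keep the sum 1, which
    is what lets the two factors multiply back to the function. *)
Lemma einv_weights (e0 e1 e2 : \bar R) : (0 < e0)%E -> (0 < e1)%E -> (0 < e2)%E ->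
  einv e0 = einv e1 + einv e2 -> exists t1 t2 : R,
    [/\ 0 <= t1, 0 <= t2, t1 + t2 = 1, einv e1 = t1 * einv e0 & einv e2 = t2 * einv e0].
Proof.
move=> e00 e10 e20 eE; have i0 := einv_ge0 e00; have i1 := einv_ge0 e10; have i2 := einv_ge0 e20.
have [z|z] := eqVneq (einv e0) 0.
  by exists 1, 0; split; rewrite ?addr0 ?mul1r ?mul0r//; lra.
exists (einv e1 / einv e0), (einv e2 / einv e0); split; rewrite ?divr_ge0 ?divfK//.
by rewrite -mulrDl -eE divff.
Qed.

Lemma factor_side p0 q0 r0 p1 q1 r1 (th ta ka : R) : (0 < p0)%E -> (0 < q0)%E -> (0 < r0)%E ->
  (0 < p1)%E -> (0 < q1)%E -> (0 < r1)%E -> 0 <= th -> 0 <= ta -> 0 <= ka ->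
  einv p1 = th * einv p0 -> einv q1 = ta * einv q0 -> einv r1 = ka * einv r0 ->
  exists2 C : R, 0 < C & forall (K : R) (h : n.-tuple R * R -> R) a E g M, 0 < K ->
    measurable_fun [set: n.-tuple R * R] h -> (forall w, 0 <= h w) ->
    (forall m j, 0 <= a m j) -> dominates r0 h a -> certificate (3 / 4) p0 q0 K a E g ->
    cell_median_of g M ->
    (tent_norm p1 q1 (whitney_avg a1 a2 r1
       (fun w => (factor ka h a (split_weights ta th K a M) w)%:E)) <= (C * K `^ th)%:E)%E.
Proof.
move=> p00 q00 r00 p10 q10 r10 th0 ta0 ka0 pE qE rE.
have k0 : 0 < 1 / 4 :> R by lra.
have [C C0 HC] := tent_norm_dominated p10 q10 r10 k0.
have B0 : (0 : R) < 2 `^ ka by rewrite powR_gt0.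
exists (C * 2 `^ ka); first exact: mulr_gt0.
move=> K h a E g M K0 mh h0 a0 dom cert med.
have [E' [g' cert']] := factor_certificate p00 q00 p10 q10 th0 ta0 pE qE K0 B0 a0 cert med.
rewrite -mulrA; apply: (HC _ _ _ _ _ _ _ _ _ _ cert').
- by rewrite mulr_gt0// powR_gt0.
- exact: measurable_factor.
- move=> w; rewrite mulr_ge0 ?powR_ge0// /onbox; case: boxof => // mj.
  exact: split_weights_ge0.
- by move=> m j; rewrite mulr_ge0 ?powR_ge0 ?split_weights_ge0.
- apply: (factor_dominated r00) => //.
  + by move=> m j; exact: split_weights_ge0.
  + by move=> m j az; rewrite /split_weights az eqxx.
Qed.

(** The exponents of h / a and of a each add up to 1, and those of K M add up to 0. *)
Lemma factor_mulE (k1 k2 t1 t2 s1 s2 K : R) (h : n.-tuple R * R -> R) a M m j z :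
  k1 + k2 = 1 -> t1 + t2 = 1 -> s1 + s2 = 1 -> (forall w, 0 <= h w) ->
  wbox m j z -> 0 < a m j -> 0 < K * M m j ->
  factor k1 h a (split_weights t1 s1 K a M) z * factor k2 h a (split_weights t2 s2 K a M) z = h z.
Proof.
move=> kE tE sE h0 zj ap KM; rewrite /factor !(onboxE _ zj) /split_weights gt_eqF//.
rewrite mulrACA -powRD ?kE ?oner_eq0// powRr1 ?divr_ge0// ?(ltW ap)//.
rewrite [X in _ * X]mulrACA -powRD ?tE ?oner_eq0// powRr1 ?(ltW ap)// -powRD; last first.
  by rewrite (gt_eqF KM) implybT.
by rewrite (_ : s1 - t1 + (s2 - t2) = 0) ?powRr0 ?mulr1 ?divfK ?gt_eqF//; lra.
Qed.

(** Only the countably many boxes with a = 0 matter; there domination at every positive number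
    forces h = 0 almost everywhere, by [gaugeH_null]. *)
Lemma measH_off_null r (h f : n.-tuple R * R -> R) a : (0 < r)%E ->
  measurable_fun [set: n.-tuple R * R] h -> (forall w, 0 <= h w) -> (forall m j, 0 <= a m j) ->
  dominates r h a ->
  (forall m j z, wbox m j z -> 0 < a m j -> f z = h z) ->
  (forall m j z, wbox m j z -> a m j = 0 -> f z = 0) ->
  measH [set z | upper z /\ h z <> f z] = 0%E.
Proof.
move=> r0 mh h0 a0 dom fpos fzero.
pose F (k : nat) : set (n.-tuple R * R) :=
  if unpickle k is Some (m, j) then
    if a m j == 0 then [set z | wbox m j z /\ 0 < h z] else set0
  else set0.
have mF k : measurable (F k).
  rewrite /F; case: (unpickle k) => [[m j]|]//; case: (a m j == 0) => //.
  apply: measurableI; first exact: measurable_wbox.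
  rewrite (_ : (fun z => _) = setT `&` h @^-1` `]0, +oo[%classic).
    by apply: mh => //; exact: measurable_itv.
  by rewrite setTI; apply/seteqP; split => z /=; rewrite in_itv/= andbT.
have F0 k : measH (F k) = 0%E.
  rewrite /F; case: (unpickle k) => [[m j]|]; last by rewrite measure0.
  case: eqP => [az|_]; last by rewrite measure0.
  apply: (gaugeH_null (C := whitney_ratio * wvol m) r0) => //.
  - exact: measurable_wbox.
  - by move=> l l0; apply: dom; rewrite az.
apply/eqP; rewrite eq_le measure_ge0 andbT -(measH_bigcup_null mF F0).
apply: measH_le_set => z [z0 hf]; have zj := wbox_mem z0.
set m := lev z.2 in zj; set j := cell m z.1 in zj.
have az : a m j = 0.
  apply/eqP; apply: contrapT => /negP az; apply: hf; rewrite (fpos m j z zj)//.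
  by rewrite lt_neqAle eq_sym az a0.
have [k kE] : exists k, unpickle k = Some (m, j) by exists (pickle (m, j)); exact: pickleK.
exists k; first exact: I.
rewrite /F kE az eqxx; split; first exact: zj.
rewrite lt_neqAle h0 andbT; apply/negP => /eqP hz; apply: hf.
by rewrite -hz (fzero m j z zj az).
Qed.

(** The bound is linear in K with a constant depending only on the level and p. Letting K tend to 0
    shows that norm 0 makes all coefficients vanish. *)
Lemma certificate_bound (p : \bar R) m : (0 < p)%E -> exists2 L : R, 0 < L &
  forall q (K : R) a E g j, (0 < q)%E -> 0 < K -> (forall m j, 0 <= a m j) ->
    certificate (3 / 4) p q K a E g -> a m j <= K * L.
Proof.
move=> p0; set v := side m ^+ n; have v0 : 0 < v by rewrite exprn_gt0// side_gt0.
have lower q (K : R) a E g x : (0 < q)%E -> 0 < K -> (forall m j, 0 <= a m j) ->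
    certificate (3 / 4) p q K a E g -> E m x -> a m (cell m x) <= K * g x.
  move=> q0 K0 a0 [_ _ [_ g0] _ lq] Ex.
  have u0 m' : 0 <= a m' (cell m' x) * \1_(E m') x by rewrite mulr_ge0.
  have := lq_bound_ge m q0 (mulr_ge0 (ltW K0) (g0 x)) u0 (lq x).
  by rewrite indicE mem_set// mulr1.
case/exponentP: (p0) lower => [s s0 -> _|-> _] lower.
  (* If a > K L, then g > L on [E m] inside the cell. Since L^s = 2 / v and this part has volume at
     least 3 v / 4, the integral of g^s would be at least 3/2. *)
  exists ((2 / v) `^ s^-1); first by apply: powR_gt0; rewrite divr_gt0.
  set L := _ `^ _ => q K a E g j q0 K0 a0 cert; rewrite leNgt; apply/negP => h.
  have [mE fE [mg g0] lp _] := cert.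
  set Q := cell m @^-1` [set j]; have mQ : measurable Q by exact: measurable_cell.
  have : ((2 / v)%:E * leb_n (E m `&` Q) <= 1)%E.
    apply: le_trans lp; rewrite muleC -int_Rn_indicZ ?lee_fin ?divr_ge0 ?(ltW v0)//; last exact: measurableI.
    rewrite int_RnE; last 2 first.
    - apply: emeasurable_funM => //; apply/measurable_EFinP; apply: measurable_indic; exact: measurableI.
    - by move=> x; rewrite mule_ge0 ?lee_fin// divr_ge0// ltW.
    apply: ge0_le_integral_nomeas => x _; first by rewrite mule_ge0 ?lee_fin// divr_ge0// ltW.
    rewrite indicE; case: (boolP (x \in _)) => [/set_mem[Ex xj]|_]; last by rewrite mul0e lee_fin powR_ge0.
    rewrite mul1e lee_fin.
    have -> : 2 / v = L `^ s.
      by rewrite /L -powRrM mulVf ?gt_eqF// powRr1// divr_ge0// ltW.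
    apply: powR_ler; rewrite ?(ltW s0) ?powR_ge0//.
    have := lower q K a E g x q0 K0 a0 cert Ex; rewrite xj => h'.
    by have := lt_le_trans h h'; rewrite ltr_pM2l// => /ltW.
  have := fE m j; rewrite -/Q leb_n_cell -/v => /(lee_wpmul2l (x := (2 / v)%:E)).
  rewrite lee_fin divr_ge0 ?(ltW v0)// => /(_ isT) h1 h2.
  have := le_trans h1 h2; rewrite -!EFinM lee_fin.
  rewrite (_ : 2 / v * _ = 3 / 2); last by field; rewrite gt_eqF.
  by lra.
exists 1; first exact: ltr01.
move=> q K a E g j q0 K0 a0 cert; have [mE fE [mg g0] lp _] := cert.
have [x [Ex xj]] : exists x, E m x /\ cell m x = j.
  apply: contrapT => h; have := fE m j.
  rewrite (_ : E m `&` _ = set0) ?measure0; last first.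
    by apply/seteqP; split => // x [Ex xj]; apply: h; exists x.
  rewrite leb_n_cell -/v -EFinM lee_fin; lra.
have := lower q K a E g x q0 K0 a0 cert Ex; rewrite xj => /le_trans; apply.
by rewrite ler_wpM2l ?(ltW K0)//; exact: lp.
Qed.

Lemma tent_norm_ge0 p q (G : n.-tuple R * R -> \bar R) : (forall z, 0 < z.2 -> (0 <= G z)%E) -> (0 <= tent_norm p q G)%E.
Proof.
move=> G0; rewrite /tent_norm.
case: (_ && _); first exact: poweR_ge0.
case: (_ && _).
  apply: le_ereal_sup_tmp; set c : n.-tuple R := [tuple 0 | i < n].
  eexists; first by exists c, c, 1; split; [exact: ltr01|split; [rewrite /eball/= edistxx|reflexivity]].
  exact: poweR_ge0.
case: (_ && _); first exact: poweR_ge0.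
apply: le_ereal_inf_tmp => M /= M0; rewrite leNgt; apply/negP => Mneg.
pose j : n.-tuple int := [tuple 0 | i < n].
have : (measH (wbox 0%R j) <= 0)%E.
  rewrite -M0; apply: measH_le_set => z /wbox_pos z0; split => //.
  exact: lt_le_trans Mneg (G0 z z0).
by rewrite measH_wbox lee_fin leNgt wvol_gt0.
Qed.

Lemma tent_factor p0 p1 p2 q0 q1 q2 r0 r1 r2 : (0 < p0)%E -> (0 < p1)%E -> (0 < p2)%E ->
  (0 < q0)%E -> (0 < q1)%E -> (0 < q2)%E -> (0 < r0)%E -> (0 < r1)%E -> (0 < r2)%E ->
  einv p0 = einv p1 + einv p2 -> einv q0 = einv q1 + einv q2 -> einv r0 = einv r1 + einv r2 ->
  exists2 C : R, 0 < C & forall h : n.-tuple R * R -> R,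
    measurable_fun [set: n.-tuple R * R] h -> (forall w, 0 <= h w) ->
    let N p q r (f : n.-tuple R * R -> R) :=
      tent_norm p q (whitney_avg a1 a2 r (fun w => (f w)%:E)) in
    (N p0 q0 r0 h < +oo)%E ->
    exists h1 h2 : n.-tuple R * R -> R,
      [/\ measurable_fun [set: n.-tuple R * R] h1 /\ measurable_fun [set: n.-tuple R * R] h2,
          (forall w, 0 <= h1 w) /\ (forall w, 0 <= h2 w),
          (N p1 q1 r1 h1 < +oo)%E /\ (N p2 q2 r2 h2 < +oo)%E,
          measH [set z | upper z /\ h z <> h1 z * h2 z] = 0%E &
          (N p1 q1 r1 h1 * N p2 q2 r2 h2 <= C%:E * N p0 q0 r0 h)%E].
Proof.
move=> p00 p10 p20 q00 q10 q20 r00 r10 r20 pE qE rE.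
have [s1 [s2 [s10 s20 sE sE1 sE2]]] := einv_weights p00 p10 p20 pE.
have [t1 [t2 [t10 t20 tE tE1 tE2]]] := einv_weights q00 q10 q20 qE.
have [k1 [k2 [k10 k20 kE kE1 kE2]]] := einv_weights r00 r10 r20 rE.
have [C0 C00 H0] := whitney_certificate p00 q00 r00.
have [C1 C10 H1] := factor_side p00 q00 r00 p10 q10 r10 s10 t10 k10 sE1 tE1 kE1.
have [C2 C20 H2] := factor_side p00 q00 r00 p20 q20 r20 s20 t20 k20 sE2 tE2 kE2.
exists (C1 * C2 * C0); first by rewrite !mulr_gt0.
move=> h mh h0 N Nfin; set a := boxavg r0 h.
have a0 m j : 0 <= a m j by exact: boxavg_ge0.
have N0 p q r f : (forall w, 0 <= f w) -> (0 <= N p q r f)%E.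
  by move=> f0; apply: tent_norm_ge0 => z z0; exact: whitney_avg_ge0.
pose b1 K M := factor k1 h a (split_weights t1 s1 K a M).
pose b2 K M := factor k2 h a (split_weights t2 s2 K a M).
have fac0 k t s K M w : 0 <= factor k h a (split_weights t s K a M) w.
  rewrite mulr_ge0 ?powR_ge0// /onbox; case: boxof => // mj; exact: split_weights_ge0.
have main K : 0 < K -> (N p0 q0 r0 h <= K%:E)%E -> exists M : int -> n.-tuple int -> R,
    [/\ dominates r0 h a, (forall m j, 0 < a m j -> 0 < C0 * K * M m j)%R,
      (N p1 q1 r1 (b1 (C0 * K)%R M) < +oo)%E, (N p2 q2 r2 (b2 (C0 * K)%R M) < +oo)%E &
      (N p1 q1 r1 (b1 (C0 * K)%R M) * N p2 q2 r2 (b2 (C0 * K)%R M) <= (C1 * C2 * C0 * K)%:E)%E].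
  move=> K0 NK; have [dom [E [g cert]]] := H0 K h K0 mh h0 NK.
  have CK : 0 < C0 * K by exact: mulr_gt0.
  have [M med] : exists M, cell_median_of g M.
    by case: cert => _ _ [mg g0] _ _; exact: cell_median_exists.
  have n1 := H1 _ _ _ _ _ _ CK mh h0 a0 dom cert med.
  have n2 := H2 _ _ _ _ _ _ CK mh h0 a0 dom cert med.
  exists M; split.
  - exact: dom.
  - by move=> m j aj; apply: mulr_gt0 => //; exact: (median_gt0 q00 CK cert).
  - by apply: le_lt_trans n1 _; rewrite ltry.
  - by apply: le_lt_trans n2 _; rewrite ltry.
  - apply: le_trans (lee_pmul _ _ n1 n2) _; [exact: N0|exact: N0|].
    (* The weights s1 and s2 add up to 1, so the two powers of C0 K multiply to C0 K. *)
    rewrite -EFinM lee_fin mulrACA -powRD ?sE ?oner_eq0// powRr1 ?(ltW CK)//.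
    by rewrite !mulrA.
have Nh0 : (0 <= N p0 q0 r0 h)%E by exact: N0.
have NE : N p0 q0 r0 h = (fine (N p0 q0 r0 h))%:E by rewrite fineK// ge0_fin_numE.
set K := fine _ in NE; have K0 : 0 <= K by rewrite -lee_fin -NE.
(* Certificates require a positive K, so norm 0 is treated apart. *)
have [Kz|Kz] := eqVneq K 0; last first.
  have Kp : 0 < K by rewrite lt_neqAle eq_sym Kz.
  have NK : (N p0 q0 r0 h <= K%:E)%E by rewrite NE.
  have [M [dom KM f1 f2 f12]] := main K Kp NK.
  exists (b1 (C0 * K) M), (b2 (C0 * K) M); split; last 1 first.
  - by rewrite NE -EFinM.
  - by split; exact: measurable_factor.
  - by split => w; exact: fac0.
  - by split; [exact: f1|exact: f2].
  - apply: (measH_off_null r00 mh h0 a0 dom).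
    + by move=> m j z zj aj; exact: (factor_mulE kE tE sE h0 zj aj (KM m j aj)).
    + move=> m j z zj az; rewrite /b1 {1}/factor (onboxE (split_weights _ _ _ _ _) zj).
      by rewrite {1}/split_weights az eqxx mulr0 mul0r.
have az m j : a m j = 0.
  have [L L0 HL] := certificate_bound m p00.
  apply/eqP; rewrite eq_le a0 andbT; apply/ler_addgt0Pl => e e0; rewrite addr0.
  have Ke : 0 < e / (C0 * L) by rewrite divr_gt0// mulr_gt0.
  have [|dom [E [g cert]]] := H0 _ h Ke mh h0; first by rewrite -/(N p0 q0 r0 h) NE Kz lee_fin ltW.
  apply: le_trans (HL _ _ _ _ _ _ q00 _ a0 cert) _; first exact: mulr_gt0.
  by rewrite le_eqVlt; apply/orP; left; apply/eqP; field; rewrite !gt_eqF.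
have zE k t s K' M : factor k h a (split_weights t s K' a M) = fun=> 0.
  apply/funext => z; rewrite /factor (_ : onbox (split_weights _ _ _ _ _) z = 0) ?mulr0//.
  by rewrite /onbox; case: boxof => // mj; rewrite /split_weights az eqxx.
(* With all coefficients 0 both factors are the zero function, whatever K is. Applying [main] to
   arbitrarily small K bounds the product of their norms, without computing the tent norm of 0 case
   by case. *)
have small e : 0 < e -> exists2 M : int -> n.-tuple int -> R, dominates r0 h a &
    [/\ (N p1 q1 r1 (fun=> 0%R) < +oo)%E, (N p2 q2 r2 (fun=> 0%R) < +oo)%E &
     (N p1 q1 r1 (fun=> 0%R) * N p2 q2 r2 (fun=> 0%R) <= (C1 * C2 * C0 * e)%:E)%E].
  move=> e0; have [|M [dom _ n1 n2 n12]] := main e e0; first by rewrite NE Kz lee_fin ltW.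
  have e1 : b1 (C0 * e) M = fun=> 0 by exact: zE.
  have e2 : b2 (C0 * e) M = fun=> 0 by exact: zE.
  by rewrite e1 in n1 n12; rewrite e2 in n2 n12; exists M; [exact: dom|split; [exact: n1|exact: n2|exact: n12]].
have [_ dom [n1 n2 _]] := small 1 ltr01.
exists (fun=> 0), (fun=> 0); split.
- by split; exact: measurable_cst.
- by split=> w.
- by split; [exact: n1|exact: n2].
- apply: (measH_off_null r00 mh h0 a0 dom).
  + by move=> m j z _; rewrite az ltxx.
  + by move=> m j z _ _; rewrite mulr0.
rewrite NE Kz mule0; apply/lee_addgt0Pr => e e0; rewrite add0e.
have CC : 0 < C1 * C2 * C0 by rewrite !mulr_gt0.
have [_ _ [_ _ h']] := small (e / (C1 * C2 * C0)) (divr_gt0 e0 CC).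
by apply: le_trans h' _; rewrite mulrC divfK// gt_eqF.
Qed.

(** * Complex-valued functions *)

Lemma esssupH_congr (A : set (n.-tuple R * R)) (g h : n.-tuple R * R -> \bar R) :
  (forall z, A z -> g z = h z) -> esssupH A g = esssupH A h.
Proof.
move=> gh; congr ereal_inf; apply/funext => M; congr (measH _ = _).
apply/seteqP; split => w [Aw] Mw; split => //=; first by rewrite -gh.
by rewrite gh.
Qed.

Lemma whitney_avg_congr r (g h : n.-tuple R * R -> \bar R) z : (forall w, 0 < w.2 -> g w = h w) ->
  0 < z.2 -> whitney_avg a1 a2 r g z = whitney_avg a1 a2 r h z.
Proof.
move=> gh z0; have gW w : whitney a1 a2 z w -> g w = h w by move/(whitney_upper z0)/gh.
rewrite /whitney_avg/=; case: (r == +oo%E).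
  exact: esssupH_congr.
congr poweR; congr (_ * _)%E; congr intH; apply/funext => w; rewrite indicE.
by case: (boolP (w \in whitney a1 a2 z)) => [/set_mem wW|_]; [rewrite gW|rewrite !mul0e].
Qed.

Lemma tent_norm_congr p q (g h : n.-tuple R * R -> \bar R) : (forall z, 0 < z.2 -> g z = h z) ->
  tent_norm p q g = tent_norm p q h.
Proof.
move=> gh.
have cE (A : set (n.-tuple R * R)) (F : \bar R -> n.-tuple R * R -> \bar R) :
    (forall z, A z -> 0 < z.2) -> intH (fun z => (\1_A z)%:E * F (g z) z)%E =
    intH (fun z => (\1_A z)%:E * F (h z) z)%E.
  move=> A0; congr intH; apply/funext => z; rewrite indicE.
  by case: (boolP (z \in A)) => [/set_mem/A0 z0|_]; [rewrite gh|rewrite !mul0e].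
rewrite /tent_norm.
have -> : (fun x : n.-tuple R => poweR (intH (fun z => (\1_(cone x) z)%:E *
      (poweR (g z) (fine q) * ((z.2 ^+ n.+1)^-1)%:E))%E) (fine p / fine q)) =
    (fun x => poweR (intH (fun z => (\1_(cone x) z)%:E *
      (poweR (h z) (fine q) * ((z.2 ^+ n.+1)^-1)%:E))%E) (fine p / fine q)).
  apply/funext => x; congr poweR.
  by apply: (cE _ (fun y z => poweR y (fine q) * ((z.2 ^+ n.+1)^-1)%:E)%E) => z [].
have tE (B : set (n.-tuple R)) :
    intH (fun z => (\1_(tent B) z)%:E * (poweR (g z) (fine q) * (z.2^-1)%:E))%E =
    intH (fun z => (\1_(tent B) z)%:E * (poweR (h z) (fine q) * (z.2^-1)%:E))%E.
  by apply: (cE _ (fun y z => poweR y (fine q) * (z.2^-1)%:E)%E) => z [].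
have -> : (fun x : n.-tuple R => poweR (ereal_sup (g @` cone x)) (fine p)) =
    (fun x => poweR (ereal_sup (h @` cone x)) (fine p)).
  by apply/funext => x; rewrite (@eq_imagel _ _ (cone x) g h)// => z [z0 _]; exact: gh.
have -> : esssupH (@upper R n) g = esssupH (@upper R n) h by exact: esssupH_congr.
case: (_ && _); first by [].
case: (_ && _); last by case: (_ && _).
congr ereal_sup.
by apply/seteqP; split => _ [x [c [rho [rho0 [xc ->]]]]]; exists x, c, rho; split => //; split => //; rewrite tE.
Qed.

End WhitneyBoxes.

Section ComplexValued.
Variables (R : realType) (n : nat).

Lemma normc_ge0 (x : R[i]) : 0 <= Normc.normc x.
Proof. by case: x => a b; exact: sqrtr_ge0. Qed.

(** Set to 0 off the half-space to be measurable everywhere, as [cmeasurable] speaks only of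
    [upper]; the norms do not see the change. *)
Definition weighted_norm (b : R) (f : n.-tuple R * R -> R[i]) : n.-tuple R * R -> R :=
  fun z => if 0 < z.2 then Normc.normc (f z) * z.2 `^ (- b) else 0.

Lemma weighted_normE b f z : 0 < z.2 -> weighted_norm b f z = Normc.normc (f z) * z.2 `^ (- b).
Proof. by move=> z0; rewrite /weighted_norm z0. Qed.

Lemma weighted_norm_ge0 b f z : 0 <= weighted_norm b f z.
Proof.
by rewrite /weighted_norm; case: ifP => // _; rewrite mulr_ge0 ?normc_ge0 ?powR_ge0.
Qed.

Lemma measurable_height_powR (b : R) :
  measurable_fun [set: n.-tuple R * R] (fun z : n.-tuple R * R => z.2 `^ b).
Proof. exact: measurableT_comp (measurable_powR b) measurable_snd. Qed.

Lemma measurable_weighted_norm b f : cmeasurable f ->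
  measurable_fun [set: n.-tuple R * R] (weighted_norm b f).
Proof.
move=> [mre mim]; apply: measurable_fun_if => //.
  by apply: measurable_fun_ltr; [exact: measurable_cst|exact: measurable_snd].
rewrite (_ : _ `&` _ = @upper R n); last by apply/seteqP; split => z => [[]|].
apply: measurable_funM; last exact: measurable_funTS (measurable_height_powR _).
apply: (@eq_measurable_fun _ _ _ _ _ (fun z => (complex.Re (f z) ^+ 2 + complex.Im (f z) ^+ 2) `^ 2^-1)).
  by move=> z _; rewrite powR12_sqrt ?addr_ge0 ?sqr_ge0//; case: (f z).
apply: (measurableT_comp (measurable_powR 2^-1)).
by apply: measurable_funD; exact: measurable_funX.
Qed.

Lemma wtent_normE a1 a2 (ha1 : 0 < a1) (ha12 : a1 < a2^-1) (ha2 : a2^-1 < 1) p q r b f :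
  wtent_norm a1 a2 p q r b f =
  tent_norm p q (whitney_avg a1 a2 r (fun w => (weighted_norm b f w)%:E)).
Proof.
apply: tent_norm_congr => z z0; apply: whitney_avg_congr => // w w0.
by rewrite weighted_normE.
Qed.

Lemma cmeasurableM (f1 f2 : n.-tuple R * R -> R[i]) : cmeasurable f1 -> cmeasurable f2 ->
  cmeasurable (fun z => f1 z * f2 z).
Proof.
move=> [r1 i1] [r2 i2]; split.
- apply: (@eq_measurable_fun _ _ _ _ _ (fun z => complex.Re (f1 z) * complex.Re (f2 z) -
    complex.Im (f1 z) * complex.Im (f2 z))).
    by move=> z _; case: (f1 z) => ? ?; case: (f2 z).
  by apply: measurable_funB; exact: measurable_funM.
- apply: (@eq_measurable_fun _ _ _ _ _ (fun z => complex.Re (f1 z) * complex.Im (f2 z) +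
    complex.Im (f1 z) * complex.Re (f2 z))).
    by move=> z _; case: (f1 z) => ? ?; case: (f2 z).
  by apply: measurable_funD; exact: measurable_funM.
Qed.

Lemma weighted_normM b1 b2 (f1 f2 : n.-tuple R * R -> R[i]) z :
  weighted_norm (b1 + b2) (fun z => f1 z * f2 z) z = weighted_norm b1 f1 z * weighted_norm b2 f2 z.
Proof.
have [z0|z0] := ltP 0 z.2.
  rewrite !weighted_normE// Normc.normcM opprD powRD ?(gt_eqF z0) ?implybT//.
  by rewrite mulrACA.
by rewrite /weighted_norm ltNge z0/= mul0r.
Qed.

(** Undoes the weight, so that a nonnegative real factor becomes a complex function with the
    prescribed modulus. *)
Definition height_lift (b : R) (h : n.-tuple R * R -> R) (z : n.-tuple R * R) : R[i] :=
  ((h z * z.2 `^ b)%:C)%C.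

Lemma normc_height_lift b h z : 0 <= h z -> Normc.normc (height_lift b h z) = h z * z.2 `^ b.
Proof. by move=> h0; rewrite /= expr0n addr0 sqrtr_sqr ger0_norm// mulr_ge0// powR_ge0. Qed.

Lemma weighted_norm_height_lift b h z : 0 <= h z -> 0 < z.2 ->
  weighted_norm b (height_lift b h) z = h z.
Proof.
move=> h0 z0; rewrite weighted_normE// normc_height_lift// -mulrA -powRD; last first.
  by rewrite (gt_eqF z0) implybT.
by rewrite subrr powRr0 mulr1.
Qed.

Lemma cmeasurable_height_lift b h : measurable_fun [set: n.-tuple R * R] h ->
  cmeasurable (height_lift b h).
Proof.
move=> mh; split => /=; last exact: measurable_cst.
by apply: measurable_funTS; apply: measurable_funM => //; exact: measurable_height_powR.
Qed.

Lemma normc_of_weighted_norm b1 b2 f h1 h2 z : 0 < z.2 -> 0 <= h1 z -> 0 <= h2 z ->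
  weighted_norm (b1 + b2) f z = h1 z * h2 z ->
  Normc.normc (f z) = Normc.normc (height_lift b1 h1 z) * Normc.normc (height_lift b2 h2 z).
Proof.
move=> z0 h10 h20 e; rewrite (normc_height_lift b1 h10) (normc_height_lift b2 h20).
rewrite mulrACA -e -powRD; last by rewrite (gt_eqF z0) implybT.
by rewrite weighted_normE// -mulrA -powRD ?(gt_eqF z0) ?implybT// addNr powRr0 mulr1.
Qed.

End ComplexValued.

Lemma wtent_norm_height_lift (R : realType) (n : nat) (a1 a2 : R) (ha1 : 0 < a1)
    (ha12 : a1 < a2^-1) (ha2 : a2^-1 < 1) p q r b (h : n.-tuple R * R -> R) :
  (forall w, 0 <= h w) -> wtent_norm a1 a2 p q r b (height_lift b h) =
    tent_norm p q (whitney_avg a1 a2 r (fun w => (h w)%:E)).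
Proof.
move=> h0; rewrite (wtent_normE ha1 ha12 ha2); apply: tent_norm_congr => z z0.
apply: (whitney_avg_congr ha1 ha12 ha2) => [w w0|]; last exact: z0.
by rewrite weighted_norm_height_lift.
Qed.

Lemma wtent_norm_ge0 (R : realType) (n : nat) (hn : (0 < n)%N) (a1 a2 : R) (ha1 : 0 < a1)
    (ha12 : a1 < a2^-1) (ha2 : a2^-1 < 1) p q r b (f : n.-tuple R * R -> R[i]) :
  (0 <= wtent_norm a1 a2 p q r b f)%E.
Proof.
rewrite (wtent_normE ha1 ha12 ha2); apply: (tent_norm_ge0 ha1 ha12 ha2) => z z0.
by apply: (whitney_avg_ge0 hn ha1 ha12 ha2 r z0) => w; exact: weighted_norm_ge0.
Qed.

Lemma ge0_lty_fineE (R : realType) (x : \bar R) : (0 <= x)%E -> (x < +oo)%E -> x = (fine x)%:E.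
Proof. by move=> x0 xy; rewrite fineK// ge0_fin_numE. Qed.

(** [tent_mul] asks for positive bounds on the norms, which may be 0; they are approached from
    above. *)
Lemma le_mul_of_bounds (R : realType) (C x y : R) (X : \bar R) : 0 < C -> 0 <= x -> 0 <= y ->
  (forall x' y', x < x' -> y < y' -> (X <= (C * (x' * y'))%:E)%E) -> (X <= (C * (x * y))%:E)%E.
Proof.
move=> C0 x0 y0 h; apply/lee_addgt0Pr => e e0.
have d0 : 0 < C * (x + y + 1) by rewrite mulr_gt0//; lra.
(* The product grows by t (x + y + t); t <= 1 replaces the last t by 1, and the second bound makes
   the total at most e. *)
pose t := Num.min 1 (e / (C * (x + y + 1))).
have t0 : 0 < t by rewrite lt_min ltr01 divr_gt0.
have t1 : t <= 1 by rewrite ge_min lexx.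
have te : t * (C * (x + y + 1)) <= e by rewrite -ler_pdivlMr// ge_min lexx orbT.
apply: (le_trans (h (x + t) (y + t) _ _)); [lra|lra|].
rewrite -EFinD lee_fin; apply: (@le_trans _ _ (C * (x * y) + t * (C * (x + y + 1)))).
  rewrite (_ : C * _ = C * (x * y) + t * (C * (x + y + t))); last by ring.
  by rewrite lerD2l ler_wpM2l ?(ltW t0)// ler_wpM2l ?(ltW C0)// lerD2l.
by rewrite lerD2l.
Qed.

Theorem theorem3p4 (R : realType) (n : nat) (hn : (0 < n)%N) (a1 a2 : R)
  (ha1 : 0 < a1) (ha12 : a1 < a2^-1) (ha2 : a2^-1 < 1)
  (p0 p1 p2 q0 q1 q2 r0 r1 r2 : \bar R) (b0 b1 b2 : R)
  (hp0 : (0 < p0)%E) (hp1 : (0 < p1)%E) (hp2 : (0 < p2)%E)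
  (hq0 : (0 < q0)%E) (hq1 : (0 < q1)%E) (hq2 : (0 < q2)%E)
  (hr0 : (0 < r0)%E) (hr1 : (0 < r1)%E) (hr2 : (0 < r2)%E)
  (Hp : einv p0 = einv p1 + einv p2)
  (Hq : einv q0 = einv q1 + einv q2)
  (Hr : einv r0 = einv r1 + einv r2)
  (Hb : b0 = b1 + b2) :
  (* multiplication  T0 <- T1 . T2 *)
  (exists C : R, 0 < C /\
     forall f1 f2 : n.-tuple R * R -> R[i],
       in_wtent a1 a2 p1 q1 r1 b1 f1 -> in_wtent a1 a2 p2 q2 r2 b2 f2 ->
       in_wtent a1 a2 p0 q0 r0 b0 (fun z => (f1 z * f2 z)%R) /\
       (wtent_norm a1 a2 p0 q0 r0 b0 (fun z => (f1 z * f2 z)%R)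
          <= C%:E * wtent_norm a1 a2 p1 q1 r1 b1 f1
                  * wtent_norm a1 a2 p2 q2 r2 b2 f2)%E)
  /\
  (* factorization  T0 -> T1 . T2 *)
  (exists C : R, 0 < C /\
     forall f0 : n.-tuple R * R -> R[i],
       in_wtent a1 a2 p0 q0 r0 b0 f0 ->
       exists f1 f2 : n.-tuple R * R -> R[i],
         in_wtent a1 a2 p1 q1 r1 b1 f1 /\ in_wtent a1 a2 p2 q2 r2 b2 f2 /\
         measH [set z | upper z /\
                  Normc.normc (f0 z) <> Normc.normc (f1 z) * Normc.normc (f2 z)]
           = 0%E /\
         (wtent_norm a1 a2 p1 q1 r1 b1 f1 * wtent_norm a1 a2 p2 q2 r2 b2 f2
            <= C%:E * wtent_norm a1 a2 p0 q0 r0 b0 f0)%E).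
Proof.
subst b0; split.
- have [C C0 H] := tent_mul hn ha1 ha12 ha2 hp0 hp1 hp2 hq0 hq1 hq2 hr0 hr1 hr2 Hp Hq Hr.
  exists C; split; first exact: C0.
  move=> f1 f2 [m1 fin1] [m2 fin2].
  have E1 := ge0_lty_fineE (wtent_norm_ge0 hn ha1 ha12 ha2 p1 q1 r1 b1 f1) fin1.
  have E2 := ge0_lty_fineE (wtent_norm_ge0 hn ha1 ha12 ha2 p2 q2 r2 b2 f2) fin2.
  have x0 := fine_ge0 (wtent_norm_ge0 hn ha1 ha12 ha2 p1 q1 r1 b1 f1).
  have y0 := fine_ge0 (wtent_norm_ge0 hn ha1 ha12 ha2 p2 q2 r2 b2 f2).
  set x := fine _ in E1 x0; set y := fine _ in E2 y0.
  have bound : (wtent_norm a1 a2 p0 q0 r0 (b1 + b2) (fun z => (f1 z * f2 z)%R) <= (C * (x * y))%:E)%E.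
    apply: (le_mul_of_bounds C0 x0 y0) => x' y' xx yy.
    rewrite (wtent_normE ha1 ha12 ha2).
    rewrite (_ : (fun w => _) = (fun w => (weighted_norm b1 f1 w * weighted_norm b2 f2 w)%:E)); last first.
      by apply/funext => w; rewrite weighted_normM.
    apply: (H _ _ x' y' (le_lt_trans x0 xx) (le_lt_trans y0 yy) (measurable_weighted_norm b1 m1)
      (measurable_weighted_norm b2 m2) (weighted_norm_ge0 b1 f1) (weighted_norm_ge0 b2 f2)).
    + by rewrite -(wtent_normE ha1 ha12 ha2) E1 lee_fin ltW.
    + by rewrite -(wtent_normE ha1 ha12 ha2) E2 lee_fin ltW.
  split; first split.
  + exact: cmeasurableM.
  + by apply: le_lt_trans bound _; rewrite ltry.
  + by apply: le_trans bound _; rewrite E1 E2 -!EFinM -mulrA.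
have [C C0 H] := tent_factor hn ha1 ha12 ha2 hp0 hp1 hp2 hq0 hq1 hq2 hr0 hr1 hr2 Hp Hq Hr.
exists C; split; first exact: C0.
move=> f0 [m0]; rewrite (wtent_normE ha1 ha12 ha2) => fin0.
have [h1 [h2 [[mh1 mh2] [h10 h20] [fin1 fin2] null le12]]] :=
  H _ (measurable_weighted_norm (b1 + b2) m0) (weighted_norm_ge0 (b1 + b2) f0) fin0.
exists (height_lift b1 h1), (height_lift b2 h2).
have E1 := wtent_norm_height_lift ha1 ha12 ha2 p1 q1 r1 b1 h10.
have E2 := wtent_norm_height_lift ha1 ha12 ha2 p2 q2 r2 b2 h20.
split; first by split; [exact: cmeasurable_height_lift|rewrite E1; exact: fin1].
split; first by split; [exact: cmeasurable_height_lift|rewrite E2; exact: fin2].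
split; last by rewrite E1 E2; exact: le12.
apply/eqP; rewrite eq_le measure_ge0 andbT -null; apply: measH_le_set => z [z0 hz].
split; first exact: z0.
by move=> e; apply: hz; exact: normc_of_weighted_norm z0 (h10 z) (h20 z) e.
Qed.
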